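(* Let $p$ be a prime and let $B_p$ be the quaternion algebra over $\mathbb{Q}$ ramified precisely at $p$ and $\infty$. Then the following hold. (1) Let $\mathcal{O}$ and $\mathcal{O}'$ be maximal orders of $B_p$. If $\mathcal{O}'$ dominates $\mathcal{O}$ in the sense that $a_{\mathcal{O}'^T}(n)\geq a_{\mathcal{O}^T}(n)$ for all $n\in\mathbb{N}$, then $\mathcal{O}$ and $\mathcal{O}'$ are isomorphic (equivalently, they are of the same type, i.e. there is a nonzero $c\in B_p$ with $\mathcal{O}'=c^{-1}\mathcal{O}c$). (2) The algorithm of Chevyrev and Galbraith, which takes as input a maximal order $\mathcal{O}$ of $B_p$ and constructs a supersingular elliptic curve $E$ over $\mathbb{F}_{p^2}$ with $\operatorname{End}(E)\cong\mathcal{O}$, halts on every input $\mathcal{O}$.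
   Context: Quaternions. $B_p$ is the (unique up to isomorphism) definite quaternion algebra over $\mathbb{Q}$ ramified exactly at $p$ and $\infty$, with standard involution $h\mapsto\overline{h}$, reduced trace $\operatorname{Tr}(h)=h+\overline{h}$ and reduced norm $\operatorname{Nr}(h)=h\overline{h}$. Let $B_p^0=\{h\in B_p:\operatorname{Tr}(h)=0\}$. An order of $B_p$ is a rank 4 $\mathbb{Z}$-lattice in $B_p$ that is also a subring; it is maximal if it is not properly contained in another order. Gross lattice. For a maximal order $\mathcal{O}$ of $B_p$, set $\mathcal{O}^T:=(2\mathcal{O}+\mathbb{Z})\cap B_p^0=\{2x-\operatorname{Tr}(x):x\in\mathcal{O}\}$, a $\mathbb{Z}$-lattice of rank 3. Fix a $\mathbb{Z}$-basis $u_1,u_2,u_3$ of $\mathcal{O}^T$. For an integer $d\ge 0$ let $$a_{\mathcal{O}^T}(d):=\#\{h=h_1u_1+h_2u_2+h_3u_3\in\mathcal{O}^T:\ h_i\in\mathbb{Z},\ \operatorname{Nr}(h)=d,\ \gcd(h_1,h_2,h_3)=1\},$$ the number of primitive representations of $d$ by $\operatorname{Nr}$ on $\mathcal{O}^T$ (independent of the choice of basis). The algorithm. Chevyrev and Galbraith proved that their algorithm is correct whenever it halts, and that it satisfies the following halting criterion: on input a maximal order $\mathcal{O}$ of $B_p$, it halts unless there exists a maximal order $\mathcal{O}'$ of $B_p$, not conjugate to $\mathcal{O}$ in $B_p$, such that $a_{\mathcal{O}'^T}(n)\ge a_{\mathcal{O}^T}(n)$ for every integer $n\ge 0$. For part (2),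 the algorithm may be taken to be any procedure with maximal orders of $B_p$ as inputs that satisfies this halting criterion. *)

(* Defs.v *)
From HB Require Import structures.
From mathcomp Require Import all_boot all_order all_algebra.
From mathcomp Require Import finmap.
From mathcomp Require Import all_classical all_reals.
From mathcomp Require Import ring lra zify.

Set Implicit Arguments.
Unset Strict Implicit.
Unset Printing Implicit Defensive.

Import Order.TTheory GRing.Theory Num.Theory.
Local Open Scope classical_set_scope.
Local Open Scope ring_scope.

Lemma logn_nonprime l n : ~~ prime l -> logn l n = 0%N.
Proof. by move=> lP; rewrite lognE (negPf lP). Qed.

(* For l not prime, [logn l] is 0, so this is the trivial absolute value; thus
   no primality assumption is needed for the constructions below. *)
Definition padic_norm (l : nat) (q : rat) : rat :=
  if q == 0 then 0
  else l%:R ^ ((logn l `|denq q|%N)%:Z - (logn l `|numq q|%N)%:Z).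

Section PadicNorm.
Variable l : nat.
Local Notation N := (padic_norm l).

Lemma padic_norm0 : N 0 = 0.
Proof. by rewrite /padic_norm eqxx. Qed.

Let pow_gt0 (d m : nat) :
  0 < (l%:R : rat) ^ ((logn l d)%:Z - (logn l m)%:Z).
Proof.
case: (posnP l) => [->|l0]; last by apply: exprz_gt0; rewrite ltr0n.
by rewrite !logn_nonprime// subrr expr0z.
Qed.

Lemma padic_norm_gt0 q : q != 0 -> 0 < N q.
Proof. by rewrite /padic_norm => /negPf ->. Qed.

Lemma padic_norm_ge0 q : 0 <= N q.
Proof. by have [->|/padic_norm_gt0/ltW//] := eqVneq q 0; rewrite padic_norm0. Qed.

Lemma padic_norm_frac (m d : int) : m != 0 -> d != 0 ->
  N (m%:~R / d%:~R) = l%:R ^ ((logn l `|d|%N)%:Z - (logn l `|m|%N)%:Z).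
Proof.
move=> m0 d0; set q := _ / _.
have q0 : q != 0 by rewrite mulf_neq0 ?invr_eq0 ?intr_eq0.
rewrite /padic_norm (negPf q0); congr (_ ^ _).
have e : m * denq q = numq q * d.
  apply: (@intr_inj rat); rewrite !rmorphM /=.
  have := divq_num_den q; rewrite {3}/q => /eqP.
  by rewrite eqr_div ?intr_eq0 ?denq_eq0// => /eqP ->.
have e' : (logn l `|m| + logn l `|denq q| = logn l `|numq q| + logn l `|d|)%N.
  by rewrite -!lognM ?absz_gt0 ?denq_eq0 ?numq_eq0// -!abszM e.
by lia.
Qed.

Lemma padic_normM x y : N (x * y) = N x * N y.
Proof.
have [->|x0] := eqVneq x 0; first by rewrite mul0r padic_norm0 mul0r.
have [->|y0] := eqVneq y 0; first by rewrite mulr0 padic_norm0 mulr0.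
have -> : x * y = (numq x * numq y)%:~R / (denq x * denq y)%:~R.
  by rewrite -{1}(divq_num_den x) -{1}(divq_num_den y) !rmorphM /= mulf_div.
rewrite padic_norm_frac ?mulf_neq0 ?numq_eq0 ?denq_eq0//.
rewrite !abszM !lognM ?absz_gt0 ?numq_eq0 ?denq_eq0//.
rewrite /padic_norm (negPf x0) (negPf y0).
case: (posnP l) => [->|l0].
  by rewrite !logn_nonprime// subrr expr0z mulr1.
rewrite -expfzDr ?pnatr_eq0 -?lt0n//; congr (_ ^ _); lia.
Qed.

Lemma padic_norm1 : N 1 = 1.
Proof.
have /eqP := padic_normM 1 1; rewrite mulr1 -{1}[N 1]mulr1.
have := padic_norm_gt0 (oner_neq0 rat).
by move=> /lt0r_neq0 n0 /eqP/(mulfI n0) <-.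
Qed.

Lemma padic_normN x : N (- x) = N x.
Proof.
by rewrite /padic_norm oppr_eq0 numqN denqN abszN.
Qed.

Lemma padic_normV x : N x^-1 = (N x)^-1.
Proof.
have [->|x0] := eqVneq x 0; first by rewrite !(invr0, padic_norm0).
apply: (mulfI (lt0r_neq0 (padic_norm_gt0 x0))).
by rewrite -padic_normM !divff ?padic_norm1// lt0r_neq0// padic_norm_gt0.
Qed.

Let logn_add (m n : int) : m != 0 -> n != 0 -> m + n != 0 ->
  (minn (logn l `|m|) (logn l `|n|) <= logn l `|(m + n)%R|)%N.
Proof.
move=> m0 n0 s0; case: (boolP (prime l)) => [lP|lP]; last first.
  by rewrite !logn_nonprime.
rewrite -pfactor_dvdn ?absz_gt0//.
set k := minn _ _.
have dm : (l ^ k %| `|m|)%N by rewrite pfactor_dvdn ?absz_gt0// geq_minl.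
have dn : (l ^ k %| `|n|)%N by rewrite pfactor_dvdn ?absz_gt0// geq_minr.
have : ((l ^ k)%N%:Z %| m + n)%Z by apply: rpredD.
by [].
Qed.

Lemma padic_normD x y : N (x + y) <= Num.max (N x) (N y).
Proof.
have [->|x0] := eqVneq x 0; first by rewrite add0r le_max lexx orbT.
have [->|y0] := eqVneq y 0; first by rewrite addr0 le_max lexx.
have [->|s0] := eqVneq (x + y) 0.
  by rewrite padic_norm0 le_max padic_norm_ge0.
pose d := denq x * denq y; pose m := numq x * denq y; pose n := numq y * denq x.
have d0 : d != 0 by rewrite mulf_neq0 ?denq_eq0.
have m0 : m != 0 by rewrite mulf_neq0 ?denq_eq0 ?numq_eq0.
have n0 : n != 0 by rewrite mulf_neq0 ?denq_eq0 ?numq_eq0.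
have dx0 : (denq x)%:~R != 0 :> rat by rewrite intr_eq0 denq_eq0.
have dy0 : (denq y)%:~R != 0 :> rat by rewrite intr_eq0 denq_eq0.
have ex : x = m%:~R / d%:~R.
  by rewrite -{1}(divq_num_den x) /m /d !rmorphM /=; field; rewrite ?dx0 ?dy0.
have ey : y = n%:~R / d%:~R.
  by rewrite -{1}(divq_num_den y) /n /d !rmorphM /=; field; rewrite ?dx0 ?dy0.
have es : x + y = (m + n)%:~R / d%:~R.
  by rewrite {1}ex {1}ey rmorphD /= mulrDl.
have mn0 : m + n != 0.
  by apply: contraNneq s0 => mn0; rewrite es mn0 mul0r.
rewrite es {1}ex {1}ey !padic_norm_frac//.
have := logn_add m0 n0 mn0.
case: (leqP l 1) => [l1 _|l1 h].
  have lnp k : logn l k = 0%N by apply: logn_nonprime; case: l l1 => [|[|]].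
  by rewrite !lnp le_max lexx.
have l1r : 1 < (l%:R : rat) by rewrite ltr1n.
rewrite le_max !(ler_eXz2l l1r) !lerD2l !lerN2 !lez_nat.
by rewrite -geq_min.
Qed.

Lemma padic_normB_lt x y e : N x < e -> N y < e -> N (x - y) < e.
Proof.
move=> hx hy; apply: le_lt_trans (padic_normD _ _) _.
by rewrite padic_normN gt_max hx hy.
Qed.

End PadicNorm.

Definition is_cauchy (l : nat) (x : nat -> rat) : Prop :=
  forall e : rat, 0 < e -> exists N : nat, forall m n : nat,
    (N <= m)%N -> (N <= n)%N -> padic_norm l (x m - x n) < e.

Definition is_null (l : nat) (x : nat -> rat) : Prop :=
  forall e : rat, 0 < e -> exists N : nat, forall n : nat,
    (N <= n)%N -> padic_norm l (x n) < e.

Definition cauchy_pred (l : nat) : {pred nat -> rat} :=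
  fun x => `[< is_cauchy l x >].

Lemma cauchy_bounded l x : is_cauchy l x ->
  exists2 M : rat, 0 < M & exists N : nat, forall n, (N <= n)%N ->
    padic_norm l (x n) < M.
Proof.
move=> /(_ 1 ltr01)[N hN]; exists (padic_norm l (x N) + 1).
  by rewrite ltr_wpDl// padic_norm_ge0.
exists N => n Nn; rewrite -[x n](subrK (x N)).
apply: le_lt_trans (padic_normD _ _ _) _.
have := hN n N Nn (leqnn N); rewrite gt_max.
by have := padic_norm_ge0 l (x N); lra.
Qed.

Lemma cauchy_closed l : subring_closed (cauchy_pred l).
Proof.
split=> [|x y /asboolP hx /asboolP hy|x y /asboolP hx /asboolP hy];
  apply/asboolP.
- by move=> e e0; exists 0%N => m n _ _; rewrite subrr padic_norm0.
- move=> e e0; have [Nx hNx] := hx e e0; have [Ny hNy] := hy e e0.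
  exists (maxn Nx Ny) => m n; rewrite !geq_max => /andP[? ?] /andP[? ?].
  have -> : (x - y) m - (x - y) n = (x m - x n) - (y m - y n).
    by rewrite !(fctE, fct_sumE) /=; ring.
  by apply: padic_normB_lt; [apply: hNx|apply: hNy].
- move=> e e0; have [Mx Mx0 [Bx hBx]] := cauchy_bounded hx.
  have [My My0 [By hBy]] := cauchy_bounded hy.
  have [Nx hNx] := hx (e / My) (divr_gt0 e0 My0).
  have [Ny hNy] := hy (e / Mx) (divr_gt0 e0 Mx0).
  exists (maxn (maxn Nx Ny) (maxn Bx By)) => m n.
  rewrite !geq_max => /andP[/andP[a1 a2] /andP[a3 a4]].
  move=> /andP[/andP[b1 b2] /andP[b3 b4]].
  have -> : (x * y) m - (x * y) n =
      (x m - x n) * y m - x n * (y n - y m) by rewrite !fctE; ring.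
  apply: padic_normB_lt; rewrite padic_normM.
    rewrite -[ltRHS](divfK (lt0r_neq0 My0)).
    by rewrite ltr_pM ?padic_norm_ge0 ?hNx ?hBy.
  rewrite mulrC -[ltRHS](divfK (lt0r_neq0 Mx0)).
  by rewrite ltr_pM ?padic_norm_ge0 ?hNy ?hBx.
Qed.

HB.instance Definition _ (l : nat) :=
  GRing.isSubringClosed.Build (nat -> rat) (cauchy_pred l) (cauchy_closed l).

Record cauchy_seq (l : nat) :=
  CauchySeq { cauchy_val :> nat -> rat; _ : cauchy_val \in cauchy_pred l }.
HB.instance Definition _ l := [isSub for @cauchy_val l].
HB.instance Definition _ l := [Choice of cauchy_seq l by <:].
HB.instance Definition _ l :=
  [SubChoice_isSubComNzRing of cauchy_seq l by <:].

Definition null_pred (l : nat) : {pred cauchy_seq l} :=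
  fun x => `[< is_null l x >].
Arguments null_pred : clear implicits.

Lemma null_closed l : idealr_closed (null_pred l).
Proof.
split=> [||a x y /asboolP hx /asboolP hy].
- by apply/asboolP => e e0; exists 0%N => n _; rewrite padic_norm0.
- apply/asboolP => /(_ 1 ltr01)[N /(_ N (leqnn N))].
  by rewrite padic_norm1 ltxx.
- apply/asboolP => e e0.
  have /asboolP/cauchy_bounded[M M0 [B hB]] := valP a.
  have [Nx hNx] := hx (e / M) (divr_gt0 e0 M0); have [Ny hNy] := hy e e0.
  exists (maxn B (maxn Nx Ny)) => n; rewrite !geq_max => /and3P[? ? ?].
  apply: le_lt_trans (padic_normD _ _ _) _.
  rewrite gt_max hNy// andbT padic_normM.
  rewrite mulrC -[ltRHS](divfK (lt0r_neq0 M0)).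
  by rewrite ltr_pM ?padic_norm_ge0 ?hNx//; apply: hB.
Qed.

HB.instance Definition _ (l : nat) :=
  isIdealr.Build (cauchy_seq l) (null_pred l) (null_closed l).

(* The field Q_l of l-adic numbers, as the completion of Q: l-adic Cauchy
   sequences modulo null sequences. *)
Definition padic (l : nat) : Type := {ideal_quot (null_pred l)}.
HB.instance Definition _ l := GRing.ComNzRing.on (padic l).

Lemma cauchy_bounded_away l (x : nat -> rat) : is_cauchy l x -> ~ is_null l x ->
  exists2 d : rat, 0 < d & exists N : nat, forall n, (N <= n)%N ->
    d <= padic_norm l (x n).
Proof.
move=> hx /existsNP[e /not_implyP[e0 /forallNP hN]].
have [N hNe] := hx e e0; exists e => //; exists N => n Nn.
have /existsNP[k /not_implyP[Nk /negP]] := hN N; rewrite -leNgt => ek.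
rewrite leNgt; apply/negP => xn.
have : padic_norm l (x n - (x n - x k)) < e by rewrite padic_normB_lt// hNe.
by rewrite opprB addrC subrK ltNge ek.
Qed.

Lemma cauchy_inv l (x : nat -> rat) : is_cauchy l x -> ~ is_null l x ->
  is_cauchy l (fun n => (x n)^-1).
Proof.
move=> hx /(cauchy_bounded_away hx)[d d0 [N hN]] e e0.
have [M hM] := hx (e * (d * d)) (mulr_gt0 e0 (mulr_gt0 d0 d0)).
exists (maxn N M) => m n; rewrite !geq_max => /andP[Nm Mm] /andP[Nn Mn].
have x0 k : (N <= k)%N -> x k != 0.
  move=> /hN; apply: contraTneq => ->.
  by rewrite padic_norm0 -ltNge.
have -> : (x m)^-1 - (x n)^-1 = (x n - x m) * ((x m)^-1 * (x n)^-1).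
  by field; rewrite !x0.
rewrite !padic_normM !padic_normV -invfM ltr_pdivrMr; last first.
  by rewrite mulr_gt0// padic_norm_gt0// x0.
apply: lt_le_trans (hM _ _ Mn Mm) _.
by rewrite ler_pM2l// ler_pM ?hN// ltW.
Qed.

Lemma padic_has_inv l (x : padic l) : x != 0 -> exists y, y * x = 1.
Proof.
elim/quotW: x => c; rewrite piE Quotient.equivE subr0 => /asboolP c0.
have hc : is_cauchy l c by apply/asboolP; exact: valP c.
have dP : (fun n => (c n)^-1) \in cauchy_pred l.
  by apply/asboolP; exact: cauchy_inv.
pose d := CauchySeq dP.
exists (\pi_(padic l) d)%qT; rewrite -rmorphM -(rmorph1 (\pi_(padic l))%qT).
apply/eqP; rewrite -Quotient.idealrBE; apply/asboolP => e e0.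
have [r r0 [N hN]] := cauchy_bounded_away hc c0.
exists N => n /hN rn; rewrite (_ : _ n = (c n)^-1 * c n - 1)//.
rewrite mulVf ?subrr ?padic_norm0//.
by apply: contraTneq rn => ->; rewrite padic_norm0 -ltNge.
Qed.

Definition padic_inv l (x : padic l) : padic l :=
  if x == 0 then 0 else xget 0 [set y | y * x = 1].

Lemma padic_mulVf l (x : padic l) : x != 0 -> padic_inv x * x = 1.
Proof.
move=> x0; rewrite /padic_inv (negPf x0).
by case: xgetP => [y _ //|]; have [y yx /(_ y)] := padic_has_inv x0.
Qed.

Lemma padic_inv0 l : padic_inv (0 : padic l) = 0.
Proof. by rewrite /padic_inv eqxx. Qed.

HB.instance Definition _ l :=
  GRing.ComNzRing_isField.Build (padic l) (@padic_mulVf l) (@padic_inv0 l).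

(* The quaternion algebra (a, b | F) with basis 1, i, j, k = i j, where
   i^2 = a, j^2 = b and j i = - i j. *)
Record quat (F : fieldType) (a b : F) := Quat { qre : F; qi : F; qj : F; qk : F }.

Section QuaternionAlgebra.
Variables (F : fieldType) (a b : F).
Local Notation B := (quat a b).
Implicit Types x y z : B.

Definition quat_row x : 'rV[F]_4 := \row_k [:: qre x; qi x; qj x; qk x]`_k.
Definition row_quat (r : 'rV[F]_4) : B :=
  Quat a b (r 0 (inord 0)) (r 0 (inord 1)) (r 0 (inord 2)) (r 0 (inord 3)).

Lemma quat_rowK : cancel quat_row row_quat.
Proof. by case=> *; rewrite /row_quat !mxE !inordK. Qed.

Lemma row_quatK : cancel row_quat quat_row.
Proof.
move=> r; apply/rowP => k; rewrite mxE /=.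
by case: k => [[|[|[|[|//]]]] kP] /=; congr (r 0 _); apply/val_inj;
  rewrite /= inordK.
Qed.

HB.instance Definition _ := Choice.copy B (can_type quat_rowK).

Definition quat_add x y : B :=
  Quat a b (qre x + qre y) (qi x + qi y) (qj x + qj y) (qk x + qk y).
Definition quat_opp x : B := Quat a b (- qre x) (- qi x) (- qj x) (- qk x).
Definition quat_scale (c : F) x : B :=
  Quat a b (c * qre x) (c * qi x) (c * qj x) (c * qk x).
Definition quat_mul x y : B := Quat a b
  (qre x * qre y + a * (qi x * qi y) + b * (qj x * qj y)
    - a * b * (qk x * qk y))
  (qre x * qi y + qi x * qre y - b * (qj x * qk y) + b * (qk x * qj y))
  (qre x * qj y + qj x * qre y + a * (qi x * qk y) - a * (qk x * qi y))
  (qre x * qk y + qk x * qre y + qi x * qj y - qj x * qi y).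

Lemma quat_addA : associative quat_add.
Proof. by move=> [????] [????] [????]; rewrite /quat_add /= !addrA. Qed.
Lemma quat_addC : commutative quat_add.
Proof. by move=> [????] [????]; congr Quat; rewrite /= addrC. Qed.
Lemma quat_add0 : left_id (Quat a b 0 0 0 0) quat_add.
Proof. by move=> [????]; rewrite /quat_add /= !add0r. Qed.
Lemma quat_addN : left_inverse (Quat a b 0 0 0 0) quat_opp quat_add.
Proof. by move=> [????]; rewrite /quat_add /= !addNr. Qed.

HB.instance Definition _ :=
  GRing.isZmodule.Build B quat_addA quat_addC quat_add0 quat_addN.

Lemma quat_scaleA c d x : quat_scale c (quat_scale d x) = quat_scale (c * d) x.
Proof. by case: x => *; rewrite /quat_scale /= !mulrA. Qed.
Lemma quat_scale1 : left_id 1 quat_scale.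
Proof. by move=> [????]; rewrite /quat_scale /= !mul1r. Qed.
Lemma quat_scaleDr : right_distributive quat_scale +%R.
Proof. by move=> c [????] [????]; congr Quat; rewrite /= mulrDr. Qed.
Lemma quat_scaleDl x : {morph quat_scale^~ x : c d / c + d}.
Proof. by move=> c d; congr Quat; rewrite /= mulrDl. Qed.

HB.instance Definition _ := GRing.Zmodule_isLmodule.Build F B
  quat_scaleA quat_scale1 quat_scaleDr quat_scaleDl.

Lemma quat_mulA : associative quat_mul.
Proof. by move=> [????] [????] [????]; congr Quat => /=; ring. Qed.
Lemma quat_mul1l : left_id (Quat a b 1 0 0 0) quat_mul.
Proof. by move=> [????]; congr Quat => /=; ring. Qed.
Lemma quat_mul1r : right_id (Quat a b 1 0 0 0) quat_mul.
Proof. by move=> [????]; congr Quat => /=; ring. Qed.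
Lemma quat_mulDl : left_distributive quat_mul +%R.
Proof. by move=> [????] [????] [????]; congr Quat => /=; ring. Qed.
Lemma quat_mulDr : right_distributive quat_mul +%R.
Proof. by move=> [????] [????] [????]; congr Quat => /=; ring. Qed.
Lemma quat_oner_neq0 : Quat a b 1 0 0 0 != 0.
Proof. by apply/eqP => -[] /eqP; rewrite oner_eq0. Qed.

HB.instance Definition _ := GRing.Zmodule_isNzRing.Build B
  quat_mulA quat_mul1l quat_mul1r quat_mulDl quat_mulDr quat_oner_neq0.

Lemma quat_scalerAl c x y : c *: (x * y) = (c *: x) * y.
Proof. by case: x y => [????] [????]; congr Quat => /=; ring. Qed.
HB.instance Definition _ := GRing.Lmodule_isLalgebra.Build F B quat_scalerAl.

Lemma quat_scalerAr c x y : c *: (x * y) = x * (c *: y).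
Proof. by case: x y => [????] [????]; congr Quat => /=; ring. Qed.
HB.instance Definition _ := GRing.Lalgebra_isAlgebra.Build F B quat_scalerAr.

Lemma quat_row_linear : linear quat_row.
Proof.
by move=> c x y; apply/rowP => k; rewrite !mxE;
  case: k => [[|[|[|[|//]]]] kP].
Qed.
HB.instance Definition _ := Lmodule_hasFinDim.Build F B
  (exist2 _ _ quat_row quat_row_linear (Bijective quat_rowK row_quatK)).

(* The standard involution. *)
Definition qconj x : B := Quat a b (qre x) (- qi x) (- qj x) (- qk x).

(* The reduced trace and norm, as elements of F; see [qtrE] and [qnrE]. *)
Definition qtr x : F := qre (x + qconj x).
Definition qnr x : F := qre (x * qconj x).

Lemma quat_algE (c : F) : c%:A = Quat a b c 0 0 0.
Proof. by congr Quat; rewrite /= ?mulr1 ?mulr0. Qed.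

Lemma qtrE x : x + qconj x = (qtr x)%:A.
Proof. by rewrite quat_algE; congr Quat; rewrite /= subrr. Qed.
Lemma qnrE x : x * qconj x = (qnr x)%:A.
Proof. by rewrite quat_algE; congr Quat => /=; ring. Qed.
Lemma qnrE' x : qconj x * x = (qnr x)%:A.
Proof. by rewrite quat_algE; congr Quat => /=; rewrite /qnr /=; ring. Qed.

Lemma qnrM x y : qnr (x * y) = qnr x * qnr y.
Proof. by case: x y => [????] [????]; rewrite /qnr /=; ring. Qed.
Lemma qnr1 : qnr 1 = 1.
Proof. by rewrite /qnr /=; ring. Qed.

Definition quat_unit : pred B := fun x => qnr x != 0.
Definition quat_inv x : B :=
  if qnr x != 0 then (qnr x)^-1 *: qconj x else x.

Lemma quat_mulVx : {in quat_unit, left_inverse 1 quat_inv *%R}.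
Proof.
move=> x xu; rewrite /quat_inv (xu : qnr x != 0) -scalerAl qnrE'.
by rewrite scalerA mulVf// scale1r.
Qed.
Lemma quat_mulxV : {in quat_unit, right_inverse 1 quat_inv *%R}.
Proof.
move=> x xu; rewrite /quat_inv (xu : qnr x != 0) -scalerAr qnrE.
by rewrite scalerA mulVf// scale1r.
Qed.
Lemma quat_unitP x y : y * x = 1 /\ x * y = 1 -> quat_unit x.
Proof.
move=> [yx _]; apply/eqP => x0; have := qnrM y x.
by rewrite yx qnr1 x0 mulr0 => /eqP; rewrite oner_eq0.
Qed.
Lemma quat_inv_out : {in [predC quat_unit], quat_inv =1 id}.
Proof. by move=> x xu; rewrite /quat_inv ifN. Qed.

HB.instance Definition _ := GRing.NzRing_hasMulInverse.Build B
  quat_mulVx quat_mulxV quat_unitP quat_inv_out.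

End QuaternionAlgebra.

(* For an extension K of Q, (a, b | K) is the scalar extension of (a, b | Q)
   to K; a place v is ramified when the scalar extension to the completion Q_v
   is a division algebra. *)
Definition ramified_over (K : fieldType) (a b : rat) : Prop :=
  forall x : quat (ratr a : K) (ratr b : K), x != 0 -> x \is a GRing.unit.

Definition ramified_exactly_at_p_oo (R : realType) (p : nat) (a b : rat) : Prop :=
  [/\ a != 0, b != 0, ramified_over R a b &
      forall l : nat, prime l -> (ramified_over (padic l) a b <-> l = p)].

Section Orders.
Variables (a b : rat).
Local Notation B := (quat a b).
Implicit Types (O : set B) (h : B).

Definition Zspan n (e : n.-tuple B) : set B :=
  [set h | exists z : 'I_n -> int, h = \sum_(i < n) e`_i *~ z i].

Definition Zbasis n (e : n.-tuple B) (L : set B) : Prop :=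
  free e /\ L = Zspan e.

Definition is_order O : Prop :=
  [/\ exists e : 4.-tuple B, Zbasis e O, O 1,
      forall x y, O x -> O y -> O (x - y) &
      forall x y, O x -> O y -> O (x * y)].

Definition maximal_order O : Prop :=
  is_order O /\ ~ exists2 O' : set B, is_order O' & O `<` O'.

Definition same_type O O' : Prop :=
  exists2 c : B, c != 0 & O' = [set c^-1 * x * c | x in O].

Definition isomorphic_orders O O' : Prop :=
  exists f : B -> B, [/\ set_bij O O' f, f 1 = 1,
    {in O &, {morph f : x y / x + y}} & {in O &, {morph f : x y / x * y}}].

Definition gross_lattice O : set B :=
  [set h | qtr h = 0 /\ exists2 x, O x & exists m : int, h = x *+ 2 + m%:~R].

Definition primitive_reps (u : 3.-tuple B) (d : nat) : set B :=
  [set h | exists z : 'I_3 -> int,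
     [/\ h = \sum_(i < 3) u`_i *~ z i, \big[gcdz/0]_(i < 3) z i = 1 & qnr h = d%:R]].

Definition gross_basis O : 3.-tuple B :=
  xget [tuple 0 | i < 3] [set u | Zbasis u (gross_lattice O)].

(* [fset_set] of an infinite set is empty, but [qnr] is positive definite when
   the algebra is ramified at oo, and then these sets are finite. *)
Definition gross_rep O (d : nat) : nat :=
  #|` fset_set (primitive_reps (gross_basis O) d)|.

Definition dominates O' O : Prop := forall n : nat, (gross_rep O n <= gross_rep O' n)%N.

End Orders.

(* A procedure: a transition system that, on input x, runs from the state
   [init x] until a step returns an output. *)
Record procedure (In Out : Type) := Procedure {
  state : Type;
  init : In -> state;
  step : state -> Out + state
}.

Inductive halts_from In Out (A : procedure In Out) : state A -> Prop :=
| HaltsNow s o of step s = inl o : halts_from s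
| HaltsLater s s' of step s = inr s' & halts_from s' : halts_from s.

Definition halts_on In Out (A : procedure In Out) (x : In) : Prop :=
  halts_from (init A x).

Definition max_order (a b : rat) : Type := {O : set (quat a b) | maximal_order O}.

Definition halting_criterion a b Out (A : procedure (max_order a b) Out) : Prop :=
  forall O : max_order a b,
    ~ (exists O' : max_order a b,
         ~ same_type (sval O) (sval O') /\ dominates (sval O') (sval O)) ->
    halts_on A O.

(* Main.v *)
(* The Gross lattice L of a maximal order is a positive ternary lattice of Gram
   determinant 4 p^2 in which all 2x2 Gram minors are divisible by 4 p.

   Domination of the primitive representation numbers gives a norm-preserving
   injection L -> L'. It is onto: the sums of the weights (1 - Nr(h) / Y^2)_+^4
   over L and over L' agree up to O(1 / Y), the covolumes being equal, while a
   missed vector of L' would leave a gap bounded below as Y grows. Only 1-D sums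
   along the vectors of proportional bases of L and L' are compared.

   Hence successive minima D1 <= D2 <= D3 of L and L' coincide. The minima form
   bases, and the minors determine the squares of the off-diagonal entries Tij
   mod 4 p. Reducedness and Hermite's inequality give |Tij| < p, so the Tij
   agree up to sign, and the common determinant lets the signs be matched by
   changing signs of basis vectors. So L and L' are isometric, and an isometry of
   pure quaternions is, up to sign, conjugation by some c by the Skolem-Noether
   argument. It conjugates the orders because the parity of the trace is read
   off the integrality of the norm.

   The discriminant is p because a prime l dividing it forces, by maximality,
   an integral ternary form whose reduction mod l has rank two and is
   anisotropic there, which makes the algebra ramified at l; discriminant 1 is
   excluded by Hermite's inequality and D1 >= 3. *)

Require Import Defs.
From HB Require Import structures.
From mathcomp Require Import all_boot all_order all_algebra.
From mathcomp Require Import finmap.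
From mathcomp Require Import all_classical all_reals.
From mathcomp Require Import ring lra zify.

Set Implicit Arguments.
Unset Strict Implicit.
Unset Printing Implicit Defensive.

Import Order.TTheory GRing.Theory Num.Theory.
Local Open Scope classical_set_scope.
Local Open Scope ring_scope.

(** * Pure quaternions and Gram determinants *)

(** Domination is only an inequality between numbers of vectors, so equality must come from volume.
    A plain count of vectors in a ball has an error that grows with the radius and cannot detect a
    single missed vector; hence a smooth cutoff. On a line meeting the support in O(Y) points,
    fourth differences O(Y ^ -4) make the whole sum and N times the sum over the multiples of N
    differ by O(Y ^ -3). There are O(Y ^ 2) lines, so the total error O(1 / Y) tends to 0. Two
    lattices in the same rational space become comparable in this way because, in suitable bases,
    they differ by a diagonal matrix, each entry of which is a dilation along one axis.

    The numerical margin in the second half is 36 > 32: Hermite's inequality with constant 8 / 3 and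
    determinant 4 p ^ 2 gives 3 D1 D2 D3 <= 32 p ^ 2, whereas D1 >= 3 and D2 >= 2 p would make the
    left side at least 36 p ^ 2. This puts every off-diagonal entry below p, where its square modulo
    4 p determines it up to sign. *)

Section Geometry.
Variables (a b : rat).
Local Notation B := (quat a b).
Implicit Types x y z h : B.

Definition dot x y : rat := qre (x * qconj y).

Definition trip x y z : rat :=
  qi x * (qj y * qk z - qk y * qj z) - qj x * (qi y * qk z - qk y * qi z)
  + qk x * (qi y * qj z - qj y * qi z).

Definition gram2 x y : rat := dot x x * dot y y - dot x y ^+ 2.

Definition gram3 x y z : rat :=
  dot x x * dot y y * dot z z + 2 * (dot x y * dot x z * dot y z)
  - dot x x * dot y z ^+ 2 - dot y y * dot x z ^+ 2 - dot z z * dot x y ^+ 2.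

Lemma quat_eq x y :
  qre x = qre y -> qi x = qi y -> qj x = qj y -> qk x = qk y -> x = y.
Proof. by case: x y => [????] [????] /= -> -> -> ->. Qed.

Lemma qnr_dot x : qnr x = dot x x. Proof. by []. Qed.

Lemma qtr_re x : qtr x = 2 * qre x.
Proof. by rewrite /qtr /=; ring. Qed.

Lemma dotC x y : dot x y = dot y x.
Proof. by rewrite /dot /=; ring. Qed.
Lemma dotDl x y z : dot (x + y) z = dot x z + dot y z.
Proof. by rewrite /dot /=; ring. Qed.
Lemma dotZl c x z : dot (c *: x) z = c * dot x z.
Proof. by rewrite /dot /=; ring. Qed.
Lemma dotNl x z : dot (- x) z = - dot x z.
Proof. by rewrite /dot /=; ring. Qed.
Lemma dotDr x y z : dot z (x + y) = dot z x + dot z y.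
Proof. by rewrite !(dotC z) dotDl. Qed.
Lemma dotZr c x z : dot z (c *: x) = c * dot z x.
Proof. by rewrite !(dotC z) dotZl. Qed.
Lemma dotNr x z : dot z (- x) = - dot z x.
Proof. by rewrite !(dotC z) dotNl. Qed.
Lemma dot0l x : dot 0 x = 0.
Proof. by rewrite /dot /=; ring. Qed.
Lemma dot0r x : dot x 0 = 0.
Proof. by rewrite dotC dot0l. Qed.
Definition dotE := (dotDl, dotDr, dotZl, dotZr, dotNl, dotNr).

(** Cramer's rule, with [trip] the determinant of the pure coordinates. *)
Lemma trip_expand x y z h :
  qre x = 0 -> qre y = 0 -> qre z = 0 -> qre h = 0 ->
  trip x y z *: h = trip h y z *: x + trip x h z *: y + trip x y h *: z.
Proof.
move=> hx hy hz hh; apply: quat_eq; rewrite /trip /= ?hx ?hy ?hz ?hh; ring.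
Qed.

(** On pure quaternions the norm form is diagonal with entries - a, - b, a b, of determinant (a b) ^
    2. Gram determinants are therefore rational squares, and covolumes can be compared through
    [trip]. *)
Lemma gram3_trip x y z : qre x = 0 -> qre y = 0 -> qre z = 0 ->
  gram3 x y z = (a * b * trip x y z) ^+ 2.
Proof. by move=> hx hy hz; rewrite /gram3 /trip /dot /= hx hy hz; ring. Qed.

Lemma trip_comb (x y z : B) (x1 x2 x3 y1 y2 y3 z1 z2 z3 : rat) :
  trip (x1 *: x + x2 *: y + x3 *: z) (y1 *: x + y2 *: y + y3 *: z)
       (z1 *: x + z2 *: y + z3 *: z) =
  (x1 * (y2 * z3 - y3 * z2) - x2 * (y1 * z3 - y3 * z1)
    + x3 * (y1 * z2 - y2 * z1)) * trip x y z.
Proof. by rewrite /trip /=; ring. Qed.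

Hypotheses (a0 : a < 0) (b0 : b < 0).

Lemma dot_sos x :
  dot x x = qre x ^+ 2 + (- a) * qi x ^+ 2 + (- b) * qj x ^+ 2 + a * b * qk x ^+ 2.
Proof. by rewrite /dot /=; ring. Qed.

Lemma dot_ge0 x : 0 <= dot x x.
Proof.
rewrite dot_sos; have ab : 0 < a * b by rewrite nmulr_rgt0.
by rewrite !addr_ge0 ?sqr_ge0// mulr_ge0 ?sqr_ge0 ?oppr_ge0 ?ltW.
Qed.

Lemma dot_eq0 x : dot x x = 0 -> x = 0.
Proof.
have ab : 0 < a * b by rewrite nmulr_rgt0.
have ha : 0 < - a by rewrite oppr_gt0.
have hb : 0 < - b by rewrite oppr_gt0.
rewrite dot_sos => h; have h0 := sqr_ge0 (qre x); have h1 : 0 <= - a * qi x ^+ 2 by rewrite mulr_ge0 ?sqr_ge0 ?ltW.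
have h2 : 0 <= - b * qj x ^+ 2 by rewrite mulr_ge0 ?sqr_ge0 ?ltW.
have h3 : 0 <= a * b * qk x ^+ 2 by rewrite mulr_ge0 ?sqr_ge0 ?ltW.
have z c u : c != 0 -> c * u ^+ 2 = 0 -> u = 0 :> rat.
  by move=> c0 /eqP; rewrite mulf_eq0 (negPf c0) /= sqrf_eq0 => /eqP.
apply: quat_eq => /=.
- by apply: (z 1); rewrite ?oner_eq0//; lra.
- by apply: (z (- a)); rewrite ?gt_eqF//; lra.
- by apply: (z (- b)); rewrite ?gt_eqF//; lra.
- by apply: (z (a * b)); rewrite ?gt_eqF//; lra.
Qed.

Lemma dot_gt0 x : x != 0 -> 0 < dot x x.
Proof.
by move=> x0; rewrite lt_neqAle dot_ge0 andbT eq_sym; apply: contraNneq x0 => /dot_eq0 ->.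
Qed.

Lemma dot_neq0 x : x != 0 -> dot x x != 0.
Proof. by move=> /dot_gt0; rewrite lt0r => /andP[]. Qed.

Lemma gram2_dot x y : x != 0 ->
  gram2 x y = dot x x * dot (y - (dot x y / dot x x) *: x) (y - (dot x y / dot x x) *: x).
Proof.
move=> /dot_neq0 x0; rewrite !dotE (dotC y x) /gram2.
by field.
Qed.

Lemma gram2_ge0 x y : 0 <= gram2 x y.
Proof.
have [->|x0] := eqVneq x 0; first by rewrite /gram2 !dot0l mul0r expr0n subr0.
by rewrite gram2_dot// mulr_ge0 ?dot_ge0.
Qed.

Lemma gram2_eq0 x y : x != 0 -> gram2 x y = 0 -> y = (dot x y / dot x x) *: x.
Proof.
move=> x0; rewrite gram2_dot// => /eqP; rewrite mulf_eq0 (negPf (dot_neq0 x0)) /=.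
by move=> /eqP/dot_eq0/eqP; rewrite subr_eq0 => /eqP.
Qed.

Lemma gram2Z c x : gram2 x (c *: x) = 0.
Proof. by rewrite /gram2 !dotE; ring. Qed.

Lemma gram2_neq0 x y : gram2 x y != 0 -> x != 0 /\ y != 0.
Proof.
by move=> h; split; apply: contraNneq h => ->;
  rewrite /gram2 ?dot0l ?dot0r ?mul0r ?mulr0 expr0n subr0.
Qed.

Lemma trip_gram2 x y z : qre x = 0 -> qre y = 0 -> qre z = 0 ->
  trip x y z != 0 -> gram2 x y != 0.
Proof.
move=> hx hy hz t0; have ab : a * b != 0 by rewrite mulf_neq0// lt_eqF.
apply: contraNneq t0 => g0.
have [x0|x0] := eqVneq x 0; first by rewrite x0 /trip /=; apply/eqP; ring.
by rewrite (gram2_eq0 x0 g0) /trip /=; apply/eqP; ring.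
Qed.

End Geometry.

Lemma near_int (x : rat) : exists m : int, `|x - m%:~R| <= 1 / 2.
Proof.
exists (Num.floor (x + 1 / 2)).
have := floor_itv (x + 1 / 2); rewrite rmorphD /= => /andP[h1 h2].
by rewrite ler_norml; lra.
Qed.

(** * Successive minima in rank three *)

(** The commutator of pure quaternions is twice their cross product. This yields a vector off the
    plane of [x] and [y], and shows that commuting pure quaternions are proportional. *)
Lemma trip_comm (a b : rat) (x y : quat a b) : qre x = 0 -> qre y = 0 ->
  a * b * trip x y (x * y - y * x) = 2 * gram2 x y.
Proof. by move=> hx hy; rewrite /trip /gram2 /dot /= hx hy; ring. Qed.

Section Reduction.
Variables (a b : rat).
Hypotheses (a0 : a < 0) (b0 : b < 0).
Local Notation B := (quat a b).
Implicit Types x y z h u : B.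

Record minimal_triple (L : set B) u1 u2 u3 : Prop := MinimalTriple {
  mt_in1 : L u1; mt_in2 : L u2; mt_in3 : L u3;
  mt_neq0 : u1 != 0; mt_gram2 : gram2 u1 u2 != 0; mt_trip : trip u1 u2 u3 != 0;
  mt_min1 : forall h, L h -> h != 0 -> dot u1 u1 <= dot h h;
  mt_min2 : forall h, L h -> gram2 u1 h != 0 -> dot u2 u2 <= dot h h;
  mt_min3 : forall h, L h -> trip u1 u2 h != 0 -> dot u3 u3 <= dot h h }.

(** Finite generation is a consequence: integral norms let minima be attained, and [mt_gen] turns
    the minimal vectors into a basis. *)
Record pure_lattice (L : set B) : Prop := PureLattice {
  pl_sub : forall x y, L x -> L y -> L (x - y);
  pl_pure : forall x, L x -> qre x = 0;
  pl_nat : forall x, L x -> exists n : nat, dot x x = n%:R;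
  pl_rank : exists v1 v2 v3, [/\ L v1, L v2, L v3 & trip v1 v2 v3 != 0] }.

Variable L : set B.
Hypothesis HL : pure_lattice L.

Lemma pl0 : L 0.
Proof. by have [v [_ [_ [hv _ _ _]]]] := pl_rank HL; rewrite -(subrr v); apply: pl_sub. Qed.
Lemma plN x : L x -> L (- x).
Proof. by move=> hx; rewrite -sub0r; apply: pl_sub => //; exact: pl0. Qed.
Lemma plD x y : L x -> L y -> L (x + y).
Proof. by move=> hx hy; rewrite -[y]opprK; apply: pl_sub => //; exact: plN. Qed.
Lemma plZ (m : int) x : L x -> L (m%:~R *: x).
Proof.
move=> hx; have hn (n : nat) : L (n%:R *: x).
  elim: n => [|n IH]; first by rewrite scale0r; exact: pl0.
  by rewrite -natr1 scalerDl scale1r; apply: plD.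
case: m => n; first by rewrite -pmulrn.
by rewrite NegzE rmorphN /= scaleNr -pmulrn; apply: plN.
Qed.

Lemma pl_argmin (P : B -> Prop) : (exists2 h, L h & P h) ->
  exists u, [/\ L u, P u & forall h, L h -> P h -> dot u u <= dot h h].
Proof.
move=> [h0 Lh0 Ph0].
pose Q (n : nat) := `[< exists h, [/\ L h, P h & dot h h = n%:R] >].
have exQ : exists n, Q n.
  by have [n hn] := pl_nat HL Lh0; exists n; apply/asboolP; exists h0.
case: (ex_minnP exQ) => m /asboolP[u [Lu Pu um]] hm.
exists u; split=> // h Lh Ph; have [n hn] := pl_nat HL Lh.
by rewrite um hn ler_nat; apply: hm; apply/asboolP; exists h.
Qed.

Lemma minimal_triple_exists : exists u1 u2 u3, minimal_triple L u1 u2 u3.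
Proof.
have [v1 [v2 [v3 [L1 L2 L3 tv]]]] := pl_rank HL.
have [p1 p2 p3] : [/\ qre v1 = 0, qre v2 = 0 & qre v3 = 0] by split; apply: (pl_pure HL).
have v10 : v1 != 0 by apply: contraNneq tv => ->; rewrite /trip /=; apply/eqP; ring.
have [u1 [Lu1 u10 m1]] := @pl_argmin (fun h => h != 0) (ex_intro2 _ _ v1 L1 v10).
have q1 := pl_pure HL Lu1.
have [v [Lv gv]] : exists v, L v /\ gram2 u1 v != 0.
  apply: contrapT => /forallNP H.
  have E v : L v -> v = (dot u1 v / dot u1 u1) *: u1.
    move=> Lv; apply: (gram2_eq0 a0 b0) => //; apply/eqP.
    by have /not_andP[//|/negP/negPn] := H v.
  move: tv; rewrite (E v1 L1) (E v2 L2) /trip /= => /negP; apply; apply/eqP; ring.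
have [u2 [Lu2 u20 m2]] := @pl_argmin (fun h => gram2 u1 h != 0) (ex_intro2 _ _ v Lv gv).
have q2 := pl_pure HL Lu2.
have [w [Lw tw]] : exists w, L w /\ trip u1 u2 w != 0.
  apply: contrapT => /forallNP H.
  have E w : L w -> trip u1 u2 w = 0.
    by move=> Lw; apply/eqP; have /not_andP[//|/negP/negPn] := H w.
  (* The commutator is a combination of v1, v2, v3. If all of these lay in the plane of u1 and u2,
     so would the commutator, against [trip_comm]. *)
  have := trip_comm q1 q2; set h := _ - _ => hh.
  have qh : qre h = 0 by rewrite /h /=; ring.
  have := trip_expand p1 p2 p3 qh.
  move=> /(congr1 (trip u1 u2)).
  have -> x y z c d e : trip u1 u2 (c *: x + d *: y + e *: z) =
    c * trip u1 u2 x + d * trip u1 u2 y + e * trip u1 u2 z.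
    by rewrite /trip /=; ring.
  have -> c x : trip u1 u2 (c *: x) = c * trip u1 u2 x by rewrite /trip /=; ring.
  rewrite (E v1 L1) (E v2 L2) (E v3 L3) !mulr0 !addr0 => /eqP.
  rewrite mulf_eq0 (negPf tv) /= => /eqP t0; move: hh; rewrite t0 mulr0 => /esym/eqP.
  by rewrite mulf_eq0 (negPf u20) orbF pnatr_eq0.
have [u3 [Lu3 u30 m3]] := @pl_argmin (fun h => trip u1 u2 h != 0) (ex_intro2 _ _ w Lw tw).
by exists u1, u2, u3; split.
Qed.

Variables u1 u2 u3 : B.
Hypothesis HU : minimal_triple L u1 u2 u3.

Let q1 : qre u1 = 0 := pl_pure HL (mt_in1 HU).
Let q2 : qre u2 = 0 := pl_pure HL (mt_in2 HU).
Let q3 : qre u3 = 0 := pl_pure HL (mt_in3 HU).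
Local Notation D1 := (dot u1 u1).
Local Notation D2 := (dot u2 u2).
Local Notation D3 := (dot u3 u3).
Local Notation T12 := (dot u1 u2).
Local Notation T13 := (dot u1 u3).
Local Notation T23 := (dot u2 u3).

Lemma mt_D1_gt0 : 0 < D1. Proof. by apply: dot_gt0 => //; exact: mt_neq0 HU. Qed.
Lemma mt_D12 : D1 <= D2.
Proof.
by apply: (mt_min1 HU); [exact: mt_in2 HU|have [] := gram2_neq0 (mt_gram2 HU)].
Qed.
Lemma mt_D23 : D2 <= D3.
Proof.
apply: (mt_min2 HU); first exact: mt_in3 HU.
apply: (@trip_gram2 _ _ a0 b0 _ _ u2) => //.
by apply: contraNneq (mt_trip HU) => h; apply/eqP; rewrite -[RHS]oppr0 -h /trip; ring.
Qed.

Let twice_le (D T D' : rat) : 0 <= D -> D' <= D' + 2 * T + D -> D' <= D' - 2 * T + D ->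
  `|2 * T| <= D.
Proof. by move=> *; rewrite ler_norml; apply/andP; split; lra. Qed.

(** The vectors u2 + u1 and u2 - u1 are off the line of u1, so neither is shorter than u2. *)
Lemma mt_T12 : `|2 * T12| <= D1.
Proof.
have D10 := ltW mt_D1_gt0.
have key (e : rat) : e = 1 \/ e = - 1 -> D2 <= D2 + 2 * e * T12 + D1.
  move=> he; have -> : D2 + 2 * e * T12 + D1 = dot (u2 + e *: u1) (u2 + e *: u1).
    rewrite !dotE (dotC u2 u1); case: he => ->; ring.
  apply: (mt_min2 HU).
    apply: (plD (mt_in2 HU)).
    by case: he => ->; [have := plZ 1 (mt_in1 HU)|have := plZ (-1) (mt_in1 HU)].
  suff -> : gram2 u1 (u2 + e *: u1) = gram2 u1 u2 by exact: mt_gram2 HU.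
  by rewrite /gram2 !dotE (dotC u2 u1); ring.
apply: (@twice_le _ _ D2) => //; first by have := key 1 (or_introl erefl); rewrite mulr1.
by have := key (-1) (or_intror erefl); rewrite mulrN1 mulNr.
Qed.

Let pm3 (v : B) (e : rat) : L v -> (forall c : rat, trip u1 u2 (u3 + c *: v) = trip u1 u2 u3) ->
  e = 1 \/ e = - 1 -> D3 <= D3 + 2 * e * dot v u3 + dot v v.
Proof.
move=> Lv tv he.
have -> : D3 + 2 * e * dot v u3 + dot v v = dot (u3 + e *: v) (u3 + e *: v).
  by rewrite !dotE (dotC u3 v); case: he => ->; ring.
apply: (mt_min3 HU); last by rewrite tv; exact: mt_trip HU.
apply: (plD (mt_in3 HU)).
by case: he => ->; [have := plZ 1 Lv|have := plZ (-1) Lv].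
Qed.

Lemma mt_T13 : `|2 * T13| <= D1.
Proof.
have tv c : trip u1 u2 (u3 + c *: u1) = trip u1 u2 u3 by rewrite /trip /=; ring.
have h1 := pm3 (mt_in1 HU) tv (or_introl erefl).
have h2 := pm3 (mt_in1 HU) tv (or_intror erefl).
by apply: (@twice_le _ _ D3); [exact: ltW mt_D1_gt0|lra|lra].
Qed.

Lemma mt_T23 : `|2 * T23| <= D2.
Proof.
have tv c : trip u1 u2 (u3 + c *: u2) = trip u1 u2 u3 by rewrite /trip /=; ring.
have h1 := pm3 (mt_in2 HU) tv (or_introl erefl).
have h2 := pm3 (mt_in2 HU) tv (or_intror erefl).
by apply: (@twice_le _ _ D3); [exact: dot_ge0|lra|lra].
Qed.


Local Notation g12 := (gram2 u1 u2).

Lemma mt_g12_gt0 : 0 < g12.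
Proof. by rewrite lt_neqAle eq_sym (mt_gram2 HU) gram2_ge0. Qed.

Lemma mt_g12_le : g12 / D1 <= D2.
Proof.
rewrite ler_pdivrMr ?mt_D1_gt0// /gram2 mulrC.
by have := sqr_ge0 T12; lra.
Qed.

(* Gram-Schmidt: [gram3 / g12] and [g12 / D1] are the squared lengths of the
   second and first residual vectors. *)
Lemma gram_schmidt h (m1 m2 : rat) :
  dot (h - m2 *: u2 - m1 *: u1) (h - m2 *: u2 - m1 *: u1) =
  gram3 u1 u2 h / g12
  + ((D1 * dot u2 h - T12 * dot u1 h) / g12 - m2) ^+ 2 * (g12 / D1)
  + (dot u1 h / D1 - m2 * (T12 / D1) - m1) ^+ 2 * D1.
Proof.
have D10 : D1 != 0 by rewrite gt_eqF// mt_D1_gt0.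
have g0 := mt_gram2 HU.
rewrite !dotE (dotC h u1) (dotC h u2) (dotC u2 u1) /gram3.
move: g0; rewrite /gram2.
set d1 := dot u1 u1; set d2 := dot u2 u2; set d3 := dot h h.
set t1 := dot u1 h; set t2 := dot u2 h; set t := T12.
by move=> g0; field; rewrite g0 D10.
Qed.

Lemma gram3_le h : gram3 u1 u2 h / g12 <= dot h h.
Proof.
have := gram_schmidt h 0 0; rewrite !scale0r !subr0 => ->.
rewrite -addrA lerDl addr_ge0// mulr_ge0 ?sqr_ge0 ?divr_ge0 ?dot_ge0//.
exact: gram2_ge0.
Qed.

Let sqr_le4 (e : rat) : `|e| <= 1 / 2 -> e ^+ 2 <= 1 / 4.
Proof.
move=> he; have : `|e| ^+ 2 <= (1 / 2) ^+ 2 by rewrite ler_pXn2r ?nnegrE ?normr_ge0 ?he.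
by rewrite real_normK ?num_real// => /le_trans; apply; lra.
Qed.

(** Rounding the two Gram-Schmidt coefficients leaves at most a quarter of each squared residual
    length, and these lengths are at most D2 and D1. *)
Lemma mt_reduce12 h : exists m1 m2 : int, let h' := h - m2%:~R *: u2 - m1%:~R *: u1 in
  dot h' h' <= gram3 u1 u2 h / g12 + D2 / 4 + D1 / 4.
Proof.
have [m2 h2] := near_int ((D1 * dot u2 h - T12 * dot u1 h) / g12).
have [m1 h1] := near_int (dot u1 h / D1 - m2%:~R * (T12 / D1)).
exists m1, m2 => /=; rewrite gram_schmidt -!addrA lerD2l; apply: lerD.
  apply: (@le_trans _ _ (1 / 4 * (g12 / D1))).
    by rewrite ler_wpM2r ?sqr_le4// divr_ge0 ?dot_ge0 ?gram2_ge0.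
  by have := mt_g12_le; lra.
by rewrite mulrC ler_wpM2l ?dot_ge0//; have := sqr_le4 h1; lra.
Qed.

Lemma trip_sub12 h (m1 m2 : rat) : trip u1 u2 (h - m2 *: u2 - m1 *: u1) = trip u1 u2 h.
Proof. by rewrite /trip /=; ring. Qed.

Lemma pl_sub12 h (m1 m2 : int) : L h -> L (h - m2%:~R *: u2 - m1%:~R *: u1).
Proof.
move=> Lh; apply: (pl_sub HL); last exact: plZ (mt_in1 HU).
by apply: (pl_sub HL) => //; exact: plZ (mt_in2 HU).
Qed.

(** Reducing u3 modulo u1 and u2 keeps it off their plane, so D3 <= [gram3] / [g12] + (D1 + D2) / 4,
    whence [gram3] / [g12] >= D3 / 2. Together with [g12] >= 3 / 4 D1 D2 this gives the factor 3 /
    8. *)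
Lemma mt_hermite : 3 * (D1 * D2 * D3) <= 8 * gram3 u1 u2 u3.
Proof.
have [m1 [m2 /= hm]] := mt_reduce12 u3.
have := mt_min3 HU (pl_sub12 m1 m2 (mt_in3 HU)); rewrite trip_sub12 => /(_ (mt_trip HU)).
move=> /le_trans /(_ hm) h3.
have : D3 / 2 <= gram3 u1 u2 u3 / g12 by have := mt_D12; have := mt_D23; lra.
rewrite ler_pdivlMr ?mt_g12_gt0// => h4.
have : 3 / 4 * (D1 * D2) <= g12.
  have : (2 * T12) ^+ 2 <= D1 ^+ 2.
    rewrite -(real_normK (num_real (2 * T12))) ler_pXn2r ?nnegrE ?normr_ge0 ?mt_T12//.
    exact: ltW mt_D1_gt0.
  have : D1 * D1 <= D1 * D2 by rewrite ler_pM2l ?mt_D12// mt_D1_gt0.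
  by rewrite /gram2; lra.
move=> /(ler_wpM2l (dot_ge0 a0 b0 u3)); lra.
Qed.

(** Reducing h modulo u3, u2, u1 leaves a vector of norm at most (D1 + D2 + D3) / 4 < D3, which lies
    in the plane of u1 and u2 by minimality. Its norm is then at most (D1 + D2) / 4 < D2, so it lies
    on the line of u1, where rounding leaves norm at most D1 / 4 and hence 0. *)
Lemma mt_gen h : L h ->
  exists z1 z2 z3 : int, h = z1%:~R *: u1 + z2%:~R *: u2 + z3%:~R *: u3.
Proof.
move=> Lh; have [m3 h3] := near_int (trip u1 u2 h / trip u1 u2 u3).
pose k := h - m3%:~R *: u3.
have Lk : L k by apply: (pl_sub HL) => //; exact: plZ (mt_in3 HU).
have tk : trip u1 u2 k = (trip u1 u2 h / trip u1 u2 u3 - m3%:~R) * trip u1 u2 u3.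
  by rewrite mulrBl divfK ?(mt_trip HU)// /k /trip /=; ring.
have gk : gram3 u1 u2 k / g12 <= D3 / 4.
  rewrite gram3_trip// ?(pl_pure HL Lk)// tk mulrCA exprMn -gram3_trip// -mulrA.
  apply: (@le_trans _ _ (1 / 4 * D3)); last lra.
  apply: ler_pM; rewrite ?sqr_ge0 ?sqr_le4 ?gram3_le//.
  by rewrite divr_ge0 ?gram2_ge0// gram3_trip// sqr_ge0.
have [m1 [m2 /= hm]] := mt_reduce12 k.
have D1_gt0 := mt_D1_gt0; have D12 := mt_D12; have D23 := mt_D23.
set k' := k - _ - _ in hm; have Lk' : L k' by apply: pl_sub12.
have tk' : trip u1 u2 k' = 0.
  apply: contrapT => /eqP /(mt_min3 HU Lk'); lra.
have g0 : gram3 u1 u2 k = 0.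
  by rewrite gram3_trip// ?(pl_pure HL Lk)// -(trip_sub12 _ m1%:~R m2%:~R) -/k' tk' mulr0 expr0n.
have g1 : gram2 u1 k' = 0.
  apply: contrapT => /eqP /(mt_min2 HU Lk'); rewrite g0 mul0r in hm; lra.
have := gram2_eq0 a0 b0 (mt_neq0 HU) g1; set x := _ / _ => hx.
have [m0 h0] := near_int x.
have : k' - m0%:~R *: u1 = 0.
  apply: contrapT => /eqP.
  have Lk0 : L (k' - m0%:~R *: u1) by apply: (pl_sub HL) => //; exact: plZ (mt_in1 HU).
  move=> /(mt_min1 HU Lk0); rewrite hx -scalerBl dotZl dotZr mulrA -expr2.
  by have := ler_wpM2r (ltW D1_gt0) (sqr_le4 h0); lra.
move=> /eqP; rewrite subr_eq0 => /eqP e0.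
exists (m1 + m0), m2, m3; rewrite rmorphD /= scalerDl -e0 [_ + k']addrC /k' /k.
by rewrite !subrK.
Qed.

End Reduction.

(** * Sums of a smoothed weight over a lattice *)

Section FourthDifference.
Variable R : realFieldType.


Lemma ler_normD2 (x y X Y : R) : `|x| <= X -> `|y| <= Y -> `|x + y| <= X + Y.
Proof. by move=> hx hy; apply: le_trans (ler_normD _ _) _; apply: lerD. Qed.
Lemma ler_normM2 (x y X Y : R) : `|x| <= X -> `|y| <= Y -> `|x * y| <= X * Y.
Proof. by move=> hx hy; rewrite normrM; apply: ler_pM. Qed.
Lemma ler_norm_nat (n : nat) : `|n%:R : R| <= n%:R.
Proof. by rewrite normr_nat. Qed.

Definition pos4 (x : R) : R := Num.max 0 x ^+ 4.

Lemma pos4_ge0 x : 0 <= pos4 x.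
Proof. by rewrite exprn_ge0// le_max lexx. Qed.
Lemma pos4_eq0 x : x <= 0 -> pos4 x = 0.
Proof. by move=> hx; rewrite /pos4 max_l// expr0n. Qed.
Lemma pos4E x : 0 <= x -> pos4 x = x ^+ 4.
Proof. by move=> hx; rewrite /pos4 max_r. Qed.

Definition diff (f : int -> R) (t : int) : R := f (t + 1) - f t.
Definition diff4 := iter 4 diff.

Lemma diff4E f t : diff4 f t =
  f (t + 4) - 4 * f (t + 3) + 6 * f (t + 2) - 4 * f (t + 1) + f t.
Proof.
have e (m n k : int) : m + n = k -> t + m + n = t + k by rewrite -addrA => ->.
by rewrite /diff4 /= /diff !(e _ _ _ erefl) /=; ring.
Qed.

(* Coefficients of s^4, ..., s^8 in (p + e s + c s^2)^4, weighted by the fourth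
   differences at 0 of these powers. *)
Definition quartic_rem (p e c d : R) : R :=
  24 * (e * e * e * e + 12 * p * e * e * c + 6 * p * p * c * c
    + 10 * (4 * e * e * e * c + 12 * p * e * c * c) * d
    + 65 * (6 * e * e * c * c + 4 * p * c * c * c) * d * d
    + 350 * (4 * e * c * c * c) * d * d * d
    + 1701 * (c * c * c * c) * d * d * d * d).

(** The fourth difference of i ^ n at 0 is 24 S(n, 4), with Stirling numbers S(n, 4) = 1, 10, 65,
    350, 1701 for n = 4, ..., 8 and 0 for smaller n. *)
Lemma quartic_remE p e c d :
  let F (i : R) := (p + e * (i * d) + c * (i * d) ^+ 2) ^+ 4 in
  F 4 - 4 * F 3 + 6 * F 2 - 4 * F 1 + F 0 = d ^+ 4 * quartic_rem p e c d.
Proof. by rewrite /quartic_rem /=; ring. Qed.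

Definition quartic_rem_le (M C : R) : Prop := forall p e c d : R,
  `|p| <= M -> `|e| <= M -> `|c| <= M -> `|d| <= M -> `|quartic_rem p e c d| <= C.

Lemma quartic_rem_bound (M : R) : exists C : R, quartic_rem_le M C.
Proof.
eexists => p e c d hp he hc hd; rewrite /quartic_rem.
(* The constant stays an existential variable; following the syntax with the triangle inequality
   builds it. *)
repeat lazymatch goal with
  | |- is_true (`|_ + _| <= _) => apply: ler_normD2
  | |- is_true (`|_ * _| <= _) => apply: ler_normM2
  | |- is_true (`|_%:R| <= _) => apply: ler_norm_nat
  | |- _ => eassumption
  end.
Qed.

End FourthDifference.

(** * Sums over Z and over residue classes *)

Section IntegerSums.
Variable R : realFieldType.


Implicit Types f g : int -> R.

Definition zsum (f : int -> R) : R := \sum_(t \in [set: int]) f t.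
Definition supp (K : nat) (f : int -> R) := forall t : int, (K <= `|t|)%N -> f t = 0.
Definition zbox (K : nat) : seq int := [seq i%:Z - K%:Z | i <- iota 0 K.*2].

Lemma zbox_uniq K : uniq (zbox K).
Proof. by rewrite map_inj_uniq ?iota_uniq// => i j; lia. Qed.

Lemma sum_zbox_const K (e : R) : \sum_(t <- zbox K) e = K.*2%:R * e.
Proof. by rewrite big_const_seq count_predT size_map size_iota iter_addr addr0 mulr_natl. Qed.

Lemma mem_zbox K (t : int) : (`|t| < K)%N -> t \in zbox K.
Proof.
move=> tK; apply/mapP; exists (absz (t + K%:Z)); last by lia.
by rewrite mem_iota; lia.
Qed.

Lemma zsum_seq f r : uniq r -> (forall t, t \notin r -> f t = 0) ->
  zsum f = \sum_(t <- r) f t.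
Proof.
move=> ur hr; rewrite /zsum (fsbigE r)//; last by move=> t _; exact: hr.
by apply: eq_bigl => t; rewrite in_setT.
Qed.

Lemma zsumE K f : supp K f -> zsum f = \sum_(t <- zbox K) f t.
Proof.
move=> sf; apply: zsum_seq; first exact: zbox_uniq.
by move=> t tK; apply: sf; rewrite leqNgt; apply: contra tK; exact: mem_zbox.
Qed.

Lemma eq_zsum f g : f =1 g -> zsum f = zsum g.
Proof. by move=> /funext ->. Qed.

Lemma zsum_shift f (c : int) : zsum (fun t => f (t + c)) = zsum f.
Proof.
rewrite /zsum -(reindex_fsbigT (fun t : int => t + c))//.
by exists (fun t => t - c) => t; rewrite ?addrK ?subrK.
Qed.

Lemma zsum_residues K N f : supp K f -> (0 < N)%N ->
  zsum f = \sum_(0 <= s < N) zsum (fun n => f (n * N%:Z + s%:Z)).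
Proof.
(* The box is enlarged to a multiple of [N], so that it splits into whole blocks. One block more
   than [K] covers the shift by a residue. *)
move=> sf N0; rewrite (@zsum_seq f (zbox (K.+1 * N))); first last.
- move=> t tK; apply: sf; rewrite leqNgt; apply: contra tK => h; apply: mem_zbox.
  by apply: leq_trans h _; rewrite mulSn (leq_trans (leq_pmulr K N0))// leq_addl.
- exact: zbox_uniq.
rewrite big_map doubleMl -[X in iota 0 X]subn0 -/(index_iota 0 _) big_nat_mul.
under eq_bigr => k _.
  rewrite -{1}[(k * N)%N]add0n big_addn mulSn addnK.
  over.
rewrite exchange_big_nat /=; apply: eq_big_nat => s /andP[_ sN].
rewrite (@zsumE K.+1) ?big_map ?/index_iota ?subn0; last first.
  move=> t tK; apply: sf; move: tK sN N0; nia.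
by apply: eq_bigr => k _; congr f; rewrite !PoszD !PoszM; lia.
Qed.

Lemma diff_periodic g (N : int) : (forall t, g (t + N) = g t) ->
  forall t, diff g (t + N) = diff g t.
Proof. by move=> gN t; rewrite /diff gN -addrA [N + 1]addrC addrA gN. Qed.

Lemma diff_steps g e : (forall t, `|diff g t| <= e) ->
  forall t (n : nat), `|g (t + n%:Z) - g t| <= n%:R * e.
Proof.
move=> ge t; elim=> [|n IH]; first by rewrite addr0 subrr normr0 mul0r.
have -> : g (t + n.+1%:Z) - g t = diff g (t + n%:Z) + (g (t + n%:Z) - g t).
  have -> : t + n.+1%:Z = t + n%:Z + 1 by rewrite -addrA -PoszD addn1.
  by rewrite /diff; ring.
by rewrite -nat1r mulrDl mul1r; apply: ler_normD2.
Qed.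

Lemma periodicM g (N : nat) : (forall t, g (t + N%:Z) = g t) ->
  forall t (k : int), g (t + k * N%:Z) = g t.
Proof.
move=> gN t; have H (n : nat) u : g (u + n%:Z * N%:Z) = g u.
  elim: n u => [|n IH] u; first by rewrite mul0r addr0.
  by rewrite -addn1 PoszD mulrDl mul1r addrA gN IH.
case=> n; first exact: H.
by rewrite NegzE mulNr -[LHS](H n.+1) subrK.
Qed.

Lemma periodic_osc g (N : nat) e : (0 < N)%N -> 0 <= e -> (forall t, g (t + N%:Z) = g t) ->
  (forall t, `|diff g t| <= e) -> forall s t, `|g s - g t| <= N%:R * e.
Proof.
move=> N0 e0 gN ge s t.
have m0 : 0 <= ((s - t) %% N%:Z)%Z by rewrite modz_ge0//; lia.
have -> : g s = g (t + Posz (absz ((s - t) %% N%:Z)%Z)).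
  rewrite gez0_abs// -[RHS](periodicM gN _ ((s - t) %/ N%:Z)%Z); congr g.
  by rewrite -addrA [X in t + X]addrC -divz_eq addrC subrK.
apply: le_trans (diff_steps ge _ _) _; rewrite ler_wpM2r// ler_nat.
have := ltz_pmod (s - t) (_ : 0 < N%:Z); lia.
Qed.

Lemma sum_diff g t (N : nat) : \sum_(0 <= i < N) diff g (t + i%:Z) = g (t + N%:Z) - g t.
Proof.
transitivity (\sum_(0 <= i < N) (g (t + i.+1%:Z) - g (t + i%:Z))).
  by apply: eq_bigr => i _; rewrite /diff -addrA -PoszD addn1.
by rewrite (telescope_sumr (fun i => g (t + i%:Z)))// addr0.
Qed.

(** Over a period the differences of g sum to zero, so each of them is bounded by their oscillation.
    A bound on differences thus descends one order at the cost of a factor N. *)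
Lemma periodic_diff g (N : nat) e : (0 < N)%N -> 0 <= e -> (forall t, g (t + N%:Z) = g t) ->
  (forall t, `|diff (diff g) t| <= e) -> forall t, `|diff g t| <= N%:R * e.
Proof.
move=> N0 e0 gN ge t.
have osc := periodic_osc N0 e0 (diff_periodic gN) ge.
have : \sum_(0 <= i < N) (diff g t - diff g (t + i%:Z)) = N%:R * diff g t.
  by rewrite sumrB sum_diff gN subrr subr0 sumr_const_nat subn0 mulr_natl.
move=> /(congr1 (fun x => `|x|)); rewrite normrM normr_nat => h.
have : N%:R * `|diff g t| <= N%:R * (N%:R * e).
  rewrite -h; apply: le_trans (ler_norm_sum _ _ _) _.
  apply: le_trans (ler_sum _ (fun i _ => osc t (t + i%:Z))) _.
  by rewrite sumr_const_nat subn0 [leRHS]mulr_natl.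
by rewrite ler_pM2l// ltr0n.
Qed.

Lemma periodic_diff4 g (N : nat) e : (0 < N)%N -> 0 <= e -> (forall t, g (t + N%:Z) = g t) ->
  (forall t, `|diff4 g t| <= e) -> forall s t, `|g s - g t| <= N%:R ^+ 4 * e.
Proof.
move=> N0 e0 gN ge.
have N1 : 0 <= N%:R :> R by rewrite ler0n.
have g1 := diff_periodic gN; have g2 := diff_periodic g1.
have h3 := periodic_diff N0 e0 g2 ge.
have h2 := periodic_diff N0 (mulr_ge0 N1 e0) g1 h3.
have h1 := periodic_diff N0 (mulr_ge0 N1 (mulr_ge0 N1 e0)) gN h2.
move=> s t; have := periodic_osc N0 (mulr_ge0 N1 (mulr_ge0 N1 (mulr_ge0 N1 e0))) gN h1 s t.
by rewrite !exprS expr0 mulr1 !mulrA.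
Qed.

(* The sums over the residue classes mod N form an N-periodic function whose
   fourth difference is small, hence nearly constant. *)
Lemma zsum_dilate K N f e : (0 < N)%N -> 0 <= e -> supp K f ->
  (forall t, `|diff4 f t| <= e) ->
  `|zsum f - N%:R * zsum (fun n => f (n * N%:Z))| <= N%:R ^+ 5 * (K + N + 4).*2%:R * e.
Proof.
move=> N0 e0 sf fe.
pose F (s : int) := zsum (fun n => f (n * N%:Z + s)).
have FN t : F (t + N%:Z) = F t.
  rewrite /F -[RHS](zsum_shift _ 1); apply: eq_zsum => n; congr f; ring.
have sF (s : int) : (`|s| <= N + 4)%N -> supp (K + N + 4) (fun n => f (n * N%:Z + s)).
  by move=> sN t tK; apply: sf; move: sN tK N0; nia.
have dF t : `|diff4 F t| <= (K + N + 4).*2%:R * e.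
  (* By periodicity t may be replaced by its residue [s]; then one box contains the supports of all
     five translates. *)
  rewrite (divz_eq t N%:Z) addrC.
  have per g : (forall t, g (t + N%:Z) = g t) -> forall t, diff4 g (t + N%:Z) = diff4 g t.
    by move=> gN; do 4![apply: diff_periodic].
  rewrite (periodicM (per _ FN)); set s := (_ %% _)%Z.
  have s0 : 0 <= s by rewrite modz_ge0//; lia.
  have sN : s < N%:Z by rewrite ltz_pmod.
  have FE (i : nat) : (i <= 4)%N ->
      F (s + i%:Z) = \sum_(n <- zbox (K + N + 4)) f (n * N%:Z + (s + i%:Z)).
    by move=> i4; rewrite /F (zsumE (sF _ _))//; lia.
  have -> : diff4 F s = \sum_(n <- zbox (K + N + 4)) diff4 f (n * N%:Z + s).
    rewrite diff4E -[in F s](addr0 s) !FE// !mulr_sumr -sumrB -big_split -sumrB -big_split.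
    by apply: eq_bigr => n _; rewrite diff4E /= !addrA addr0.
  apply: le_trans (ler_norm_sum _ _ _) _.
  apply: le_trans (ler_sum _ (fun t _ => fe _)) _.
  by rewrite sum_zbox_const.
have osc := periodic_diff4 N0 (mulr_ge0 (ler0n _ _) e0) FN dF.
rewrite (zsum_residues sf N0).
have -> : zsum (fun n => f (n * N%:Z)) = F 0 by apply: eq_zsum => n; rewrite addr0.
have -> : N%:R * F 0 = \sum_(0 <= s < N) F 0 by rewrite sumr_const_nat subn0 mulr_natl.
rewrite -sumrB; apply: le_trans (ler_norm_sum _ _ _) _.
apply: le_trans (ler_sum _ (fun s _ => osc _ _)) _.
by rewrite sumr_const_nat subn0 -[leLHS]mulr_natl [in leRHS]exprS !mulrA.
Qed.

End IntegerSums.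

(** * Fourth differences of the weight along a line *)

Section Weight.
Variable R : realFieldType.


Definition quad_ge0 (A b c : R) : Prop :=
  forall t : R, 0 <= A * t ^+ 2 + 2 * b * t + c.

(** The constant depends on A alone, so that it serves all parallel lines and all Y. Consider five
    consecutive points. If [P] is nonpositive at all of them, the weight vanishes; if it is
    nonnegative, the fourth difference is that of a polynomial in i / Y. If [P] changes sign, then,
    varying by only O(1 / Y), its positive values are O(1 / Y) and their fourth powers O(1 / Y ^
    4). *)
Lemma weight_diff4 (A : R) : 0 < A -> exists2 C : R, 0 <= C &
  forall (b c : R) (Y : nat), (0 < Y)%N ->
  quad_ge0 A b c -> forall t : int,
  `|diff4 (fun t => pos4 (1 - (A * t%:~R ^+ 2 + 2 * b * t%:~R + c) / Y%:R ^+ 2)) t|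
    <= C / Y%:R ^+ 4.
Proof.
(* [M] bounds the slope [e]: 2 (1 + A) at a point of positive weight, plus 8 A for moving by at most
   four. [G] = 4 M + 32 M bounds the variation of [P] over [0, 4] in units of [d], from |i - j| <= 4
   and |i + j| <= 8. *)
move=> A0; have [M MA] : exists M : R, M = 2 * (1 + 5 * A) by eexists.
have M1 : 1 <= M by rewrite MA; lra.
have [G GM] : exists G : R, G = 36 * M by eexists.
have G0 : 0 <= G by rewrite GM; lra.
have G4 : 0 <= G ^+ 4 by rewrite exprn_ge0.
have [C1 hC1] := quartic_rem_bound M.
(* 16 = 1 + 4 + 6 + 4 + 1 is the sum of the absolute values of the coefficients of a fourth
   difference. *)
exists (`|C1| + 16 * G ^+ 4).
  by apply: addr_ge0; [exact: normr_ge0|exact: mulr_ge0].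
move=> b c Y Y0 Qge0 t.
have y0 : 0 < Y%:R :> R by rewrite ltr0n.
have [d dY] : exists d : R, d = Y%:R^-1 by eexists.
have d0 : 0 < d by rewrite dY invr_gt0.
have d1 : d <= 1 by rewrite dY invf_le1// ler1n.
pose Q (t : R) := A * t ^+ 2 + 2 * b * t + c.
pose P (i : R) := 1 - Q (t%:~R + i) * d ^+ 2.
pose e := - 2 * ((A * t%:~R + b) * d).
have PE i : P i = P 0 + e * (i * d) + (- A) * (i * d) ^+ 2.
  by rewrite /P /Q /e; ring.
have -> (X : R) : X / Y%:R ^+ 4 = X * d ^+ 4 by rewrite dY exprVn.
pose S (p : R -> R) := p 4 - 4 * p 3 + 6 * p 2 - 4 * p 1 + p 0.
have -> : diff4 (fun t => pos4 (1 - (A * t%:~R ^+ 2 + 2 * b * t%:~R + c) / Y%:R ^+ 2)) t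
    = S (fun i => pos4 (P i)).
  rewrite diff4E /S /P !rmorphD /= addr0 dY !exprVn.
  by [].
pose good (i : R) := [/\ 0 <= i & i <= 4].
have g0 : good 0 by split; lra. have g1 : good 1 by split; lra.
have g2 : good 2 by split; lra. have g3 : good 3 by split; lra. have g4 : good 4 by split; lra.
have d4 : 0 <= d ^+ 4 by rewrite exprn_ge0// ltW.
have [hneg|] := pselect (forall i, good i -> P i <= 0).
  rewrite /S !pos4_eq0; try exact: hneg.
  rewrite !(mulr0, subr0, addr0) normr0; apply: mulr_ge0 => //.
  by apply: addr_ge0; [exact: normr_ge0|exact: mulr_ge0].
move=> /existsNP[i0 /not_implyP[gi0 /negP]]; rewrite -ltNge => Pi0.
have he : `|e| <= M.
  (* A nonnegative quadratic has b ^ 2 <= A c, so (A x + b) ^ 2 <= A Q(x), and Q(x) [d] ^ 2 < 1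
     wherever the weight is positive. *)
  have key : ((A * (t%:~R + i0) + b) * d) ^+ 2 <= (1 + A) ^+ 2.
    apply: (@le_trans _ _ (A * (Q (t%:~R + i0) * d ^+ 2))).
      have := Qge0 (- b / A); have -> : A * (- b / A) ^+ 2 + 2 * b * (- b / A) + c = (A * c - b ^+ 2) / A.
        by field; rewrite gt_eqF.
      rewrite pmulr_lge0 ?invr_gt0// => h.
      rewrite exprMn mulrA ler_wpM2r ?sqr_ge0//.
      have -> : A * Q (t%:~R + i0) = (A * (t%:~R + i0) + b) ^+ 2 + (A * c - b ^+ 2).
        by rewrite /Q; ring.
      by rewrite lerDl.
    have : Q (t%:~R + i0) * d ^+ 2 <= 1 by move: Pi0; rewrite /P; lra.
    move=> /(ler_wpM2l (ltW A0)); have := sqr_ge0 A; lra.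
  have h1 : `|(A * (t%:~R + i0) + b) * d| <= 1 + A.
    rewrite -(@ler_pXn2r _ 2)// ?nnegrE ?normr_ge0//; last lra.
    by rewrite real_normK ?num_real.
  have -> : e = - 2 * ((A * (t%:~R + i0) + b) * d) + 2 * (A * (i0 * d)) by rewrite /e; ring.
  have -> : M = 2 * (1 + A) + 2 * (A * (4 * 1)) by rewrite MA; ring.
  apply: ler_normD2; apply: ler_normM2; rewrite ?normrN ?ler_norm_nat//.
  apply: ler_normM2; first by rewrite (gtr0_norm A0) lexx.
  case: gi0 => i00 i04; apply: ler_normM2; first by rewrite (ger0_norm i00).
  by rewrite gtr0_norm.
have hc : `|- A| <= M by rewrite normrN gtr0_norm// MA; lra.
have hd : `|d| <= M by rewrite gtr0_norm//; lra.
rewrite mulrDl.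
have [hpos|] := pselect (forall i, good i -> 0 <= P i).
  have -> : S (fun i => pos4 (P i)) = d ^+ 4 * quartic_rem (P 0) e (- A) d.
    rewrite -quartic_remE /S !pos4E; try exact: hpos.
    by rewrite (PE 4) (PE 3) (PE 2) (PE 1) !mul0r expr0n /= !mulr0 !addr0.
  have hp : `|P 0| <= M.
    rewrite ger0_norm ?hpos//; apply: le_trans M1; rewrite /P gerBl mulr_ge0 ?sqr_ge0//.
    exact: Qge0.
  have := hC1 _ _ _ _ hp he hc hd => h.
  rewrite normrM (ger0_norm d4) mulrC -[leLHS]addr0; apply: lerD.
    by rewrite ler_wpM2r//; apply: le_trans h (ler_norm _).
  by apply: mulr_ge0 => //; exact: mulr_ge0.
move=> /existsNP[j0 /not_implyP[gj0 /negP]]; rewrite -ltNge => Pj0.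
have hP i : good i -> 0 <= pos4 (P i) <= (G * d) ^+ 4.
  move=> [i1 i4]; rewrite pos4_ge0 /= /pos4 ler_pXn2r ?nnegrE ?le_max ?lexx//; last first.
    by apply: mulr_ge0 => //; exact: ltW.
  rewrite ge_max; apply/andP; split; first by apply: mulr_ge0 => //; exact: ltW.
  apply: (@le_trans _ _ `|P i - P j0|).
    by apply: le_trans (ler_norm _); lra.
  rewrite (PE i) (PE j0).
  have -> : P 0 + e * (i * d) + - A * (i * d) ^+ 2 - (P 0 + e * (j0 * d) + - A * (j0 * d) ^+ 2)
    = (e * (i - j0) + - A * ((i - j0) * (i + j0) * d)) * d by ring.
  have -> : G * d = (M * 4 + M * (4 * 8 * 1)) * d by rewrite GM; ring.
  apply: ler_normM2; last by rewrite gtr0_norm.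
  case: gj0 => j1 j4.
  have hij : `|i - j0| <= 4 by rewrite ler_norml; apply/andP; split; lra.
  apply: ler_normD2; first exact: ler_normM2.
  apply: ler_normM2 => //; apply: ler_normM2; last by rewrite gtr0_norm.
  apply: ler_normM2 => //.
  by rewrite ger0_norm; lra.
rewrite -[leLHS]add0r; apply: lerD; first by apply: mulr_ge0; rewrite ?normr_ge0.
have := hP 0 g0; have := hP 1 g1; have := hP 2 g2; have := hP 3 g3; have := hP 4 g4.
rewrite -mulrA -exprMn /S ler_norml.
move=> /andP[? ?] /andP[? ?] /andP[? ?] /andP[? ?] /andP[? ?]; apply/andP; split; lra.
Qed.

End Weight.

(** * Weighted lattice sums under dilation of the coordinates *)

Section LatticeSums.
Variable R : realFieldType.
Implicit Types (Q : R -> R -> R -> R) (f g h : nat -> R).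

Definition ternary Q : Prop := exists q11 q22 q33 q12 q13 q23 : R, forall x y z,
  Q x y z = q11 * x ^+ 2 + q22 * y ^+ 2 + q33 * z ^+ 2
    + 2 * q12 * x * y + 2 * q13 * x * z + 2 * q23 * y * z.

(** A natural number m is used so that the weight at scale Y is supported in the integer box of
    half-width m Y. *)
Definition coercive Q (m : nat) : Prop := forall x y z : R,
  [/\ x ^+ 2 <= m%:R ^+ 2 * Q x y z, y ^+ 2 <= m%:R ^+ 2 * Q x y z
    & z ^+ 2 <= m%:R ^+ 2 * Q x y z].

(* The fourth power makes [weight] smooth enough (three continuous derivatives)
   for its sums over a lattice and over a sublattice to agree, after scaling by
   the index, up to O(1 / Y). *)
Definition weight Q (Y : nat) (x y z : int) : R :=
  pos4 (1 - Q x%:~R y%:~R z%:~R / Y%:R ^+ 2).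

Definition lattice_sum Q (Y : nat) : R :=
  \sum_(p \in [set: int * int * int]) weight Q Y p.1.1 p.1.2 p.2.

Definition close f g : Prop :=
  exists C : R, forall Y : nat, (0 < Y)%N -> `|f Y - g Y| <= C / Y%:R.

Lemma close_sym f g : close f g -> close g f.
Proof. by move=> [C hC]; exists C => Y Y0; rewrite distrC hC. Qed.

Lemma close_trans g f h : close f g -> close g h -> close f h.
Proof.
move=> [C hC] [D hD]; exists (C + D) => Y Y0.
have -> : f Y - h Y = (f Y - g Y) + (g Y - h Y) by ring.
by rewrite mulrDl; apply: ler_normD2; [exact: hC|exact: hD].
Qed.

Lemma closeZ c f g : close f g -> close (fun Y => c * f Y) (fun Y => c * g Y).
Proof.
move=> [C hC]; exists (`|c| * C) => Y Y0.
by rewrite -mulrBr -mulrA; apply: ler_normM2 => //; exact: hC.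
Qed.

Lemma coercive_gt0 Q m : coercive Q m -> (0 < m)%N.
Proof.
move=> /(_ 1 0 0)[h _ _]; rewrite lt0n; apply/eqP => m0; move: h.
by rewrite m0 expr1n expr0n mul0r ler10.
Qed.

Lemma coercive_ge0 Q m x y z : coercive Q m -> 0 <= Q x y z.
Proof.
move=> cQ; have [h _ _] := cQ x y z.
have m0 : 0 < m%:R ^+ 2 :> R by rewrite exprn_gt0// ltr0n (coercive_gt0 cQ).
by rewrite -(pmulr_rge0 _ m0); apply: le_trans h; exact: sqr_ge0.
Qed.

Lemma weight_ge0 Q Y x y z : 0 <= weight Q Y x y z.
Proof. exact: pos4_ge0. Qed.

Let far (m Y : nat) (x : int) (q : R) : (0 < m)%N -> (0 < Y)%N ->
  x%:~R ^+ 2 <= m%:R ^+ 2 * q -> (m * Y <= `|x|)%N -> 1 - q / Y%:R ^+ 2 <= 0.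
Proof.
move=> m0 Y0 h xK; rewrite subr_le0 ler_pdivlMr ?mul1r; last by rewrite exprn_gt0// ltr0n.
have m2 : 0 < m%:R ^+ 2 :> R by rewrite exprn_gt0// ltr0n.
rewrite -(ler_pM2l m2); apply: le_trans h; rewrite -exprMn -natrM.
have -> : x%:~R ^+ 2 = (`|x|%N%:R : R) ^+ 2.
  by rewrite [in RHS]pmulrn abszE intr_norm real_normK ?num_real.
by rewrite ler_pXn2r ?nnegrE ?ler0n// ler_nat.
Qed.

Lemma weight_far Q m Y x y z : coercive Q m -> (0 < Y)%N ->
  (m * Y <= `|x|)%N || (m * Y <= `|y|)%N || (m * Y <= `|z|)%N -> weight Q Y x y z = 0.
Proof.
move=> cQ Y0 H; have m0 := coercive_gt0 cQ.
have [hx hy hz] := cQ x%:~R y%:~R z%:~R.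
apply: pos4_eq0; move: H => /orP[/orP[H|H]|H].
- exact: far H. 
- exact: far H.
- exact: far H.
Qed.

Definition zbox3 (K : nat) : seq (int * int * int) :=
  [seq (xy, z) | xy <- [seq (x, y) | x <- zbox K, y <- zbox K], z <- zbox K].

Lemma zbox3_uniq K : uniq (zbox3 K).
Proof.
rewrite !allpairs_uniq ?zbox_uniq//; first by move=> [? ?] [? ?].
by move=> [? ?] [? ?].
Qed.

Lemma weight_zbox3 Q m Y (p : int * int * int) : coercive Q m -> (0 < Y)%N ->
  p \notin zbox3 (m * Y) -> weight Q Y p.1.1 p.1.2 p.2 = 0.
Proof.
case: p => [[x y] z] cQ Y0 /=; apply: contraNeq => w0.
have B t : (`|t| < m * Y)%N || (m * Y <= `|t|)%N by case: ltnP.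
have := B x; have := B y; have := B z.
have H : ~~ ((m * Y <= `|x|)%N || (m * Y <= `|y|)%N || (m * Y <= `|z|)%N).
  by apply: contra w0 => h; rewrite (weight_far cQ Y0 h).
move: H; rewrite !negb_or => /andP[/andP[/negPf -> /negPf ->] /negPf ->].
rewrite !orbF => hz hy hx.
by apply/allpairsP; exists ((x, y), z); split=> //=; [apply/allpairsP; exists (x, y); split|];
  rewrite ?mem_zbox.
Qed.

Lemma lattice_sum_seq Q m Y : coercive Q m -> (0 < Y)%N ->
  lattice_sum Q Y = \sum_(p <- zbox3 (m * Y)) weight Q Y p.1.1 p.1.2 p.2.
Proof.
move=> cQ Y0; rewrite /lattice_sum (fsbigE (zbox3 (m * Y)))//.
- by apply: eq_bigl => p; rewrite in_setT.
- exact: zbox3_uniq.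
- by move=> p _; exact: weight_zbox3.
Qed.

Lemma lattice_sum_zsum Q m Y : coercive Q m -> (0 < Y)%N ->
  lattice_sum Q Y = \sum_(y <- zbox (m * Y)) \sum_(z <- zbox (m * Y))
    zsum (fun x => weight Q Y x y z).
Proof.
move=> cQ Y0; rewrite (lattice_sum_seq cQ Y0) big_allpairs big_allpairs exchange_big /=.
apply: eq_bigr => y _; rewrite exchange_big /=; apply: eq_bigr => z _.
by rewrite (@zsumE _ (m * Y))// => x xK; apply: (weight_far cQ Y0); rewrite xK.
Qed.

Lemma lattice_sum_swap Q Y : lattice_sum Q Y = lattice_sum (fun x y z => Q y x z) Y.
Proof.
rewrite /lattice_sum (reindex_fsbigT (fun p : int * int * int => (p.1.2, p.1.1, p.2)))//.
by exists (fun p : int * int * int => (p.1.2, p.1.1, p.2)) => -[[? ?] ?].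
Qed.

Lemma lattice_sum_rot Q Y : lattice_sum Q Y = lattice_sum (fun x y z => Q z y x) Y.
Proof.
rewrite /lattice_sum (reindex_fsbigT (fun p : int * int * int => (p.2, p.1.2, p.1.1)))//.
by exists (fun p : int * int * int => (p.2, p.1.2, p.1.1)) => -[[? ?] ?].
Qed.

(** [zsum_dilate] is applied on each of the (2 m Y) ^ 2 lines parallel to the first axis; each costs
    O(Y) O(1 / Y ^ 4), which adds up to O(1 / Y). *)
Lemma lattice_sum_dilate Q m N : ternary Q -> coercive Q m -> (0 < N)%N ->
  close (lattice_sum Q) (fun Y => N%:R * lattice_sum (fun x => Q (N%:R * x)) Y).
Proof.
move=> [q11 [q22 [q33 [q12 [q13 [q23 QE]]]]]] cQ N0.
have m0 := coercive_gt0 cQ.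
have q0 : 0 < q11.
  have [h _ _] := cQ 1 0 0; move: h; rewrite QE expr1n expr0n /= !(mulr0, addr0, mulr1) => h.
  have m2 : 0 < m%:R ^+ 2 :> R by rewrite exprn_gt0// ltr0n.
  by rewrite -(pmulr_rgt0 _ m2); apply: lt_le_trans h.
have [C C0 hC] := weight_diff4 q0.
exists (4 * m%:R ^+ 2 * (N%:R ^+ 5 * (2 * (m%:R + N%:R + 4))) * C) => Y Y0.
have y1 : 1 <= Y%:R :> R by rewrite ler1n.
have y0 : 0 < Y%:R :> R by rewrite ltr0n.
have cN : coercive (fun x => Q (N%:R * x)) m.
  move=> x y z; have [h1 h2 h3] := cQ (N%:R * x) y z; split=> //.
  apply: le_trans h1; rewrite exprMn ler_peMl ?sqr_ge0// exprn_ege1// ler1n//.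
rewrite (lattice_sum_zsum cQ Y0) (lattice_sum_zsum cN Y0).
set K := (m * Y)%N.
rewrite mulr_sumr -sumrB.
pose e := N%:R ^+ 5 * (K + N + 4).*2%:R * (C / Y%:R ^+ 4) : R.
apply: (@le_trans _ _ (\sum_(y <- zbox K) \sum_(z <- zbox K) e)).
  apply: le_trans (ler_norm_sum _ _ _) _; apply: ler_sum => y _.
  rewrite mulr_sumr -sumrB.
  apply: le_trans (ler_norm_sum _ _ _) _; apply: ler_sum => z _.
  have -> : zsum (fun x => weight (fun x0 => Q (N%:R * x0)) Y x y z) =
      zsum (fun n => weight Q Y (n * N%:Z) y z).
    by apply: eq_zsum => n; rewrite /weight rmorphM /= -pmulrn [N%:R * _]mulrC.
  apply: (zsum_dilate N0).
  - by apply: divr_ge0 => //; apply: exprn_ge0; exact: ltW.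
  - by move=> x xK; apply: (weight_far cQ Y0); rewrite xK.
  - move=> t.
    pose b := q12 * y%:~R + q13 * z%:~R.
    pose c := q22 * y%:~R ^+ 2 + q33 * z%:~R ^+ 2 + 2 * q23 * y%:~R * z%:~R.
    have E (x : R) : Q x y%:~R z%:~R = q11 * x ^+ 2 + 2 * b * x + c.
      by rewrite QE /b /c; ring.
    have -> : (fun x => weight Q Y x y z) =
      (fun t : int => pos4 (1 - (q11 * t%:~R ^+ 2 + 2 * b * t%:~R + c) / Y%:R ^+ 2)).
      by apply/funext => x; rewrite /weight E.
    by apply: hC => // x; rewrite -E; apply: coercive_ge0 cQ.
under eq_bigr do rewrite sum_zbox_const.
rewrite sum_zbox_const.
have hK : (K + N + 4)%:R <= (m%:R + N%:R + 4) * Y%:R :> R.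
  have le (u : R) : 0 <= u -> u <= u * Y%:R by move=> u0; rewrite ler_peMr.
  have := le N%:R (ler0n _ _); have := le 4%:R (ler0n _ _).
  by rewrite !natrD natrM; lra.
have -> : 4 * m%:R ^+ 2 * (N%:R ^+ 5 * (2 * (m%:R + N%:R + 4))) * C / Y%:R =
  (m%:R * Y%:R * 2) * ((m%:R * Y%:R * 2) *
    (N%:R ^+ 5 * ((m%:R + N%:R + 4) * Y%:R * 2) * (C / Y%:R ^+ 4))) :> R.
  by field; rewrite gt_eqF.
rewrite /e -!muln2 !natrM; do 2![apply: ler_wpM2l; first by rewrite !mulr_ge0].
apply: ler_wpM2r; first by apply: divr_ge0 => //; apply: exprn_ge0; exact: ltW.
by apply: ler_wpM2l; [exact: exprn_ge0|apply: ler_wpM2r].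
Qed.


Lemma ternary_swap Q : ternary Q -> ternary (fun x y z => Q y x z).
Proof.
move=> [q11 [q22 [q33 [q12 [q13 [q23 QE]]]]]].
by exists q22, q11, q33, q12, q23, q13 => x y z; rewrite QE; ring.
Qed.

Lemma ternary_rot Q : ternary Q -> ternary (fun x y z => Q z y x).
Proof.
move=> [q11 [q22 [q33 [q12 [q13 [q23 QE]]]]]].
by exists q33, q22, q11, q23, q13, q12 => x y z; rewrite QE; ring.
Qed.

Lemma ternary_scale c Q : ternary Q -> ternary (fun x => Q (c * x)).
Proof.
move=> [q11 [q22 [q33 [q12 [q13 [q23 QE]]]]]].
by exists (c ^+ 2 * q11), q22, q33, (c * q12), (c * q13), q23 => x y z; rewrite QE; ring.
Qed.

Lemma coercive_swap Q m : coercive Q m -> coercive (fun x y z => Q y x z) m.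
Proof. by move=> cQ x y z; have [? ? ?] := cQ y x z. Qed.

Lemma coercive_rot Q m : coercive Q m -> coercive (fun x y z => Q z y x) m.
Proof. by move=> cQ x y z; have [? ? ?] := cQ z y x. Qed.

Lemma coercive_scaleV Q m n : (0 < n)%N -> coercive Q m ->
  coercive (fun x => Q (n%:R^-1 * x)) (m * n).
Proof.
move=> n0 cQ x y z; have [h1 h2 h3] := cQ (n%:R^-1 * x) y z.
have n1 : 1 <= n%:R ^+ 2 :> R by rewrite exprn_ege1// ler1n.
have nz : n%:R != 0 :> R by rewrite pnatr_eq0 -lt0n.
have le (t : R) : 0 <= t -> t <= n%:R ^+ 2 * t by move=> t0; rewrite ler_peMl.
have Q0 : 0 <= m%:R ^+ 2 * Q (n%:R^-1 * x) y z by apply: le_trans h1; exact: sqr_ge0.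
rewrite natrM exprMn (mulrC (m%:R ^+ 2)) -mulrA; split.
- have -> : x ^+ 2 = n%:R ^+ 2 * (n%:R^-1 * x) ^+ 2 by field.
  by rewrite ler_wpM2l// sqr_ge0.
- by apply: le_trans h2 _; exact: le.
- by apply: le_trans h3 _; exact: le.
Qed.

Lemma coercive_scale Q m n : (0 < n)%N -> coercive Q m -> coercive (fun x => Q (n%:R * x)) m.
Proof.
move=> n0 cQ x y z; have [h1 h2 h3] := cQ (n%:R * x) y z; split=> //.
by apply: le_trans h1; rewrite exprMn ler_peMl ?sqr_ge0// exprn_ege1// ler1n.
Qed.

Definition good_form Q := ternary Q /\ exists m, coercive Q m.

Lemma good_scale Q (n k : nat) : (0 < n)%N -> (0 < k)%N -> good_form Q ->
  good_form (fun x => Q (n%:R / k%:R * x)).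
Proof.
move=> n0 k0 [tQ [m cQ]]; split; first exact: ternary_scale.
exists (m * k)%N.
have -> : (fun x => Q (n%:R / k%:R * x)) = (fun x => Q (k%:R^-1 * (n%:R * x))).
  by apply/funext => x; rewrite mulrA [n%:R / _]mulrC.
exact: coercive_scale n0 (coercive_scaleV k0 cQ).
Qed.

Lemma good_swap Q : good_form Q -> good_form (fun x y z => Q y x z).
Proof.
by move=> [tQ [m cQ]]; split; [exact: ternary_swap|exists m; exact: coercive_swap].
Qed.

Lemma good_rot Q : good_form Q -> good_form (fun x y z => Q z y x).
Proof.
by move=> [tQ [m cQ]]; split; [exact: ternary_rot|exists m; exact: coercive_rot].
Qed.

(** Both [Q] and its rescaling by n / k are integral dilations, by k and by n, of the form rescaled
    by 1 / k. *)
Lemma lattice_sum_scale1 Q (n k : nat) : (0 < n)%N -> (0 < k)%N -> good_form Q ->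
  close (lattice_sum Q)
    (fun Y => n%:R / k%:R * lattice_sum (fun x => Q (n%:R / k%:R * x)) Y).
Proof.
move=> n0 k0 [tQ [m cQ]].
have kz : k%:R != 0 :> R by rewrite pnatr_eq0 -lt0n.
have tQ' := ternary_scale k%:R^-1 tQ; have cQ' := coercive_scaleV k0 cQ.
have := lattice_sum_dilate tQ' cQ' k0.
have := lattice_sum_dilate tQ' cQ' n0.
have -> : (fun x => Q (k%:R^-1 * (k%:R * x))) = Q by apply/funext => x; rewrite mulKf.
have -> : (fun x => Q (k%:R^-1 * (n%:R * x))) = (fun x => Q (n%:R / k%:R * x)).
  by apply/funext => x; rewrite mulrA [n%:R / _]mulrC.
move=> h1 h2; have := closeZ k%:R^-1 (close_trans (close_sym h2) h1).
rewrite (_ : (fun Y => _) = lattice_sum Q); last by apply/funext => Y; rewrite mulKf.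
rewrite (_ : (fun Y => _ * (_ * _)) = (fun Y => n%:R / k%:R *
  lattice_sum (fun x => Q (n%:R / k%:R * x)) Y))//.
by apply/funext => Y; rewrite mulrA [n%:R / _]mulrC.
Qed.

(** Each coordinate in turn is brought to the front by a permutation. The accumulated factor is the
    ratio of covolumes. *)
Lemma lattice_sum_scale3 Q (n1 k1 n2 k2 n3 k3 : nat) :
  (0 < n1)%N -> (0 < k1)%N -> (0 < n2)%N -> (0 < k2)%N -> (0 < n3)%N -> (0 < k3)%N ->
  good_form Q ->
  let d1 := n1%:R / k1%:R in let d2 := n2%:R / k2%:R in let d3 := n3%:R / k3%:R in
  d1 * d2 * d3 = 1 ->
  close (lattice_sum Q) (lattice_sum (fun x y z => Q (d1 * x) (d2 * y) (d3 * z))).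
Proof.
move=> n10 k10 n20 k20 n30 k30 gQ d1 d2 d3 d123.
have h1 := lattice_sum_scale1 n10 k10 gQ.
have gQ1 := good_scale n10 k10 gQ.
have h2 := lattice_sum_scale1 n20 k20 (good_swap gQ1).
have gQ2 := good_swap (good_scale n20 k20 (good_swap gQ1)).
have h3 := lattice_sum_scale1 n30 k30 (good_rot gQ2).
have e1 Q' : (fun Y => lattice_sum Q' Y) = lattice_sum (fun x y z => Q' y x z).
  by apply/funext => Y; exact: lattice_sum_swap.
have e2 Q' : (fun Y => lattice_sum Q' Y) = lattice_sum (fun x y z => Q' z y x).
  by apply/funext => Y; exact: lattice_sum_rot.
move: h2 h3; rewrite -(e1 (fun x y z => Q (d1 * x) y z)).
move=> h2; rewrite -(e2 (fun x y z => Q (d1 * x) (d2 * y) z)) => h3.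
have E2 : (fun Y => n2%:R / k2%:R * lattice_sum (fun x y z => Q (d1 * y) (n2%:R / k2%:R * x) z) Y) =
   (fun Y => d2 * lattice_sum (fun x y z => Q (d1 * x) (d2 * y) z) Y).
  by apply/funext => Y; rewrite lattice_sum_swap.
have E3 : (fun Y => n3%:R / k3%:R * lattice_sum (fun x y z => Q (d1 * z) (d2 * y) (n3%:R / k3%:R * x)) Y) =
   (fun Y => d3 * lattice_sum (fun x y z => Q (d1 * x) (d2 * y) (d3 * z)) Y).
  by apply/funext => Y; rewrite lattice_sum_rot.
move: h2 h3; rewrite E2 E3 => h2 h3.
have := close_trans h1 (closeZ d1 (close_trans h2 (closeZ d2 h3))).
set F := (fun Y => d1 * _); suff -> : F = lattice_sum (fun x y z => Q (d1 * x) (d2 * y) (d3 * z)) by [].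
by apply/funext => Y; rewrite -[RHS]mul1r -d123 /F /d1 /d2 /d3 !mulrA.
Qed.

End LatticeSums.

(** * Surjectivity of norm-preserving injections between lattices of equal covolume *)

Section Rigidity.
Variable R : archiRealFieldType.
Implicit Types (Q : R -> R -> R -> R).

Lemma lattice_sum_inj Q Q' (f : int * int * int -> int * int * int) p0 Y :
  good_form Q' -> (0 < Y)%N -> injective f ->
  (forall p, Q' (f p).1.1%:~R (f p).1.2%:~R (f p).2%:~R = Q p.1.1%:~R p.1.2%:~R p.2%:~R) ->
  (forall p, f p <> p0) ->
  lattice_sum Q Y + weight Q' Y p0.1.1 p0.1.2 p0.2 <= lattice_sum Q' Y.
Proof.
move=> [_ [m cQ']] Y0 fI fQ fp0.
pose W (p : int * int * int) := weight Q' Y p.1.1 p.1.2 p.2.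
have W0 p : 0 <= W p by exact: weight_ge0.
have -> : lattice_sum Q Y = \sum_(p \in f @` [set: int * int * int]) W p.
  rewrite fsbig_image; last by move=> ? ? _ _ /fI.
  by apply: eq_fsbigr => p _; rewrite /W /weight fQ.
rewrite fsbig_mkcond (fsbigE (zbox3 (m * Y)))//; first last.
- move=> p _ pr; rewrite /patch; case: ifP => // _; exact: weight_zbox3 pr.
- exact: zbox3_uniq.
rewrite (eq_bigl xpredT); last by move=> p; rewrite in_setT.
rewrite (lattice_sum_seq cQ' Y0).
have [p0r|p0r] := boolP (p0 \in zbox3 (m * Y)); last first.
  rewrite (weight_zbox3 cQ' Y0 p0r) addr0; apply: ler_sum => p _.
  by rewrite /patch; case: ifP => // _; exact: W0.
rewrite !(bigD1_seq p0)//= ?zbox3_uniq//.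
rewrite {1}/patch ifF; last first.
  by apply/negP => /set_mem[p _]; exact: fp0.
rewrite add0r [leLHS]addrC; apply: lerD => //; apply: ler_sum => p _.
by rewrite /patch; case: ifP => // _; exact: W0.
Qed.

Lemma lattice_rigidity Q Q' (f : int * int * int -> int * int * int) :
  good_form Q' -> close (lattice_sum Q) (lattice_sum Q') -> injective f ->
  (forall p, Q' (f p).1.1%:~R (f p).1.2%:~R (f p).2%:~R = Q p.1.1%:~R p.1.2%:~R p.2%:~R) ->
  forall p', exists p, f p = p'.
Proof.
move=> gQ' [C hC] fI fQ p0; apply: contrapT => /forallNP fp0.
pose q := Q' p0.1.1%:~R p0.1.2%:~R p0.2%:~R.
have q0 : 0 <= q by have [_ [m cQ']] := gQ'; exact: coercive_ge0 cQ'.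
(* Y > 2 q and Y >= 2 give the missed point a weight of at least (1 / 2) ^ 4, and Y > 16 |C| makes
   the error C / Y smaller than that. *)
pose Y := (Num.truncn (16 * `|C| + 2 * q)).+2.
have hY : 16 * `|C| + 2 * q < Y%:R.
  by apply: lt_le_trans (truncnS_gt _) _; rewrite ler_nat.
have y2 : 2 <= Y%:R :> R by rewrite ler_nat.
have Y0 : (0 < Y)%N by [].
have y0 : 0 < Y%:R :> R by rewrite ltr0n.
have h := lattice_sum_inj gQ' Y0 fI fQ fp0.
have w : (1 / 2) ^+ 4 <= weight Q' Y p0.1.1 p0.1.2 p0.2.
  have hq : 1 / 2 <= 1 - q / Y%:R ^+ 2.
    have : q / Y%:R ^+ 2 <= 1 / 2.
      rewrite ler_pdivrMr ?exprn_gt0// expr2.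
      have : 2 * Y%:R <= Y%:R * Y%:R :> R by rewrite ler_pM2r.
      by have := normr_ge0 C; lra.
    by lra.
  rewrite /weight -/q pos4E; last by lra.
  by rewrite ler_pXn2r// nnegrE; lra.
have := hC Y Y0; rewrite distrC => /(le_trans (ler_norm _)).
have : C / Y%:R < 1 / 16.
  rewrite ltr_pdivrMr//; have := ler_norm C; lra.
have e16 : (1 / 2) ^+ 4 = 1 / 16 :> R by field.
by rewrite e16 in w; lra.
Qed.
End Rigidity.

(** * Bases of quaternion orders and ternary forms *)

(* The integers [c] with [c * x ^+ k] integral for all [k] form an ideal of Z
   that is stable under multiplication by [x]; its generator shows that [x] is
   integral. *)
Lemma rat_int_of_pow (x : rat) (d : nat) : (0 < d)%N ->
  (forall k, d%:R * x ^+ k \is a Num.int) -> x \is a Num.int.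
Proof.
move=> d0 hd.
pose I (c : int) := forall k, c%:~R * x ^+ k \is a Num.int.
pose P (n : nat) := (0 < n)%N && `[< I n%:Z >].
have exP : exists n, P n by exists d; rewrite /P d0; apply/asboolP.
case: (ex_minnP exP) => m /andP[m0 /asboolP Im] hm.
have /intrP[e he] : m%:R * x \is a Num.int by have := Im 1%N; rewrite expr1.
have Ie : I e by move=> k; rewrite -he -mulrA -exprS; exact: Im.
have mz : m%:Z != 0 by lia.
have Ir : I (e %% m)%Z.
  move=> k; have := divz_eq e m => /(congr1 (fun t => t - (e %/ m)%Z * m)).
  rewrite addrAC subrr add0r => <-; rewrite rmorphB rmorphM /= mulrBl -mulrA.
  by apply: rpredB; [exact: Ie|apply: rpredM; [exact: intr_int|exact: Im]].
have r0 : (e %% m)%Z = 0.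
  apply/eqP; apply: contraT => r0.
  have rn : (0 <= (e %% m)%Z) by rewrite modz_ge0.
  have : P `|(e %% m)%Z|%N.
    by rewrite /P absz_gt0 r0; apply/asboolP; rewrite gez0_abs.
  move/hm; rewrite -lez_nat gez0_abs// => h.
  by have := ltz_pmod e (_ : 0 < m%:Z); lia.
apply/intrP; exists (e %/ m)%Z.
have mr : m%:R != 0 :> rat by rewrite pnatr_eq0 -lt0n.
apply: (mulfI mr); rewrite he {1}(divz_eq e m) r0 addr0 rmorphM /= mulrC.
by rewrite -pmulrn.
Qed.

Section OrderBasis.
Variables (a b : rat).
Local Notation B := (quat a b).
Implicit Types x y z h : B.
Variable O : set B.
Hypothesis HO : is_order O.

Lemma order1 : O 1. Proof. by case: HO. Qed.
Lemma orderB x y : O x -> O y -> O (x - y). Proof. by case: HO => _ _ h _; exact: h. Qed.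
Lemma orderM x y : O x -> O y -> O (x * y). Proof. by case: HO => _ _ _; exact. Qed.
Lemma orderN x : O x -> O (- x).
Proof. by move=> Ox; rewrite -sub0r -(subrr 1); do !apply: orderB => //; exact: order1. Qed.
Lemma orderD x y : O x -> O y -> O (x + y).
Proof. by move=> Ox Oy; rewrite -[y]opprK; apply: orderB => //; exact: orderN. Qed.
Lemma orderX x k : O x -> O (x ^+ k).
Proof.
by move=> Ox; elim: k => [|k IH]; [exact: order1|rewrite exprS; exact: orderM].
Qed.
Lemma orderZ (m : int) x : O x -> O (m%:~R *: x).
Proof.
move=> Ox; have O0 : O 0 by rewrite -(subrr 1); apply: orderB; exact: order1.
have H (n : nat) : O (n%:R *: x).
  elim: n => [|n IH]; first by rewrite scale0r.
  by rewrite -natr1 scalerDl scale1r; apply: orderD.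
case: m => n; first by rewrite -pmulrn.
by rewrite NegzE rmorphN /= scaleNr -pmulrn; apply: orderN.
Qed.
Lemma order_scalar (m : int) : O m%:~R%:A. Proof. exact: orderZ order1. Qed.

Lemma qnr_sum n (z : 'I_n -> int) (e : 'I_n -> B) :
  qnr (\sum_i e i *~ z i) = \sum_i \sum_j (z i * z j)%:~R * dot (e i) (e j).
Proof.
have dl (F : 'I_n -> B) y : dot (\sum_i F i) y = \sum_i dot (F i) y.
  by apply: (big_morph (fun x => dot x y)) => [? ?|]; rewrite ?dotDl ?dot0l.
rewrite qnr_dot dl; apply: eq_bigr => i _; rewrite dotC dl; apply: eq_bigr => j _.
by rewrite -!scaler_int !dotE dotC rmorphM /= mulrA [_%:~R * _%:~R]mulrC.
Qed.

Lemma qnrX x k : qnr (x ^+ k) = qnr x ^+ k.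
Proof. by elim: k => [|k IH]; rewrite ?expr0 ?qnr1// !exprS qnrM IH. Qed.

(** Norms of powers of [x] are powers of its norm, and all norms on the lattice share the
    denominator [d], a product of denominators of Gram entries; so [rat_int_of_pow] applies. *)
Lemma order_qnr_int x : O x -> qnr x \is a Num.int.
Proof.
move=> Ox; have [[e [_ OE]] _ _ _] := HO.
pose d := (\prod_(p : 'I_4 * 'I_4) `|denq (dot e`_p.1 e`_p.2)%R|)%N.
have d0 : (0 < d)%N by rewrite prodn_gt0// => p; rewrite absz_gt0 denq_eq0.
apply: (rat_int_of_pow d0) => k; rewrite -qnrX.
have := orderX k Ox; rewrite OE => -[z ->]; rewrite qnr_sum mulr_sumr.
apply: rpred_sum => i _; rewrite mulr_sumr; apply: rpred_sum => j _.
rewrite mulrCA; apply: rpredM; first exact: intr_int.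
rewrite /d (bigD1 (i, j))//= natrM mulrC mulrA; apply: rpredM; last exact: rpred_nat.
rewrite [_%:R]pmulrn gez0_abs ?ltW ?denq_gt0//.
by rewrite -numqE; exact: intr_int.
Qed.

Lemma order_qtr_int x : O x -> qtr x \is a Num.int.
Proof.
move=> Ox; have -> : qtr x = qnr (x + 1) - qnr x - 1 by rewrite qtr_re /qnr /=; ring.
apply: rpredB; last exact: rpred1.
by apply: rpredB; apply: order_qnr_int => //; apply: orderD => //; exact: order1.
Qed.

End OrderBasis.

Section QuadBasis.
Variables (a b : rat).
Local Notation B := (quat a b).
Implicit Types (x y z h : B) (O : set B).

Definition comb4 (e1 e2 e3 : B) (x0 x1 x2 x3 : rat) : B :=
  x0 *: 1 + x1 *: e1 + x2 *: e2 + x3 *: e3.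

Definition quad_basis O (e1 e2 e3 : B) : Prop := trip e1 e2 e3 != 0 /\
  forall h, O h <-> exists z0 z1 z2 z3 : int, h = comb4 e1 e2 e3 z0%:~R z1%:~R z2%:~R z3%:~R.

Lemma trip_comb4 (e1 e2 e3 : B) (x0 x1 x2 x3 y0 y1 y2 y3 z0 z1 z2 z3 : rat) :
  trip (comb4 e1 e2 e3 x0 x1 x2 x3) (comb4 e1 e2 e3 y0 y1 y2 y3) (comb4 e1 e2 e3 z0 z1 z2 z3) =
  (x1 * (y2 * z3 - y3 * z2) - x2 * (y1 * z3 - y3 * z1)
    + x3 * (y1 * z2 - y2 * z1)) * trip e1 e2 e3.
Proof. by rewrite /trip /comb4 /=; ring. Qed.

Lemma comb4_inj (e1 e2 e3 : B) (x0 x1 x2 x3 y0 y1 y2 y3 : rat) : trip e1 e2 e3 != 0 ->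
  comb4 e1 e2 e3 x0 x1 x2 x3 = comb4 e1 e2 e3 y0 y1 y2 y3 ->
  [/\ x0 = y0, x1 = y1, x2 = y2 & x3 = y3].
Proof.
move=> t0 E.
have t (x1' x2' x3' x0' y1' y2' y3' : rat) : trip (comb4 e1 e2 e3 x0 x1 x2 x3) (comb4 e1 e2 e3 0 x1' x2' x3')
      (comb4 e1 e2 e3 x0' y1' y2' y3') = trip (comb4 e1 e2 e3 y0 y1 y2 y3)
      (comb4 e1 e2 e3 0 x1' x2' x3') (comb4 e1 e2 e3 x0' y1' y2' y3') by rewrite E.
have h1 : x1 = y1.
  by have := t 0 1 0 0 0 0 1; rewrite !trip_comb4 => /(mulIf t0); lra.
have h2 : x2 = y2.
  by have := t 0 0 1 0 1 0 0; rewrite !trip_comb4 => /(mulIf t0); lra.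
have h3 : x3 = y3.
  by have := t 1 0 0 0 0 1 0; rewrite !trip_comb4 => /(mulIf t0); lra.
split=> //; move: E; rewrite h1 h2 h3 /comb4 => /(congr1 (@qre _ a b)) /=; lra.
Qed.

Lemma order_comb4 O (e1 e2 e3 : B) (z0 z1 z2 z3 : int) : is_order O -> O e1 -> O e2 -> O e3 ->
  O (comb4 e1 e2 e3 z0%:~R z1%:~R z2%:~R z3%:~R).
Proof. by move=> HO *; rewrite /comb4; do !apply: (orderD HO); apply: (orderZ HO) => //; exact: order1. Qed.

(** The Smith form of the coordinate row of 1 gives a basis in which 1 is a multiple of the first
    vector. That vector has integral norm, which forces the multiple to be 1 or - 1, so it can be
    replaced by 1. *)
Lemma order_quad_basis O : is_order O -> exists e1 e2 e3, quad_basis O e1 e2 e3.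
Proof.
move=> HO; have [[e [fe OE]] _ _ _] := HO.
have Oe i : O e`_(i : 'I_4).
  rewrite OE; exists (fun j => (j == i)%:Z); rewrite (bigD1 i)//= eqxx mulr1z.
  by rewrite big1 ?addr0// => j /negPf ->; rewrite mulr0z.
have [z hz] : Zspan e 1 by rewrite -OE; exact: order1.
have [L Lu [R Ru [d _ hM]]] := int_Smith_normal_form (\row_i z i).
pose e' (i : 'I_4) := \sum_(j < 4) e`_j *~ R i j.
have Oe' i : O (e' i).
  rewrite /e'; elim/big_ind: _ => [|x y|j _].
  - by rewrite -(subrr 1); apply: (orderB HO); exact: order1.
  - exact: orderD.
  - by rewrite -scaler_int; apply: (orderZ HO).
have eE (j : 'I_4) : e`_j = \sum_i e' i *~ (invmx R) j i.
  rewrite /e'; under eq_bigr do rewrite mulrz_suml.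
  rewrite exchange_big /= (bigD1 j)//= [X in _ + X]big1 ?addr0 => [|k kj].
    transitivity (e`_j *~ (invmx R *m R) j j).
      by rewrite mulVmx// mxE eqxx mulr1z.
    rewrite mxE mulrz_sumr; apply: eq_bigr => i _; by rewrite -mulrzA mulrC.
  transitivity (e`_k *~ (invmx R *m R) j k); last first.
    by rewrite mulVmx// mxE eq_sym (negPf kj) mulr0z.
  rewrite mxE mulrz_sumr; apply: eq_bigr => i _; by rewrite -mulrzA mulrC.
have [s hs] : exists s : int, e' ord0 *~ s = 1.
  exists (L 0 0 * d`_0).
  rewrite hz /e' mulrz_suml; apply: eq_bigr => j _; rewrite -mulrzA; congr (_ *~ _).
  have := congr1 (fun M : 'rV_4 => M 0 j) hM; rewrite !mxE => ->.
  rewrite (bigD1 ord0)//= [X in _ + X]big1 ?addr0 => [|k k0].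
    by rewrite !mxE big_ord_recl big_ord0 addr0 !mxE eqxx mulr1n mulrC.
  rewrite !mxE big_ord_recl big_ord0 addr0 !mxE /=.
  have -> : (0%N == k) = false by case: k k0 => [[]].
  by rewrite mulr0n mulr0 mul0r.
have hs' : s%:~R *: e' ord0 = 1 by rewrite scaler_int.
have s2 : s * s = 1.
  have /intrP[n hn] := order_qnr_int HO (Oe' ord0).
  have : n * (s * s) = 1.
    have := congr1 (@qnr _ a b) hs'; rewrite qnr1 qnr_dot !dotE -qnr_dot hn => E.
    by apply: (@intr_inj rat); rewrite !rmorphM /= -[RHS]E; ring.
  have := sqr_ge0 s; rewrite expr2; move: (s * s) => m m0 nm.
  have n0 : 0 < n by nia.
  have m1 : m <= 1 by nia.
  by nia.
have e'0 : e' ord0 = s%:~R%:A.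
  by rewrite scaler_int -hs -mulrzA s2 mulr1z.
pose f (k : nat) := e' (inord k).
have sum4 (F : 'I_4 -> B) : \sum_i F i = F ord0 + F (inord 1) + F (inord 2) + F (inord 3).
  rewrite !big_ord_recl big_ord0 addr0 !addrA.
  by congr (_ + F _ + F _ + F _); apply/val_inj; rewrite /= inordK.
exists (f 1%N), (f 2%N), (f 3%N); split; last first.
  move=> h; split; last first.
    by move=> [z0 [z1 [z2 [z3 ->]]]]; apply: order_comb4 => //; exact: Oe'.
  rewrite OE => -[y ->].
  pose c (i : 'I_4) : int := \sum_j y j * invmx R j i.
  exists (s * c ord0), (c (inord 1)), (c (inord 2)), (c (inord 3)).
  have -> : \sum_(i < 4) e`_i *~ y i = \sum_i e' i *~ c i.
    under eq_bigr do rewrite eE mulrz_suml.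
    rewrite exchange_big /=; apply: eq_bigr => i _.
    by rewrite /c mulrz_sumr; apply: eq_bigr => j _; rewrite -mulrzA mulrC.
  by rewrite sum4 e'0 /comb4 -!scaler_int scalerA rmorphM /= [_ * s%:~R]mulrC.
have full h : exists x0 x1 x2 x3 : rat, h = comb4 (f 1%N) (f 2%N) (f 3%N) x0 x1 x2 x3.
  have /coord_span -> : h \in <<e>>%VS.
    have : basis_of fullv e by rewrite basisEfree fe subvf size_tuple dimvf.
    by move=> /span_basis ->; rewrite memvf.
  pose c (i : 'I_4) : rat := \sum_j coord e j h * (invmx R j i)%:~R.
  exists (s%:~R * c ord0), (c (inord 1)), (c (inord 2)), (c (inord 3)).
  transitivity (\sum_i c i *: e' i).
    under eq_bigr => j _ do rewrite eE scaler_sumr.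
    rewrite exchange_big /=; apply: eq_bigr => i _.
    by rewrite /c scaler_suml; apply: eq_bigr => j _; rewrite -scaler_int scalerA.
  by rewrite sum4 e'0 /comb4 scalerA [_ * s%:~R]mulrC.
have [x0 [x1 [x2 [x3 hx]]]] := full (Quat a b 0 1 0 0).
have [y0 [y1 [y2 [y3 hy]]]] := full (Quat a b 0 0 1 0).
have [w0 [w1 [w2 [w3 hw]]]] := full (Quat a b 0 0 0 1).
have : trip (Quat a b 0 1 0 0) (Quat a b 0 0 1 0) (Quat a b 0 0 0 1) = 1.
  by rewrite /trip /=; ring.
rewrite hx hy hw trip_comb4 => h; apply/eqP => t0.
by move: h; rewrite t0 mulr0 => /eqP; rewrite eq_sym oner_eq0.
Qed.

End QuadBasis.

Section GoodBasis.
Variables (a b : rat).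
Hypotheses (a0 : a < 0) (b0 : b < 0).
Local Notation B := (quat a b).
Implicit Types (x y z h i j k : B) (O : set B).

(* The multiplication table of the even Clifford algebra of the ternary form
   al X^2 + be Y^2 + ga Z^2 + u Y Z + v X Z + w X Y. *)
Record qtable i j k (al be ga u v w : rat) : Prop := QTable {
  qt_trip : trip i j k != 0;
  qt_ti : qtr i = u; qt_tj : qtr j = v; qt_tk : qtr k = w;
  qt_ni : qnr i = be * ga; qt_nj : qnr j = al * ga; qt_nk : qnr k = al * be;
  qt_jk : j * k = al *: (u%:A - i);
  qt_ki : k * i = be *: (v%:A - j);
  qt_ij : i * j = ga *: (w%:A - k) }.

(** Half the determinant of the Hessian of the ternary form; for integral coefficients, up to sign,
    the reduced discriminant of the order spanned by 1, i, j, k. *)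
Definition half_disc (al be ga u v w : rat) : rat :=
  4 * al * be * ga + u * v * w - al * u ^+ 2 - be * v ^+ 2 - ga * w ^+ 2.

Lemma trip_rot x y z : trip y z x = trip x y z.
Proof. by rewrite /trip; ring. Qed.

Lemma qtable_rot i j k al be ga u v w :
  qtable i j k al be ga u v w -> qtable j k i be ga al v w u.
Proof.
case=> t0 ti tj tk ni nj nk jk ki ij; split; first by rewrite trip_rot.
- exact: tj.
- exact: tk.
- exact: ti.
- by rewrite nj mulrC.
- by rewrite nk mulrC.
- exact: ni.
- exact: ki.
- exact: ij.
- exact: jk.
Qed.

(** The product j k times the conjugate of k is nr(k) j. Expanding it with the two given products
    and comparing coordinates yields both relations. *)
Let qtable_step i j k (r al s be : rat) : trip i j k != 0 ->
  j * k = r%:A - al *: i -> k * i = s%:A - be *: j ->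
  r = al * qtr i /\ qnr k = al * be.
Proof.
move=> t0 jk ki.
have ik : i * k = qtr i *: k + qtr k *: i + (qtr (i * k) - qtr i * qtr k)%:A - k * i.
  by apply: quat_eq; rewrite /qtr /=; ring.
have : qnr k *: j = j * k * (qtr k *: 1 - k).
  by apply: quat_eq; rewrite /qtr /qnr /=; ring.
rewrite jk; have -> : (r%:A - al *: i) * (qtr k *: 1 - k) =
    (r * qtr k)%:A - r *: k - (al * qtr k) *: i + al *: (i * k).
  by apply: quat_eq => /=; ring.
rewrite ik ki; set T := qtr (i * k) - _.
have -> : qnr k *: j = comb4 i j k 0 0 (qnr k) 0 by apply: quat_eq; rewrite /comb4 /=; ring.
rewrite (_ : _ + al *: _ = comb4 i j k (r * qtr k + al * T - al * s) 0 (al * be) (al * qtr i - r)); last first.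
  by apply: quat_eq; rewrite /comb4 /=; ring.
move=> /(comb4_inj t0)[_ _ -> /esym/eqP].
by rewrite subr_eq0 => /eqP.
Qed.

Lemma qtable_intro i j k (r al s be m ga : rat) : trip i j k != 0 ->
  j * k = r%:A - al *: i -> k * i = s%:A - be *: j -> i * j = m%:A - ga *: k ->
  qtable i j k al be ga (qtr i) (qtr j) (qtr k).
Proof.
move=> t0 jk ki ij.
have t1 : trip j k i != 0 by rewrite trip_rot.
have t2 : trip k i j != 0 by rewrite trip_rot trip_rot.
have [r1 n3] := qtable_step t0 jk ki.
have [s1 n1] := qtable_step t1 ki ij.
have [m1 n2] := qtable_step t2 ij jk.
split; [exact: t0|by []|by []|by []|exact: n1|by rewrite n2 mulrC|exact: n3|..].
- by rewrite jk r1; apply: quat_eq => /=; ring.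
- by rewrite ki s1; apply: quat_eq => /=; ring.
- by rewrite ij m1; apply: quat_eq => /=; ring.
Qed.

Section Table.
Variables (i j k : B) (al be ga u v w : rat).
Hypothesis T : qtable i j k al be ga u v w.

Lemma qtable_mul (x0 x1 x2 x3 y0 y1 y2 y3 : rat) :
  comb4 i j k x0 x1 x2 x3 * comb4 i j k y0 y1 y2 y3 = comb4 i j k
   (x0 * y0 - be * ga * x1 * y1 - al * ga * x2 * y2 - al * be * x3 * y3
     + al * u * x2 * y3 - v * w * x3 * y2 + be * v * x3 * y1 - u * w * x1 * y3
     + ga * w * x1 * y2 - u * v * x2 * y1)
   (x0 * y1 + x1 * y0 + u * x1 * y1 - al * x2 * y3 + al * x3 * y2 + w * x1 * y3 + v * x2 * y1)
   (x0 * y2 + x2 * y0 + v * x2 * y2 - be * x3 * y1 + be * x1 * y3 + w * x3 * y2 + u * x2 * y1)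
   (x0 * y3 + x3 * y0 + w * x3 * y3 - ga * x1 * y2 + ga * x2 * y1 + v * x3 * y2 + u * x1 * y3).
Proof.
have [_ ti tj tk ni nj nk jk ki ij] := T.
have sq x : x * x = qtr x *: x - (qnr x)%:A.
  by apply: quat_eq; rewrite /qtr /qnr /=; ring.
have sw x y : y * x = qtr x *: y + qtr y *: x - (qtr x * qtr y)%:A + qconj (x * y).
  by apply: quat_eq; rewrite /qtr /=; ring.
have cj (c : rat) x : qconj (c *: ((qtr x)%:A - x)) = c *: x.
  by apply: quat_eq; rewrite /qtr /=; ring.
have kj : k * j = v *: k + w *: j - (v * w)%:A + al *: i.
  by rewrite sw jk -ti cj tj tk addrAC.
have ik : i * k = w *: i + u *: k - (w * u)%:A + be *: j.
  by rewrite sw ki -tj cj ti tk addrAC.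
have ji : j * i = u *: j + v *: i - (u * v)%:A + ga *: k.
  by rewrite sw ij -tk cj ti tj addrAC.
have ii : i * i = u *: i - (be * ga)%:A by rewrite sq ti ni.
have jj : j * j = v *: j - (al * ga)%:A by rewrite sq tj nj.
have kk : k * k = w *: k - (al * be)%:A by rewrite sq tk nk.
have -> : comb4 i j k x0 x1 x2 x3 * comb4 i j k y0 y1 y2 y3 =
  comb4 i j k (x0 * y0) (x0 * y1 + x1 * y0) (x0 * y2 + x2 * y0) (x0 * y3 + x3 * y0)
  + ((x1 * y1) *: (i * i) + (x1 * y2) *: (i * j) + (x1 * y3) *: (i * k))
  + ((x2 * y1) *: (j * i) + (x2 * y2) *: (j * j) + (x2 * y3) *: (j * k))
  + ((x3 * y1) *: (k * i) + (x3 * y2) *: (k * j) + (x3 * y3) *: (k * k)).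
  by apply: quat_eq; rewrite /comb4 /=; ring.
rewrite kj ik ji ii jj kk jk ki ij.
by apply: quat_eq; rewrite /comb4 /=; ring.
Qed.

Lemma qtable_dot : [/\ 2 * dot i j = u * v - ga * w, 2 * dot i k = u * w - be * v
  & 2 * dot j k = v * w - al * u].
Proof.
have [_ ti tj tk ni nj nk jk ki ij] := T.
have H x y : 2 * dot x y = qtr x * qtr y - qtr (x * y) by rewrite /dot /qtr /=; ring.
have cj (c : rat) x : qtr (c *: ((qtr x)%:A - x)) = c * qtr x.
  by rewrite /qtr /=; ring.
have ik : qtr (i * k) = qtr (k * i) by rewrite /qtr /=; ring.
have e1 : qtr (i * j) = ga * w by rewrite ij -tk cj.
have e2 : qtr (i * k) = be * v by rewrite ik ki -tj cj.
have e3 : qtr (j * k) = al * u by rewrite jk -ti cj.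
by rewrite !H e1 e2 e3 ti tj tk.
Qed.

Lemma qtable_nr (x0 x1 x2 x3 : rat) : qnr (comb4 i j k x0 x1 x2 x3) =
  x0 ^+ 2 + x0 * (u * x1 + v * x2 + w * x3)
  + be * ga * x1 ^+ 2 + al * ga * x2 ^+ 2 + al * be * x3 ^+ 2
  + (u * v - ga * w) * x1 * x2 + (u * w - be * v) * x1 * x3 + (v * w - al * u) * x2 * x3.
Proof.
have [_ ti tj tk ni nj nk _ _ _] := T; have [dij dik djk] := qtable_dot.
have -> : qnr (comb4 i j k x0 x1 x2 x3) =
  x0 ^+ 2 + x0 * (qtr i * x1 + qtr j * x2 + qtr k * x3)
  + qnr i * x1 ^+ 2 + qnr j * x2 ^+ 2 + qnr k * x3 ^+ 2
  + (2 * dot i j) * x1 * x2 + (2 * dot i k) * x1 * x3 + (2 * dot j k) * x2 * x3.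
  by rewrite /qnr /qtr /dot /comb4 /=; ring.
by rewrite ti tj tk ni nj nk dij dik djk.
Qed.

(* The pure parts 2 i - u, 2 j - v, 2 k - w have the adjugate of the Hessian of
   the ternary form as Gram matrix. *)
Definition purify x : B := 2 *: x - (qtr x)%:A.

Lemma purify_re x : qre (purify x) = 0.
Proof. by rewrite /purify /qtr /=; ring. Qed.

Lemma qtable_gram : let v1 := purify i in let v2 := purify j in let v3 := purify k in
  [/\ dot v1 v1 = 4 * be * ga - u ^+ 2, dot v2 v2 = 4 * al * ga - v ^+ 2
    & dot v3 v3 = 4 * al * be - w ^+ 2] /\
  [/\ dot v1 v2 = u * v - 2 * ga * w, dot v1 v3 = u * w - 2 * be * v
    & dot v2 v3 = v * w - 2 * al * u].
Proof.
have [_ ti tj tk ni nj nk _ _ _] := T; have [dij dik djk] := qtable_dot.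
have P x y : dot (purify x) (purify y) = 2 * (2 * dot x y) - qtr x * qtr y.
  by rewrite /dot /purify /qtr /=; ring.
by split; split; rewrite P -?qnr_dot ?dij ?dik ?djk ?ni ?nj ?nk ?ti ?tj ?tk; ring.
Qed.

(** The determinant of an adjugate of order three is the square of the determinant, here (2
    [half_disc]) ^ 2. *)
Lemma qtable_gram3 : gram3 (purify i) (purify j) (purify k) = 4 * half_disc al be ga u v w ^+ 2.
Proof.
have [[g11 g22 g33] [g12 g13 g23]] := qtable_gram.
by rewrite /gram3 g11 g22 g33 g12 g13 g23 /half_disc; ring.
Qed.

Lemma trip_purify x y z : trip (purify x) (purify y) (purify z) = 8 * trip x y z.
Proof. by rewrite /trip /purify /=; ring. Qed.

Lemma half_disc_neq0 : half_disc al be ga u v w != 0.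
Proof.
apply: contraTneq (qt_trip T) => N0; have := qtable_gram3.
rewrite N0 expr0n mulr0 gram3_trip ?purify_re// trip_purify => /eqP.
rewrite sqrf_eq0 mulf_eq0 mulf_eq0 (lt_eqF a0) (lt_eqF b0) /= mulf_eq0 pnatr_eq0 /=.
by move=> /eqP ->; rewrite eqxx.
Qed.

End Table.

Lemma freeP4 i j k : trip i j k != 0 -> free [tuple 1; i; j; k].
Proof.
move=> t0; apply/freeP => c.
rewrite !big_ord_recl big_ord0 addr0 !addrA /= => h.
have [h0 h1 h2 h3] : [/\ c ord0 = 0, c (lift ord0 ord0) = 0, c (lift ord0 (lift ord0 ord0)) = 0
    & c (lift ord0 (lift ord0 (lift ord0 ord0))) = 0].
  apply: (comb4_inj t0); rewrite -[RHS](_ : 0 = _) //.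
  by apply: quat_eq; rewrite /comb4 /=; ring.
case=> [[|[|[|[|//]]]] lt];
  [rewrite -h0|rewrite -h1|rewrite -h2|rewrite -h3]; congr c; exact: val_inj.
Qed.

Lemma qtable_order i j k (al be ga u v w : int) :
  qtable i j k al%:~R be%:~R ga%:~R u%:~R v%:~R w%:~R ->
  is_order [set h | exists z0 z1 z2 z3 : int, h = comb4 i j k z0%:~R z1%:~R z2%:~R z3%:~R].
Proof.
move=> T; split.
- exists [tuple 1; i; j; k]; split; first exact: freeP4 (qt_trip T).
  apply/seteqP; split=> h /=.
    move=> [z0 [z1 [z2 [z3 ->]]]]; exists (fun n : 'I_4 => [:: z0; z1; z2; z3]`_n).
    by rewrite !big_ord_recl big_ord0 addr0 /= -!scaler_int !addrA.
  move=> [z ->]; exists (z ord0), (z (lift ord0 ord0)), (z (lift ord0 (lift ord0 ord0))),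
    (z (lift ord0 (lift ord0 (lift ord0 ord0)))).
  by rewrite !big_ord_recl big_ord0 addr0 /= -!scaler_int !addrA.
- exists 1, 0, 0, 0; by apply: quat_eq; rewrite /comb4 /=; ring.
- move=> x y [x0 [x1 [x2 [x3 ->]]]] [y0 [y1 [y2 [y3 ->]]]].
  exists (x0 - y0), (x1 - y1), (x2 - y2), (x3 - y3).
  by rewrite !rmorphB /=; apply: quat_eq; rewrite /comb4 /=; ring.
- move=> x y [x0 [x1 [x2 [x3 ->]]]] [y0 [y1 [y2 [y3 ->]]]].
  rewrite (qtable_mul T).
  exists (x0 * y0 - be * ga * x1 * y1 - al * ga * x2 * y2 - al * be * x3 * y3
     + al * u * x2 * y3 - v * w * x3 * y2 + be * v * x3 * y1 - u * w * x1 * y3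
     + ga * w * x1 * y2 - u * v * x2 * y1),
   (x0 * y1 + x1 * y0 + u * x1 * y1 - al * x2 * y3 + al * x3 * y2 + w * x1 * y3 + v * x2 * y1),
   (x0 * y2 + x2 * y0 + v * x2 * y2 - be * x3 * y1 + be * x1 * y3 + w * x3 * y2 + u * x2 * y1),
   (x0 * y3 + x3 * y0 + w * x3 * y3 - ga * x1 * y2 + ga * x2 * y1 + v * x3 * y2 + u * x1 * y3).
  by rewrite !(rmorphD, rmorphN, rmorphM) /=.
Qed.

Definition good_basis O i j k (al be ga u v w : int) : Prop :=
  qtable i j k al%:~R be%:~R ga%:~R u%:~R v%:~R w%:~R /\
  forall h, O h <-> exists z0 z1 z2 z3 : int, h = comb4 i j k z0%:~R z1%:~R z2%:~R z3%:~R.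

Lemma order_good_basis O : is_order O ->
  exists i j k al be ga u v w, good_basis O i j k al be ga u v w.
Proof.
move=> HO; have [e1 [e2 [e3 [t0 OE]]]] := order_quad_basis HO.
have [O1 O2 O3] : [/\ O e1, O e2 & O e3].
  split; apply/OE; [exists 0, 1, 0, 0|exists 0, 0, 1, 0|exists 0, 0, 0, 1];
  by apply: quat_eq; rewrite /comb4 /=; ring.
have /OE[c0 [c1 [c2 [c3 jk0]]]] := orderM HO O2 O3.
pose j := e2 - c3%:~R%:A; pose k := e3 - c2%:~R%:A.
have Oj : O j by apply: (orderB HO) => //; exact: order_scalar.
have Ok : O k by apply: (orderB HO) => //; exact: order_scalar.
have /OE[s0 [s1 [s2 [s3 ki0]]]] := orderM HO Ok O1.
pose i := e1 - s3%:~R%:A.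
have Oi : O i by apply: (orderB HO) => //; exact: order_scalar.
have tr0 : trip i j k != 0 by rewrite (_ : trip i j k = trip e1 e2 e3)// /trip /=; ring.
have OE' h : O h <-> exists z0 z1 z2 z3 : int, h = comb4 i j k z0%:~R z1%:~R z2%:~R z3%:~R.
  split; last by move=> [z0 [z1 [z2 [z3 ->]]]]; apply: order_comb4.
  move=> /OE[z0 [z1 [z2 [z3 ->]]]].
  exists (z0 + z1 * s3 + z2 * c3 + z3 * c2), z1, z2, z3.
  rewrite !(rmorphD, rmorphM) /=.
  by apply: quat_eq; rewrite /comb4 /i /j /k /=; ring.
have /OE'[m0 [m1 [m2 [m3 ij]]]] := orderM HO Oi Oj.
have jk : j * k = comb4 i j k (c0 + c2 * c3 + c1 * s3)%:~R c1%:~R 0 0.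
  have -> : j * k = e2 * e3 - c2%:~R *: e2 - c3%:~R *: e3 + (c2%:~R * c3%:~R)%:A.
    by apply: quat_eq; rewrite /j /k /=; ring.
  rewrite jk0 !(rmorphD, rmorphM) /=.
  by apply: quat_eq; rewrite /comb4 /i /j /k /=; ring.
have ki : k * i = comb4 i j k (s0 + s1 * s3 + s2 * c3 + s3 * c2)%:~R s1%:~R s2%:~R 0.
  have -> : k * i = k * e1 - s3%:~R *: k by apply: quat_eq; rewrite /i /=; ring.
  rewrite ki0 !(rmorphD, rmorphM) /=.
  by apply: quat_eq; rewrite /comb4 /i /j /k /=; ring.
(* The translations of e2, e3, e1 have killed three of the six unwanted
   coefficients; the cyclic symmetry of the trace form kills the others. *)
have cyc x y z : qre ((y * z - z * y) * (z * x)) = qre ((z * x - x * z) * (y * z)).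
  by rewrite /=; ring.
have ex1 x (x0 x1 x2 x3 : rat) : x = comb4 i j k x0 x1 x2 x3 ->
    qre ((j * k - k * j) * x) = (- 2) * a * b * trip i j k * x1.
  by move=> ->; rewrite /comb4 /trip /=; ring.
have ex2 x (x0 x1 x2 x3 : rat) : x = comb4 i j k x0 x1 x2 x3 ->
    qre ((k * i - i * k) * x) = (- 2) * a * b * trip i j k * x2.
  by move=> ->; rewrite /comb4 /trip /=; ring.
have ex3 x (x0 x1 x2 x3 : rat) : x = comb4 i j k x0 x1 x2 x3 ->
    qre ((i * j - j * i) * x) = (- 2) * a * b * trip i j k * x3.
  by move=> ->; rewrite /comb4 /trip /=; ring.
have c0' : (- 2) * a * b * trip i j k != 0.
  apply: (mulf_neq0 _ tr0); apply: mulf_neq0; last by rewrite (lt_eqF b0).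
  by apply: mulf_neq0; [rewrite oppr_eq0 pnatr_eq0|rewrite (lt_eqF a0)].
have kill (n : int) : (- 2) * a * b * trip i j k * n%:~R = 0 -> n = 0.
  by move=> /eqP; rewrite mulf_eq0 (negPf c0') intr_eq0 => /eqP.
have s10 : s1 = 0 by apply: kill; rewrite -(ex1 _ _ _ _ _ ki) cyc (ex2 _ _ _ _ _ jk) mulr0.
have m10 : m1 = 0 by apply: kill; rewrite -(ex1 _ _ _ _ _ ij) -cyc (ex3 _ _ _ _ _ jk) mulr0.
have m20 : m2 = 0 by apply: kill; rewrite -(ex2 _ _ _ _ _ ij) cyc (ex3 _ _ _ _ _ ki) mulr0.
have T := @qtable_intro i j k (c0 + c2 * c3 + c1 * s3)%:~R (- c1%:~R)
  (s0 + s1 * s3 + s2 * c3 + s3 * c2)%:~R (- s2%:~R) m0%:~R (- m3%:~R) tr0.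
have /intrP[u hu] := order_qtr_int HO Oi.
have /intrP[v hv] := order_qtr_int HO Oj.
have /intrP[w hw] := order_qtr_int HO Ok.
exists i, j, k, (- c1), (- s2), (- m3), u, v, w; split=> //.
rewrite -hu -hv -hw !rmorphN /=; apply: T.
- by rewrite jk; apply: quat_eq; rewrite /comb4 /=; ring.
- by rewrite ki s10; apply: quat_eq; rewrite /comb4 /=; ring.
- by rewrite ij m10 m20; apply: quat_eq; rewrite /comb4 /=; ring.
Qed.

End GoodBasis.

(** * Integral ternary forms modulo a prime *)

Section ModPrime.
Variable l : nat.
Hypothesis lP : prime l.

Lemma dvdz_Fp (x : int) : (l%:Z %| x)%Z = (x%:~R == 0 :> 'F_l).
Proof.
have H (n : nat) : (l %| n)%N = (n%:R == 0 :> 'F_l).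
  by rewrite -(dvdn_pcharf (pchar_Fp lP)).
by case: x => n; rewrite dvdzE /= H ?NegzE ?rmorphN ?oppr_eq0 -?pmulrn.
Qed.

Lemma Fp_lift (y : 'F_l) : exists n : int, n%:~R = y.
Proof. by exists (y : nat)%:Z; rewrite -pmulrn natr_Zp. Qed.

Lemma Fp_two (y : 'F_l) : 2 = 0 :> 'F_l -> y = 0 \/ y = 1.
Proof.
move=> /eqP; rewrite -[2]/(2%:R) -(dvdn_pcharf (pchar_Fp lP)) dvdn_prime2// => /eqP l2.
by move: y; rewrite l2 => -[[|[|//]] h]; [left|right]; apply/val_inj.
Qed.
End ModPrime.

Definition idisc (al be ga u v w : int) : int :=
  4 * al * be * ga + u * v * w - al * u ^+ 2 - be * v ^+ 2 - ga * w ^+ 2.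

(* [M] is the set of integral ternary forms attached to the good bases of a
   fixed maximal order. *)
Section LocalForm.
Variables (l : nat) (M : int -> int -> int -> int -> int -> int -> Prop).
Hypothesis lP : prime l.
Hypothesis M_rot : forall al be ga u v w, M al be ga u v w -> M be ga al v w u.
Hypothesis M_shear : forall al be ga u v w s t, M al be ga u v w ->
  M al (al * s ^+ 2 - s * w + be) (al * t ^+ 2 - t * v + ga)
    (u - s * v - t * w + 2 * al * s * t) (v - 2 * al * t) (w - 2 * al * s).
(** The two configurations that maximality excludes: a form vanishing modulo l on the plane of the
    last two basis vectors, and a third basis vector orthogonal to the others modulo l whose value
    is divisible by l ^ 2. *)
Hypothesis M_plane : forall al be ga u v w, M al be ga u v w ->
  (l%:Z %| be)%Z -> (l%:Z %| ga)%Z -> (l%:Z %| u)%Z -> False.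
Hypothesis M_radical : forall al be ga u v w, M al be ga u v w ->
  (l%:Z %| u)%Z -> (l%:Z %| v)%Z -> ((l ^ 2)%N%:Z %| ga)%Z -> False.

Local Notation F := 'F_l.
Local Notation "x %:p" := (x%:~R : F) (at level 2, format "x %:p").

Let M_eq al be ga u v w al' be' ga' u' v' w' : M al be ga u v w ->
  al = al' -> be = be' -> ga = ga' -> u = u' -> v = v' -> w = w' -> M al' be' ga' u' v' w'.
Proof. by move=> ? <- <- <- <- <- <-. Qed.

Lemma M_shear3 al be ga u v w r1 r2 : M al be ga u v w ->
  M al be (al * r1 ^+ 2 + be * r2 ^+ 2 + ga + u * r2 + v * r1 + w * r1 * r2)
    (u + w * r1 + 2 * be * r2) (v + 2 * al * r1 + w * r2) w.
Proof.
move=> h; have h1 := M_rot (M_shear 0 (- r1) h).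
have h2 := M_rot (M_rot (M_shear (- r2) 0 h1)).
apply: M_eq h2 _ _ _ _ _ _; ring.
Qed.

Lemma plane_F al be ga u v w : M al be ga u v w -> be%:p = 0 -> ga%:p = 0 -> u%:p = 0 -> False.
Proof. by move=> h *; apply: (M_plane h); rewrite dvdz_Fp//; apply/eqP. Qed.

Lemma shear_plane al be ga u v w (s t : F) : M al be ga u v w ->
  al%:p * s ^+ 2 - s * w%:p + be%:p = 0 -> al%:p * t ^+ 2 - t * v%:p + ga%:p = 0 ->
  u%:p - s * v%:p - t * w%:p + 2 * al%:p * s * t = 0 -> False.
Proof.
move=> h; have [s' <-] := Fp_lift s; have [t' <-] := Fp_lift t => h1 h2 h3.
apply: (plane_F (M_shear s' t' h)).
- by rewrite -h1 !(rmorphD, rmorphN, rmorphM, rmorphXn).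
- by rewrite -h2 !(rmorphD, rmorphN, rmorphM, rmorphXn).
- by rewrite -h3 !(rmorphD, rmorphN, rmorphM, rmorphXn).
Qed.

(* A form of rank at most one mod l vanishes on a plane. *)
Lemma no_rank1_al al be ga u v w : M al be ga u v w -> al%:p != 0 ->
  4 * be%:p * ga%:p = u%:p ^+ 2 -> 4 * al%:p * ga%:p = v%:p ^+ 2 -> 4 * al%:p * be%:p = w%:p ^+ 2 ->
  v%:p * w%:p = 2 * al%:p * u%:p -> False.
Proof.
move=> h a0 e1 e2 e3 e4.
(* When l = 2 the form is a sum of squares, and squaring is the identity of F_2, so it is the square
   of x + be y + ga z; otherwise one completes the square. *)
have [c2|c2] := eqVneq (2 : F) 0.
  have sq0 (x y z : F) : 4 * x * y = z ^+ 2 -> z = 0.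
    have -> : 4 = 2 * 2 :> F by ring.
    by rewrite c2 !mul0r => /esym/eqP; rewrite sqrf_eq0 => /eqP.
  have a1 : al%:p = 1 by have [/eqP|//] := Fp_two lP al%:p c2; rewrite (negPf a0).
  have dbl (x : F) : x + x = 0 by rewrite -mulr2n -mulr_natl c2 mul0r.
  have sqr (x : F) : x ^+ 2 = x.
    by have [->|->] := Fp_two lP x c2; rewrite ?expr0n ?expr1n.
  apply: (shear_plane h (s := be%:p) (t := ga%:p));
  rewrite a1 ?(sq0 _ _ _ e1) ?(sq0 _ _ _ e2) ?(sq0 _ _ _ e3) ?c2;
  by rewrite ?sqr !(mulr0, mul0r, mul1r, subr0, addr0, dbl).
have c4 : 4 != 0 :> F by rewrite (_ : 4 = 2 * 2 :> F) ?mulf_neq0//; ring.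
have eb : be%:p = w%:p ^+ 2 / (4 * al%:p) by rewrite -e3; field; rewrite c4 a0.
have eg : ga%:p = v%:p ^+ 2 / (4 * al%:p) by rewrite -e2; field; rewrite c4 a0.
have eu : u%:p = v%:p * w%:p / (2 * al%:p) by rewrite e4; field; rewrite c2 a0.
have e44 : 4 * al%:p = 2 * (2 * al%:p) by ring.
apply: (shear_plane h (s := w%:p / (2 * al%:p)) (t := v%:p / (2 * al%:p)));
  rewrite ?eb ?eg ?eu ?e44; field; by rewrite c2 a0.
Qed.

Lemma no_rank1 al be ga u v w : M al be ga u v w ->
  4 * be%:p * ga%:p = u%:p ^+ 2 -> 4 * al%:p * ga%:p = v%:p ^+ 2 ->
  4 * al%:p * be%:p = w%:p ^+ 2 -> u%:p * v%:p = 2 * ga%:p * w%:p ->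
  u%:p * w%:p = 2 * be%:p * v%:p -> v%:p * w%:p = 2 * al%:p * u%:p -> False.
Proof.
move=> h e1 e2 e3 e4 e5 e6.
have [za|za] := eqVneq al%:p 0; last by apply: (no_rank1_al h).
have [zb|zb] := eqVneq be%:p 0; last first.
  apply: (no_rank1_al (M_rot h)) => //; last by rewrite mulrC.
  - by rewrite -e2; ring.
  - by rewrite -e3; ring.
have [zg|zg] := eqVneq ga%:p 0; last first.
  apply: (no_rank1_al (M_rot (M_rot h))) => //.
  - by rewrite -e1; ring.
  - by rewrite -e2; ring.
apply: (plane_F h) => //; apply/eqP.
by rewrite -sqrf_eq0 -e1 zb mulr0 mul0r.
Qed.

(** Modulo l the third vector is in the radical and the first two carry an anisotropic binary
    form. *)
Definition local_form al be ga u v w : Prop :=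
  [/\ M al be ga u v w, ga%:p = 0, u%:p = 0 & v%:p = 0] /\
  forall x y : F, al%:p * x ^+ 2 + w%:p * x * y + be%:p * y ^+ 2 = 0 -> x = 0 /\ y = 0.

(** A zero of the binary form and the radical vector would span a plane on which the form vanishes
    modulo l. *)
Lemma radical_local al be ga u v w : M al be ga u v w ->
  ga%:p = 0 -> u%:p = 0 -> v%:p = 0 -> local_form al be ga u v w.
Proof.
move=> h g0 u0 v0; split=> // x y q0.
have [y0|y0] := eqVneq y 0.
  split=> //; apply/eqP; apply: contraT => x0; exfalso.
  apply: (plane_F (M_rot h)) => //; apply/eqP; apply: contraT => a0.
  by move: q0; rewrite y0 expr0n !mulr0 !addr0 => /eqP; rewrite mulf_eq0 sqrf_eq0 (negPf a0) (negPf x0).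
exfalso; apply: (shear_plane h (s := - (x / y)) (t := 0)).
- transitivity ((al%:p * x ^+ 2 + w%:p * x * y + be%:p * y ^+ 2) / y ^+ 2); first by field.
  by rewrite q0 mul0r.
- by rewrite g0 expr0n !mulr0 mul0r subr0 addr0.
- by rewrite u0 v0 !mulr0 mul0r !subr0 addr0.
Qed.

(* [r] spans the radical of the form mod l; after normalising [r3 = 1] it
   becomes the third basis vector. *)
Lemma radical_local3 al be ga u v w (r1 r2 r3 : F) : M al be ga u v w -> r3 != 0 ->
  2 * al%:p * r1 + w%:p * r2 + v%:p * r3 = 0 -> w%:p * r1 + 2 * be%:p * r2 + u%:p * r3 = 0 ->
  al%:p * r1 ^+ 2 + be%:p * r2 ^+ 2 + ga%:p * r3 ^+ 2 + u%:p * r2 * r3 + v%:p * r1 * r3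
    + w%:p * r1 * r2 = 0 ->
  exists al' be' ga' u' v' w', local_form al' be' ga' u' v' w' /\
    idisc al' be' ga' u' v' w' = idisc al be ga u v w.
Proof.
move=> h r30 e1 e2 e3.
have [s hs] := Fp_lift (r1 / r3); have [t ht] := Fp_lift (r2 / r3).
have h' := M_shear3 s t h.
do 6!eexists; split; first apply: (radical_local h').
- rewrite !(rmorphD, rmorphM, rmorphXn) /= hs ht.
  transitivity ((al%:p * r1 ^+ 2 + be%:p * r2 ^+ 2 + ga%:p * r3 ^+ 2 + u%:p * r2 * r3
    + v%:p * r1 * r3 + w%:p * r1 * r2) / r3 ^+ 2); first by field.
  by rewrite e3 mul0r.
- rewrite !(rmorphD, rmorphM, rmorphXn) /= hs ht.
  transitivity ((w%:p * r1 + 2 * be%:p * r2 + u%:p * r3) / r3); first by field.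
  by rewrite e2 mul0r.
- rewrite !(rmorphD, rmorphM, rmorphXn) /= hs ht.
  transitivity ((2 * al%:p * r1 + w%:p * r2 + v%:p * r3) / r3); first by field.
  by rewrite e1 mul0r.
- by rewrite /idisc; ring.
Qed.

Lemma idisc_rot al be ga u v w : idisc be ga al v w u = idisc al be ga u v w.
Proof. by rewrite /idisc; ring. Qed.

Lemma radical_exists al be ga u v w (r1 r2 r3 : F) : M al be ga u v w ->
  (r1 != 0) || (r2 != 0) || (r3 != 0) ->
  2 * al%:p * r1 + w%:p * r2 + v%:p * r3 = 0 -> w%:p * r1 + 2 * be%:p * r2 + u%:p * r3 = 0 ->
  v%:p * r1 + u%:p * r2 + 2 * ga%:p * r3 = 0 ->
  al%:p * r1 ^+ 2 + be%:p * r2 ^+ 2 + ga%:p * r3 ^+ 2 + u%:p * r2 * r3 + v%:p * r1 * r3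
    + w%:p * r1 * r2 = 0 ->
  exists al' be' ga' u' v' w', local_form al' be' ga' u' v' w' /\
    idisc al' be' ga' u' v' w' = idisc al be ga u v w.
Proof.
move=> h /orP[/orP[r0|r0]|r0] e1 e2 e3 q0; last exact: radical_local3 h r0 e1 e2 q0.
- rewrite -idisc_rot; apply: (radical_local3 (M_rot h) r0 (r1 := r2) (r2 := r3)).
  + by rewrite -e2; ring.
  + by rewrite -e3; ring.
  + by rewrite -q0; ring.
- rewrite -idisc_rot -idisc_rot; apply: (radical_local3 (M_rot (M_rot h)) r0 (r1 := r3) (r2 := r1)).
  + by rewrite -e3; ring.
  + by rewrite -e1; ring.
  + by rewrite -q0; ring.
Qed.

(* The columns of the adjugate of the Hessian lie in the radical mod l. *)
Lemma local_form_exists al be ga u v w : M al be ga u v w ->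
  (l%:Z %| idisc al be ga u v w)%Z ->
  exists al' be' ga' u' v' w', local_form al' be' ga' u' v' w' /\
    idisc al' be' ga' u' v' w' = idisc al be ga u v w.
Proof.
move=> h; rewrite dvdz_Fp// => /eqP; rewrite /idisc !(rmorphD, rmorphN, rmorphM, rmorphXn, rmorph_nat) /=.
set A := al%:p; set B := be%:p; set C := ga%:p; set U := u%:p; set V := v%:p; set W := w%:p.
move=> N0.
pose G11 := 4 * B * C - U ^+ 2; pose G22 := 4 * A * C - V ^+ 2; pose G33 := 4 * A * B - W ^+ 2.
pose G12 := U * V - 2 * C * W; pose G13 := U * W - 2 * B * V; pose G23 := V * W - 2 * A * U.
(* Each radical condition on a column of the adjugate is a multiple of the discriminant; [y] is the
   cofactor, 2 or 0 for the linear conditions and a diagonal minor for the value of the form. *)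
have zero x y : x = y * (4 * A * B * C + U * V * W - A * U ^+ 2 - B * V ^+ 2 - C * W ^+ 2) -> x = 0.
  by rewrite N0 mulr0.
have [c1|c1] := boolP ((G11 != 0) || (G12 != 0) || (G13 != 0)).
  apply: (radical_exists h c1).
  - by apply: (zero _ 2); rewrite /G11 /G12 /G13; ring.
  - by apply: (zero _ 0); rewrite /G11 /G12 /G13; ring.
  - by apply: (zero _ 0); rewrite /G11 /G12 /G13; ring.
  - by apply: (zero _ G11); rewrite /G11 /G12 /G13; ring.
have [c2|c2] := boolP ((G12 != 0) || (G22 != 0) || (G23 != 0)).
  apply: (radical_exists h c2).
  - by apply: (zero _ 0); rewrite /G22 /G12 /G23; ring.
  - by apply: (zero _ 2); rewrite /G22 /G12 /G23; ring.
  - by apply: (zero _ 0); rewrite /G22 /G12 /G23; ring.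
  - by apply: (zero _ G22); rewrite /G22 /G12 /G23; ring.
have [c3|c3] := boolP ((G13 != 0) || (G23 != 0) || (G33 != 0)).
  apply: (radical_exists h c3).
  - by apply: (zero _ 0); rewrite /G33 /G13 /G23; ring.
  - by apply: (zero _ 0); rewrite /G33 /G13 /G23; ring.
  - by apply: (zero _ 2); rewrite /G33 /G13 /G23; ring.
  - by apply: (zero _ G33); rewrite /G33 /G13 /G23; ring.
move: c1 c2 c3; rewrite !negb_or !negbK.
move=> /andP[/andP[/eqP z11 /eqP z12] /eqP z13] /andP[/andP[_ /eqP z22] /eqP z23] /andP[_ /eqP z33].
exfalso; apply: (no_rank1 h).
- by apply/eqP; rewrite -subr_eq0; apply/eqP.
- by apply/eqP; rewrite -subr_eq0; apply/eqP.
- by apply/eqP; rewrite -subr_eq0; apply/eqP.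
- by apply/eqP; rewrite -subr_eq0; apply/eqP.
- by apply/eqP; rewrite -subr_eq0; apply/eqP.
- by apply/eqP; rewrite -subr_eq0; apply/eqP.
Qed.

(** Modulo l ^ 2 the discriminant is ga (4 al be - w ^ 2). The second factor is prime to l, since an
    anisotropic binary form over F_l has non-zero discriminant, so l ^ 2 would divide ga, against
    [M_radical]. *)
Lemma local_form_disc al be ga u v w : local_form al be ga u v w ->
  ~~ ((l ^ 2)%N%:Z %| idisc al be ga u v w)%Z.
Proof.
move=> [[h g0 u0 v0] aniso].
have g33 : 4 * al%:p * be%:p - w%:p ^+ 2 != 0.
  apply/eqP => e.
  have [c2|c2] := eqVneq (2 : F) 0.
    have w0 : w%:p = 0.
      have c4 : 4 = 2 * 2 :> F by ring.
      by move: e; rewrite c4 c2 !mul0r sub0r => /eqP; rewrite oppr_eq0 sqrf_eq0 => /eqP.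
    have a1 : al%:p = 1.
      have [a00|//] := Fp_two lP al%:p c2.
      have [] := aniso 1 0; first by rewrite a00 expr0n !mulr0 mul0r !addr0.
      by move=> /eqP; rewrite oner_eq0.
    have b1 : be%:p = 1.
      have [b00|//] := Fp_two lP be%:p c2.
      have [] := aniso 0 1; first by rewrite b00 expr0n !mulr0 !mul0r !addr0.
      by move=> _ /eqP; rewrite oner_eq0.
    have [] := aniso 1 1; first by rewrite a1 b1 w0 expr1n !mulr1 addr0 -[1 + 1]/2.
    by move=> /eqP; rewrite oner_eq0.
  have [] := aniso (- w%:p) (2 * al%:p).
    transitivity (al%:p * (4 * al%:p * be%:p - w%:p ^+ 2)); first by ring.
    by rewrite e mulr0.
  move=> _ /eqP; rewrite mulf_eq0 (negPf c2) /= => /eqP a00.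
  have [] := aniso 1 0; first by rewrite a00 expr0n !mulr0 mul0r !addr0.
  by move=> /eqP; rewrite oner_eq0.
apply/negP => dN.
move: (g0) (u0) (v0) => /eqP + /eqP + /eqP; rewrite -!dvdz_Fp// => /dvdzP[c gE] /dvdzP[u' uE] /dvdzP[v' vE].
have l0 : l%:Z != 0 by have := prime_gt0 lP; lia.
have : ((l ^ 2)%N%:Z %| ga * (4 * al * be - w ^+ 2))%Z.
  have -> : ga * (4 * al * be - w ^+ 2) = idisc al be ga u v w -
     (u' * v' * w - al * u' ^+ 2 - be * v' ^+ 2) * (l ^ 2)%N%:Z.
    by rewrite /idisc uE vE -mulnn PoszM; ring.
  by apply: rpredB => //; apply: dvdz_mull; rewrite dvdzz.
rewrite {1}gE -mulnn PoszM [c * _]mulrC -(mulrA l%:Z) dvdz_mul2l//.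
rewrite dvdz_Fp// rmorphM mulf_eq0 => /orP[c0|]; last first.
  by rewrite !(rmorphD, rmorphN, rmorphM, rmorphXn) /= (negPf g33).
apply: (M_radical h); [by rewrite dvdz_Fp// u0|by rewrite dvdz_Fp// v0|].
by rewrite gE -mulnn PoszM dvdz_mul2r// dvdz_Fp.
Qed.

Definition inorm (al be ga u v w z0 z1 z2 z3 : int) : int :=
  z0 ^+ 2 + z0 * (u * z1 + v * z2 + w * z3)
  + be * ga * z1 ^+ 2 + al * ga * z2 ^+ 2 + al * be * z3 ^+ 2
  + (u * v - ga * w) * z1 * z2 + (u * w - be * v) * z1 * z3 + (v * w - al * u) * z2 * z3.

(** Modulo l, al times the norm is the anisotropic binary form at (z0, al z3), so l divides z0 and
    z3. Then modulo l ^ 2 the norm is ga times the same form at (z2, - z1), and l ^ 2 does not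
    divide ga. *)
Lemma local_form_norm al be ga u v w z0 z1 z2 z3 : local_form al be ga u v w ->
  ((l ^ 2)%N%:Z %| inorm al be ga u v w z0 z1 z2 z3)%Z ->
  [/\ (l%:Z %| z0)%Z, (l%:Z %| z1)%Z, (l%:Z %| z2)%Z & (l%:Z %| z3)%Z].
Proof.
move=> [[h g0 u0 v0] aniso] dn.
have lz : l%:Z != 0 by have := prime_gt0 lP; lia.
have al0 : al%:p != 0.
  apply/eqP => a00; have [] := aniso 1 0; first by rewrite a00 expr0n !mulr0 mul0r !addr0.
  by move=> /eqP; rewrite oner_eq0.
have : (l%:Z %| inorm al be ga u v w z0 z1 z2 z3)%Z.
  by apply: dvdz_trans dn; rewrite dvdzE /= -mulnn dvdn_mulr.
rewrite dvdz_Fp// /inorm !(rmorphD, rmorphN, rmorphM, rmorphXn) /= g0 u0 v0.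
rewrite !(mul0r, mulr0, add0r, addr0, oppr0, subr0) => /eqP e.
have [zz0 zz3] : z0%:p = 0 /\ z3%:p = 0.
  have [] := aniso z0%:p (al%:p * z3%:p).
    transitivity (al%:p * (z0%:p ^+ 2 + z0%:p * (w%:p * z3%:p) + al%:p * be%:p * z3%:p ^+ 2)).
      by ring.
    by rewrite e mulr0.
  by move=> -> /eqP; rewrite mulf_eq0 (negPf al0) /= => /eqP.
move: (g0) (u0) (v0) (zz0) (zz3) => /eqP + /eqP + /eqP + /eqP + /eqP; rewrite -!dvdz_Fp//.
move=> /dvdzP[c gE] /dvdzP[u' uE] /dvdzP[v' vE] d0 d3.
move: (d0) (d3) => /dvdzP[z0' z0E] /dvdzP[z3' z3E].
have : ((l ^ 2)%N%:Z %| ga * (be * z1 ^+ 2 + al * z2 ^+ 2 - w * z1 * z2))%Z.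
  have -> : ga * (be * z1 ^+ 2 + al * z2 ^+ 2 - w * z1 * z2) = inorm al be ga u v w z0 z1 z2 z3 -
     (z0' ^+ 2 + z0' * (u' * z1 + v' * z2 + w * z3') + al * be * z3' ^+ 2 + u' * v' * z1 * z2
       + (u' * w - be * v') * z1 * z3' + (v' * w - al * u') * z2 * z3') * (l ^ 2)%N%:Z.
    by rewrite /inorm uE vE z0E z3E -mulnn PoszM; ring.
  by apply: rpredB => //; apply: dvdz_mull; rewrite dvdzz.
rewrite {1}gE -mulnn PoszM [c * _]mulrC -(mulrA l%:Z) dvdz_mul2l//.
rewrite [X in is_true X -> _]dvdz_Fp// rmorphM mulf_eq0 => /orP[c0|/eqP].
  exfalso; apply: (M_radical h); [by rewrite dvdz_Fp// u0|by rewrite dvdz_Fp// v0|].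
  by rewrite gE -mulnn PoszM dvdz_mul2r// dvdz_Fp.
rewrite !(rmorphD, rmorphN, rmorphM, rmorphXn) /= => q0.
have [] := aniso z2%:p (- z1%:p); first by rewrite -q0; ring.
move=> /eqP zz2 /eqP; rewrite oppr_eq0 => zz1.
by rewrite !(dvdz_Fp lP z1, dvdz_Fp lP z2).
Qed.
End LocalForm.

(** * Maximal orders *)

Section MaximalOrder.
Variables (a b : rat).
Hypotheses (a0 : a < 0) (b0 : b < 0).
Local Notation B := (quat a b).
Implicit Types (x y z h i j k : B) (O : set B).

Definition form_of O (al be ga u v w : int) : Prop :=
  exists i j k, good_basis O i j k al be ga u v w.

Lemma form_of_rot O al be ga u v w : form_of O al be ga u v w -> form_of O be ga al v w u.
Proof.
move=> [i [j [k [T OE]]]]; exists j, k, i; split; first exact: qtable_rot.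
have E (z0 z1 z2 z3 : rat) : comb4 j k i z0 z1 z2 z3 = comb4 i j k z0 z3 z1 z2.
  by rewrite /comb4 -!addrA; congr (_ + _); rewrite addrA addrC.
move=> h; rewrite OE; split=> -[z0 [z1 [z2 [z3 ->]]]].
  by exists z0, z2, z3, z1; rewrite E.
by exists z0, z3, z1, z2; rewrite E.
Qed.

(** The scalar parts of the new vectors are chosen to restore the normalised shape of the
    products. *)
Lemma qtable_shear i j k (al be ga u v w s t : rat) : qtable i j k al be ga u v w ->
  qtable (comb4 i j k (s * t * al - s * v - t * w) 1 s t)
    (comb4 i j k (- t * al) 0 1 0) (comb4 i j k (- s * al) 0 0 1)
    al (al * s ^+ 2 - s * w + be) (al * t ^+ 2 - t * v + ga)
    (u - s * v - t * w + 2 * al * s * t) (v - 2 * al * t) (w - 2 * al * s).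
Proof.
move=> T; set i' := comb4 _ _ _ _ 1 _ _; set j' := comb4 _ _ _ _ _ 1 _; set k' := comb4 _ _ _ _ _ _ 1.
have tr4 (x0 x1 x2 x3 : rat) : qtr (comb4 i j k x0 x1 x2 x3) = 2 * x0 + u * x1 + v * x2 + w * x3.
  by rewrite -(qt_ti T) -(qt_tj T) -(qt_tk T) /qtr /comb4 /=; ring.
have <- : qtr i' = u - s * v - t * w + 2 * al * s * t by rewrite tr4; ring.
have <- : qtr j' = v - 2 * al * t by rewrite tr4; ring.
have <- : qtr k' = w - 2 * al * s by rewrite tr4; ring.
have t0 : trip i' j' k' != 0.
  rewrite trip_comb4 (_ : _ * trip i j k = trip i j k); first exact: qt_trip T.
  by ring.
apply: (@qtable_intro _ _ i' j' k' (al * (u - s * v - t * w + 2 * al * s * t)) al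
  ((al * s ^+ 2 - s * w + be) * (v - 2 * al * t)) (al * s ^+ 2 - s * w + be)
  ((al * t ^+ 2 - t * v + ga) * (w - 2 * al * s)) (al * t ^+ 2 - t * v + ga)) => //.
- by rewrite (qtable_mul T); apply: quat_eq; rewrite /i' /comb4 /=; ring.
- by rewrite (qtable_mul T); apply: quat_eq; rewrite /j' /comb4 /=; ring.
- by rewrite (qtable_mul T); apply: quat_eq; rewrite /k' /comb4 /=; ring.
Qed.

Lemma form_of_shear O al be ga u v w s t : form_of O al be ga u v w ->
  form_of O al (al * s ^+ 2 - s * w + be) (al * t ^+ 2 - t * v + ga)
    (u - s * v - t * w + 2 * al * s * t) (v - 2 * al * t) (w - 2 * al * s).
Proof.
move=> [i [j [k [T OE]]]].
have := qtable_shear s%:~R t%:~R T.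
set i' := comb4 _ _ _ _ 1 _ _; set j' := comb4 _ _ _ _ _ 1 _; set k' := comb4 _ _ _ _ _ _ 1.
move=> T'; exists i', j', k'; split.
  by rewrite !(rmorphD, rmorphN, rmorphM, rmorphXn, rmorph_nat) /=.
move=> h; rewrite OE; split=> -[z0 [z1 [z2 [z3 ->]]]].
  exists (z0 - z1 * (s * t * al - s * v - t * w) + (z2 - z1 * s) * (t * al) + (z3 - z1 * t) * (s * al)),
    z1, (z2 - z1 * s), (z3 - z1 * t).
  rewrite !(rmorphD, rmorphN, rmorphM) /=.
  by apply: quat_eq; rewrite /i' /j' /k' /comb4 /=; ring.
exists (z0 + z1 * (s * t * al - s * v - t * w) - z2 * (t * al) - z3 * (s * al)),
    z1, (z2 + z1 * s), (z3 + z1 * t).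
rewrite !(rmorphD, rmorphN, rmorphM) /=.
by apply: quat_eq; rewrite /i' /j' /k' /comb4 /=; ring.
Qed.

Lemma maximal_overorder O i j k al be ga u v w i' j' k' al' be' ga' u' v' w' (c1 c2 c3 : int) :
  maximal_order O -> good_basis O i j k al be ga u v w ->
  qtable i' j' k' (al'%:~R) be'%:~R ga'%:~R u'%:~R v'%:~R w'%:~R ->
  i = c1%:~R *: i' -> j = c2%:~R *: j' -> k = c3%:~R *: k' -> O i'.
Proof.
move=> [HO maxO] [T OE] T' ei ej ek.
pose O' := [set h | exists z0 z1 z2 z3 : int, h = comb4 i' j' k' z0%:~R z1%:~R z2%:~R z3%:~R].
have OO' : O `<=` O'.
  move=> h /OE[z0 [z1 [z2 [z3 ->]]]]; exists z0, (z1 * c1), (z2 * c2), (z3 * c3).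
  by rewrite /comb4 ei ej ek !scalerA !rmorphM.
have -> : O = O'.
  apply: contrapT => ne; apply: maxO; exists O'; first exact: qtable_order T'.
  by split=> // O'O; apply: ne; apply/seteqP.
by exists 0, 1, 0, 0; apply: quat_eq; rewrite /comb4 /=; ring.
Qed.

Lemma good_basis_indivisible O i j k al be ga u v w (l : nat) :
  good_basis O i j k al be ga u v w -> prime l -> ~ O (l%:R^-1 *: i).
Proof.
move=> [T OE] lP /OE[z0 [z1 [z2 [z3 E]]]].
have : comb4 i j k 0 l%:R^-1 0 0 = comb4 i j k z0%:~R z1%:~R z2%:~R z3%:~R.
  by rewrite -E; apply: quat_eq; rewrite /comb4 /=; ring.
move=> /(comb4_inj (qt_trip T))[_ e _ _].
have l0 : l%:R != 0 :> rat by rewrite pnatr_eq0 -lt0n prime_gt0.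
have : (z1 * l%:Z)%:~R = 1%:~R :> rat by rewrite rmorphM /= -e -pmulrn mulVf.
move=> /intr_inj/(congr1 absz); rewrite abszM /= => /eqP; rewrite muln_eq1 => /andP[_ /eqP l1].
by move: lP; rewrite l1.
Qed.

(* Otherwise 1, i / l, j, k span a larger order. *)
Lemma maximal_plane O (l : nat) al be ga u v w : maximal_order O -> prime l ->
  form_of O al be ga u v w ->
  (l%:Z %| be)%Z -> (l%:Z %| ga)%Z -> (l%:Z %| u)%Z -> False.
Proof.
move=> mO lP [i [j [k G]]] /dvdzP[be' eb] /dvdzP[ga' eg] /dvdzP[u' eu].
have l0 : l%:R != 0 :> rat by rewrite pnatr_eq0 -lt0n prime_gt0.
apply: (good_basis_indivisible G lP).
apply: (@maximal_overorder O i j k al be ga u v w _ j k (l%:Z * al) be' ga' u' v w l%:Z 1 1) => //.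
- case: G => -[t0 ti tj tk ni nj nk jk ki ij] _.
  have eb' : be%:~R = be'%:~R * l%:R :> rat by rewrite eb rmorphM.
  have eg' : ga%:~R = ga'%:~R * l%:R :> rat by rewrite eg rmorphM.
  have eu' : u%:~R = u'%:~R * l%:R :> rat by rewrite eu rmorphM.
  have tZ c x : qtr (c *: x) = c * qtr x by rewrite /qtr /=; ring.
  have nZ c x : qnr (c *: x) = c ^+ 2 * qnr x by rewrite /qnr /=; ring.
  rewrite rmorphM /= -pmulrn; split.
  + have -> : trip (l%:R^-1 *: i) j k = l%:R^-1 * trip i j k by rewrite /trip /=; ring.
    by rewrite mulf_neq0// invr_eq0.
  + by rewrite tZ ti eu'; field.
  + exact: tj.
  + exact: tk.
  + by rewrite nZ ni eb' eg'; field.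
  + by rewrite nj eg'; ring.
  + by rewrite nk eb'; ring.
  + by rewrite jk eu'; apply: quat_eq => /=; field.
  + by rewrite -scalerAr ki eb' scalerA; congr (_ *: _); field.
  + by rewrite -scalerAl ij eg' scalerA; congr (_ *: _); field.
- by rewrite -pmulrn scalerA divff// scale1r.
- by rewrite scale1r.
- by rewrite scale1r.
Qed.

(* Otherwise 1, i / l, j / l, k span a larger order. *)
Lemma maximal_radical O (l : nat) al be ga u v w : maximal_order O -> prime l ->
  form_of O al be ga u v w ->
  (l%:Z %| u)%Z -> (l%:Z %| v)%Z -> ((l ^ 2)%N%:Z %| ga)%Z -> False.
Proof.
move=> mO lP [i [j [k G]]] /dvdzP[u' eu] /dvdzP[v' ev] /dvdzP[ga' eg].
have l0 : l%:R != 0 :> rat by rewrite pnatr_eq0 -lt0n prime_gt0.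
apply: (good_basis_indivisible G lP).
apply: (@maximal_overorder O i j k al be ga u v w _ (l%:R^-1 *: j) k al be ga' u' v' w l%:Z l%:Z 1) => //.
- case: G => -[t0 ti tj tk ni nj nk jk ki ij] _.
  have eg' : ga%:~R = ga'%:~R * l%:R ^+ 2 :> rat by rewrite eg rmorphM /= -pmulrn natrX.
  have eu' : u%:~R = u'%:~R * l%:R :> rat by rewrite eu rmorphM.
  have ev' : v%:~R = v'%:~R * l%:R :> rat by rewrite ev rmorphM.
  have tZ c x : qtr (c *: x) = c * qtr x by rewrite /qtr /=; ring.
  have nZ c x : qnr (c *: x) = c ^+ 2 * qnr x by rewrite /qnr /=; ring.
  split.
  + have -> : trip (l%:R^-1 *: i) (l%:R^-1 *: j) k = l%:R^-1 ^+ 2 * trip i j k.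
      by rewrite /trip /=; ring.
    by rewrite mulf_neq0// expf_neq0// invr_eq0.
  + by rewrite tZ ti eu'; field.
  + by rewrite tZ tj ev'; field.
  + exact: tk.
  + by rewrite nZ ni eg'; field.
  + by rewrite nZ nj eg'; field.
  + exact: nk.
  + by rewrite -scalerAl jk eu'; apply: quat_eq => /=; field.
  + by rewrite -scalerAr ki ev'; apply: quat_eq => /=; field.
  + by rewrite -scalerAl -scalerAr ij eg' !scalerA; congr (_ *: _); field.
- by rewrite -pmulrn scalerA divff// scale1r.
- by rewrite -pmulrn scalerA divff// scale1r.
- by rewrite scale1r.
Qed.

End MaximalOrder.

(** * Ramification at a prime dividing the discriminant *)

Section Padic.
Variable l : nat.

Fact const_cauchy (q : rat) : (fun=> q) \in cauchy_pred l.
Proof. by apply/asboolP => e e0; exists 0%N => m n _ _; rewrite subrr padic_norm0. Qed.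

Definition cconst (q : rat) : cauchy_seq l := CauchySeq (const_cauchy q).
Definition pconst (q : rat) : padic l := \pi_(padic l)%qT (cconst q).

Lemma pconstM x y : pconst (x * y) = pconst x * pconst y.
Proof. by rewrite /pconst -rmorphM; congr (\pi_ _ _)%qT; exact: val_inj. Qed.
Lemma pconstB x y : pconst (x - y) = pconst x - pconst y.
Proof. by rewrite /pconst -rmorphB; congr (\pi_ _ _)%qT; exact: val_inj. Qed.
Lemma pconst1 : pconst 1 = 1.
Proof. by rewrite /pconst -[RHS](rmorph1 (\pi_(padic l)%qT)); congr (\pi_ _ _)%qT; exact: val_inj. Qed.

HB.instance Definition _ := GRing.isZmodMorphism.Build rat (padic l) pconst pconstB.
HB.instance Definition _ := GRing.isMonoidMorphism.Build rat (padic l) pconst (pconst1, pconstM).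

Lemma ratr_padic q : ratr q = pconst q :> padic l.
Proof.
rewrite /ratr -{3}(divq_num_den q) fmorph_div /=.
by rewrite !rmorph_int.
Qed.

Lemma pi_eq0 (c : cauchy_seq l) : \pi_(padic l)%qT c = 0 <-> is_null l c.
Proof.
rewrite -(rmorph0 (\pi_(padic l)%qT)); split=> [/eqP|h].
  by rewrite -Quotient.idealrBE subr0 => /asboolP.
by apply/eqP; rewrite -Quotient.idealrBE subr0; apply/asboolP.
Qed.
End Padic.

Section PadicInteger.
Variable l : nat.
Hypothesis lP : prime l.
Local Notation N := (padic_norm l).

Let l0 : (l%:R : rat) != 0.
Proof. by rewrite pnatr_eq0 -lt0n prime_gt0. Qed.

Let lgt0 : 0 < (l%:R : rat).
Proof. by rewrite ltr0n prime_gt0. Qed.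

Lemma padic_norm_int (m : int) : m != 0 -> N m%:~R = l%:R ^- logn l `|m|.
Proof.
move=> m0; have := padic_norm_frac l m0 (oner_neq0 int).
by rewrite divr1 logn1 sub0r => ->; rewrite -exprnN.
Qed.

Lemma padic_norm_l : N l%:R = l%:R^-1.
Proof.
rewrite [X in N X]pmulrn padic_norm_int ?logn_prime//= ?eqxx ?expr1//.
by have := prime_gt0 lP; lia.
Qed.

Lemma padic_norm_int_le1 (m : int) : N m%:~R <= 1.
Proof.
have [->|m0] := eqVneq m 0; first by rewrite padic_norm0.
rewrite padic_norm_int// invf_le1 ?exprn_gt0//.
by rewrite exprn_ege1// ler1n prime_gt0.
Qed.

Lemma padic_norm_ndvd (m : int) : ~~ ((l ^ 2)%N%:Z %| m)%Z -> 1 <= l%:R * N m%:~R.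
Proof.
move=> nd; have m0 : m != 0 by apply: contraNneq nd => ->; rewrite dvdz0.
rewrite padic_norm_int// ler_pdivlMr ?exprn_gt0// mul1r.
move: nd; rewrite dvdzE /= pfactor_dvdn ?absz_gt0// -ltnNge ltnS.
by case: logn => [|[|//]] _; rewrite ?expr0 ?expr1 ?ler1n ?prime_gt0.
Qed.

Section Aniso.
Variables al be ga u v w : int.
Hypothesis aniso : forall z0 z1 z2 z3 : int,
  ((l ^ 2)%N%:Z %| inorm al be ga u v w z0 z1 z2 z3)%Z ->
  [/\ (l%:Z %| z0)%Z, (l%:Z %| z1)%Z, (l%:Z %| z2)%Z & (l%:Z %| z3)%Z].

Definition le4 (e x0 x1 x2 x3 : rat) : Prop :=
  [/\ N x0 ^+ 2 <= e, N x1 ^+ 2 <= e, N x2 ^+ 2 <= e & N x3 ^+ 2 <= e].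

(** Descent: if l ^ 2 divides the norm, so does l each coordinate, and dividing by l scales both
    sides by the same factor. Otherwise the norm has absolute value at least 1 / l, which the factor
    l compensates. *)
Lemma aniso_int (z0 z1 z2 z3 : int) :
  le4 (l%:R * N (inorm al be ga u v w z0 z1 z2 z3)%:~R) z0%:~R z1%:~R z2%:~R z3%:~R.
Proof.
have [n] := ubnP (`|z0| + `|z1| + `|z2| + `|z3|)%N.
elim: n z0 z1 z2 z3 => // n IH z0 z1 z2 z3 hn.
have [d|nd] := boolP ((l ^ 2)%N%:Z %| inorm al be ga u v w z0 z1 z2 z3)%Z; last first.
  have h := padic_norm_ndvd nd.
  have sq (m : int) : N m%:~R ^+ 2 <= 1 by rewrite exprn_ile1 ?padic_norm_ge0 ?padic_norm_int_le1.
  by split; apply: le_trans h; exact: sq.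
have [z00|nz] := boolP ((z0 == 0) && (z1 == 0) && (z2 == 0) && (z3 == 0)).
  move: z00 => /andP[/andP[/andP[/eqP-> /eqP->] /eqP->] /eqP->].
  by split; rewrite padic_norm0 expr0n mulr_ge0 ?padic_norm_ge0 ?ler0n.
have [/dvdzP[y0 e0] /dvdzP[y1 e1] /dvdzP[y2 e2] /dvdzP[y3 e3]] := aniso d.
have hy : (`|y0| + `|y1| + `|y2| + `|y3| < n)%N.
  have := prime_gt1 lP; move: hn nz; rewrite e0 e1 e2 e3 !abszM /= !mulf_eq0.
  nia.
have [i0 i1 i2 i3] := IH _ _ _ _ hy.
have -> : inorm al be ga u v w z0 z1 z2 z3 = inorm al be ga u v w y0 y1 y2 y3 * l%:Z * l%:Z.
  by rewrite /inorm e0 e1 e2 e3; ring.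
rewrite e0 e1 e2 e3 !rmorphM /= -pmulrn.
have E (x : rat) : l%:R * (x * l%:R^-1 * l%:R^-1) = (l%:R * x) * l%:R^-1 ^+ 2 by ring.
rewrite /le4 !padic_normM padic_norm_l !exprMn E.
have p0 : 0 <= (l%:R^-1 : rat) ^+ 2 by exact: sqr_ge0.
by split; apply: ler_wpM2r.
Qed.

Definition rnorm (x0 x1 x2 x3 : rat) : rat :=
  x0 ^+ 2 + x0 * (u%:~R * x1 + v%:~R * x2 + w%:~R * x3)
  + be%:~R * ga%:~R * x1 ^+ 2 + al%:~R * ga%:~R * x2 ^+ 2 + al%:~R * be%:~R * x3 ^+ 2
  + (u%:~R * v%:~R - ga%:~R * w%:~R) * x1 * x2 + (u%:~R * w%:~R - be%:~R * v%:~R) * x1 * x3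
  + (v%:~R * w%:~R - al%:~R * u%:~R) * x2 * x3.

Lemma aniso_rat (x0 x1 x2 x3 : rat) : le4 (l%:R * N (rnorm x0 x1 x2 x3)) x0 x1 x2 x3.
Proof.
pose D := denq x0 * denq x1 * denq x2 * denq x3.
have D0 : D%:~R != 0 :> rat by rewrite intr_eq0 !mulf_neq0 ?denq_eq0.
have cl x (D' : int) : exists n : int, x * (denq x * D')%:~R = n%:~R.
  by exists (numq x * D'); rewrite !rmorphM /= mulrA numqE.
have [z0 h0] : exists n : int, x0 * D%:~R = n%:~R.
  by have [n hn] := cl x0 (denq x1 * denq x2 * denq x3); exists n; rewrite -hn /D !mulrA.
have [z1 h1] : exists n : int, x1 * D%:~R = n%:~R.
  have [n hn] := cl x1 (denq x0 * denq x2 * denq x3); exists n; rewrite -hn /D.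
  by congr (_ * _%:~R); ring.
have [z2 h2] : exists n : int, x2 * D%:~R = n%:~R.
  have [n hn] := cl x2 (denq x0 * denq x1 * denq x3); exists n; rewrite -hn /D.
  by congr (_ * _%:~R); ring.
have [z3 h3] : exists n : int, x3 * D%:~R = n%:~R.
  have [n hn] := cl x3 (denq x0 * denq x1 * denq x2); exists n; rewrite -hn /D.
  by congr (_ * _%:~R); ring.
clearbody D.
have nE : (inorm al be ga u v w z0 z1 z2 z3)%:~R = rnorm x0 x1 x2 x3 * D%:~R * D%:~R :> rat.
  rewrite /inorm /rnorm !(rmorphD, rmorphN, rmorphM, rmorphXn) /= -h0 -h1 -h2 -h3; ring.
have [] := aniso_int z0 z1 z2 z3.
rewrite nE -h0 -h1 -h2 -h3 !padic_normM !exprMn !mulrA -!(mulrA _ (N D%:~R)) -expr2.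
have ND : 0 < N D%:~R ^+ 2 by rewrite exprn_gt0// padic_norm_gt0.
by rewrite !ler_pM2r.
Qed.
End Aniso.
End PadicInteger.

Section Ramification.
Variables (a b : rat) (l : nat).
Hypothesis lP : prime l.
Local Notation N := (padic_norm l).
Variables (i j k : quat a b) (al be ga u v w : int).
Hypothesis T : qtable i j k al%:~R be%:~R ga%:~R u%:~R v%:~R w%:~R.
Hypothesis aniso : forall z0 z1 z2 z3 : int,
  ((l ^ 2)%N%:Z %| inorm al be ga u v w z0 z1 z2 z3)%Z ->
  [/\ (l%:Z %| z0)%Z, (l%:Z %| z1)%Z, (l%:Z %| z2)%Z & (l%:Z %| z3)%Z].

Lemma comb4_full (h : quat a b) : exists x0 x1 x2 x3 : rat, h = comb4 i j k x0 x1 x2 x3.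
Proof.
have t0 := qt_trip T.
pose x1 := trip h j k / trip i j k; pose x2 := trip i h k / trip i j k.
pose x3 := trip i j h / trip i j k.
exists (qre h - x1 * qre i - x2 * qre j - x3 * qre k), x1, x2, x3.
have D : trip i j k * (trip i j k)^-1 = 1 by rewrite divff.
rewrite /x1 /x2 /x3; set d := (trip i j k)^-1 in D *.
apply: quat_eq; rewrite /comb4 /=; first by ring.
- by rewrite -[LHS]mul1r -D /trip; ring.
- by rewrite -[LHS]mul1r -D /trip; ring.
- by rewrite -[LHS]mul1r -D /trip; ring.
Qed.

(** [aniso_rat] bounds the coordinates in the basis 1, i, j, k, and [K] majorises the entries of the
    change to the standard basis. The constant is independent of h, which is what lets the bound
    pass to Cauchy sequences. *)
Lemma qnr_padic_bound : exists2 C : rat, 0 < C & forall (h : quat a b) (e : rat), 0 < e ->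
  N (qnr h) < e ^+ 2 * C ->
  [/\ N (qre h) < e, N (qi h) < e, N (qj h) < e & N (qk h) < e].
Proof.
(* Entries are called by position in [mul _ n] below. *)
pose cs := [:: 1; qre i; qre j; qre k; qi i; qi j; qi k; qj i; qj j; qj k; qk i; qk j; qk k].
pose K : rat := 1 + \sum_(c <- cs) N c.
have K1 : 1 <= K by rewrite lerDl sumr_ge0// => c _; exact: padic_norm_ge0.
have K0 : 0 < K by apply: lt_le_trans K1.
have cK c : c \in cs -> N c <= K.
  move=> cc; rewrite /K (big_rem c)//= addrCA lerDl addr_ge0// sumr_ge0// => d _.
  exact: padic_norm_ge0.
have l0 : 0 < (l%:R : rat) by rewrite ltr0n prime_gt0.
exists ((K ^+ 2)^-1 * l%:R^-1); first by rewrite mulr_gt0 ?invr_gt0 ?exprn_gt0.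
move=> h e e0 hN; have [x0 [x1 [x2 [x3 hx]]]] := comb4_full h.
have nE : qnr h = rnorm al be ga u v w x0 x1 x2 x3 by rewrite hx (qtable_nr T).
have B : l%:R * N (rnorm al be ga u v w x0 x1 x2 x3) < (e / K) ^+ 2.
  by rewrite -nE mulrC -ltr_pdivlMr// exprMn exprVn -mulrA.
have [b0 b1 b2 b3] := aniso_rat lP aniso x0 x1 x2 x3.
have ek : 0 < e / K by rewrite divr_gt0.
have sm x : N x ^+ 2 <= l%:R * N (rnorm al be ga u v w x0 x1 x2 x3) -> N x < e / K.
  by move=> hx2; rewrite -(@ltr_pXn2r _ 2)// ?nnegrE ?padic_norm_ge0 ?ltW// (le_lt_trans hx2).
have {b0}b0 := sm _ b0; have {b1}b1 := sm _ b1; have {b2}b2 := sm _ b2; have {b3}b3 := sm _ b3.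
have mul x n : N x < e / K -> N (x * cs`_n) < e.
  move=> xe; rewrite padic_normM; have [ns|ns] := ltnP n (size cs); last first.
    by rewrite nth_default// padic_norm0 mulr0.
  apply: (@le_lt_trans _ _ (N x * K)); first by rewrite ler_wpM2l ?padic_norm_ge0 ?cK ?mem_nth.
  by rewrite -ltr_pdivlMr.
have add x y : N x < e -> N y < e -> N (x + y) < e.
  by move=> hx' hy; apply: le_lt_trans (padic_normD _ _ _) _; rewrite gt_max hx' hy.
have x0e : N x0 < e by rewrite -[x0]mulr1; exact: (mul _ 0%N).
rewrite hx; split.
- have -> : qre (comb4 i j k x0 x1 x2 x3) = x0 + x1 * qre i + x2 * qre j + x3 * qre k.
    by rewrite /comb4 /=; ring.
  exact: (add _ _ (add _ _ (add _ _ x0e (mul _ 1%N b1)) (mul _ 2%N b2)) (mul _ 3%N b3)).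
- have -> : qi (comb4 i j k x0 x1 x2 x3) = x1 * qi i + x2 * qi j + x3 * qi k.
    by rewrite /comb4 /=; ring.
  exact: (add _ _ (add _ _ (mul _ 4%N b1) (mul _ 5%N b2)) (mul _ 6%N b3)).
- have -> : qj (comb4 i j k x0 x1 x2 x3) = x1 * qj i + x2 * qj j + x3 * qj k.
    by rewrite /comb4 /=; ring.
  exact: (add _ _ (add _ _ (mul _ 7%N b1) (mul _ 8%N b2)) (mul _ 9%N b3)).
- have -> : qk (comb4 i j k x0 x1 x2 x3) = x1 * qk i + x2 * qk j + x3 * qk k.
    by rewrite /comb4 /=; ring.
  exact: (add _ _ (add _ _ (mul _ 10%N b1) (mul _ 11%N b2)) (mul _ 12%N b3)).
Qed.

(** If a quaternion over the completion has norm 0, the norms of the approximating rational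
    quaternions form a null sequence; by the uniform bound so do their coordinates. *)
Lemma aniso_ramified : ramified_over (padic l) a b.
Proof.
move=> x x0; rewrite unfold_in /= /quat_unit; apply: contra_neq x0.
case: x => x0 x1 x2 x3.
elim/quotW: x0 => c0; elim/quotW: x1 => c1; elim/quotW: x2 => c2; elim/quotW: x3 => c3.
pose A := cconst l a; pose Bc := cconst l b.
pose D : cauchy_seq l := c0 * c0 - A * c1 * c1 - Bc * c2 * c2 + A * Bc * c3 * c3.
have -> : qnr (Quat (ratr a : padic l) (ratr b) (\pi_(padic l)%qT c0 : padic l)
    (\pi_(padic l)%qT c1 : padic l) (\pi_(padic l)%qT c2 : padic l)
    (\pi_(padic l)%qT c3 : padic l)) = \pi_(padic l)%qT D.
  rewrite /D !(rmorphD, rmorphN, rmorphM) /= !ratr_padic /pconst -/A -/Bc /qnr /=.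
  ring.
move=> /pi_eq0 nD.
have [C C0 hC] := qnr_padic_bound.
have key e : 0 < e -> exists n0, forall n, (n0 <= n)%N ->
    [/\ N (c0 n) < e, N (c1 n) < e, N (c2 n) < e & N (c3 n) < e].
  move=> e0; have [n0 hn0] := nD _ (mulr_gt0 (exprn_gt0 2 e0) C0).
  exists n0 => n /hn0; rewrite (_ : D n = qnr (Quat a b (c0 n) (c1 n) (c2 n) (c3 n))).
    by move=> /(hC _ _ e0).
  transitivity (c0 n * c0 n - a * c1 n * c1 n - b * c2 n * c2 n + a * b * c3 n * c3 n).
    by [].
  by rewrite /qnr /=; ring.
have n0 : is_null l c0 by move=> e /key[m hm]; exists m => n /hm[].
have n1 : is_null l c1 by move=> e /key[m hm]; exists m => n /hm[].
have n2 : is_null l c2 by move=> e /key[m hm]; exists m => n /hm[].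
have n3 : is_null l c3 by move=> e /key[m hm]; exists m => n /hm[].
by move: n0 n1 n2 n3 => /pi_eq0 -> /pi_eq0 -> /pi_eq0 -> /pi_eq0 ->.
Qed.
End Ramification.

(** * Gross lattices *)

(** If a > 0, then sqrt(a) + i is non-zero of norm a - a = 0; likewise for b and j. *)
Lemma ramified_real_lt0 (R : realType) (a b : rat) : a != 0 -> b != 0 ->
  ramified_over R a b -> a < 0 /\ b < 0.
Proof.
move=> a0 b0 H.
have key (x : quat (ratr a : R) (ratr b)) : x != 0 -> qnr x != 0 by move=> /H.
split.
- rewrite lt_neqAle a0 /= leNgt; apply/negP => ap.
  have ap' : 0 <= (ratr a : R) by rewrite ler0q ltW.
  pose x : quat (ratr a : R) (ratr b) := Quat _ _ (Num.sqrt (ratr a)) 1 0 0.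
  have : x != 0 by apply/eqP => -[_ /eqP]; rewrite oner_eq0.
  move/key/eqP; apply; transitivity (Num.sqrt (ratr a) ^+ 2 - ratr a : R).
    by rewrite /qnr /=; ring.
  by rewrite sqr_sqrtr// subrr.
- rewrite lt_neqAle b0 /= leNgt; apply/negP => bp.
  have bp' : 0 <= (ratr b : R) by rewrite ler0q ltW.
  pose x : quat (ratr a : R) (ratr b) := Quat _ _ (Num.sqrt (ratr b)) 0 1 0.
  have : x != 0 by apply/eqP => /(congr1 (@qj _ _ _))/eqP; rewrite /= oner_eq0.
  move/key/eqP; apply; transitivity (Num.sqrt (ratr b) ^+ 2 - ratr b : R).
    by rewrite /qnr /=; ring.
  by rewrite sqr_sqrtr// subrr.
Qed.

Section SameSpan.
Variables (a b : rat).
Local Notation B := (quat a b).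

Definition icomb3 (u1 u2 u3 : B) (z1 z2 z3 : int) : B :=
  z1%:~R *: u1 + z2%:~R *: u2 + z3%:~R *: u3.

Definition ibasis (L : set B) (u1 u2 u3 : B) : Prop :=
  [/\ L u1, L u2, L u3 & forall h, L h -> exists z1 z2 z3, h = icomb3 u1 u2 u3 z1 z2 z3].

Lemma dot_comb3 (u1 u2 u3 : B) (x1 x2 x3 y1 y2 y3 : rat) :
  dot (x1 *: u1 + x2 *: u2 + x3 *: u3) (y1 *: u1 + y2 *: u2 + y3 *: u3) =
  x1 * y1 * dot u1 u1 + x2 * y2 * dot u2 u2 + x3 * y3 * dot u3 u3
  + (x1 * y2 + x2 * y1) * dot u1 u2 + (x1 * y3 + x3 * y1) * dot u1 u3
  + (x2 * y3 + x3 * y2) * dot u2 u3.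
Proof. by rewrite !dotE (dotC u2 u1) (dotC u3 u1) (dotC u3 u2); ring. Qed.

Lemma trip_ispan L (u1 u2 u3 v1 v2 v3 : B) : ibasis L u1 u2 u3 -> L v1 -> L v2 -> L v3 ->
  exists d : int, trip v1 v2 v3 = d%:~R * trip u1 u2 u3.
Proof.
move=> [_ _ _ H] /H[x1 [x2 [x3 ->]]] /H[y1 [y2 [y3 ->]]] /H[z1 [z2 [z3 ->]]].
exists (x1 * (y2 * z3 - y3 * z2) - x2 * (y1 * z3 - y3 * z1) + x3 * (y1 * z2 - y2 * z1)).
by rewrite /icomb3 trip_comb !(rmorphD, rmorphN, rmorphM).
Qed.

(** The two transition determinants are integers inverse to each other. *)
Lemma trip_ibasis L (u1 u2 u3 v1 v2 v3 : B) : ibasis L u1 u2 u3 -> ibasis L v1 v2 v3 ->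
  trip v1 v2 v3 ^+ 2 = trip u1 u2 u3 ^+ 2.
Proof.
move=> hu hv; have [L1 L2 L3 _] := hu; have [K1 K2 K3 _] := hv.
have [d hd] := trip_ispan hu K1 K2 K3; have [d' hd'] := trip_ispan hv L1 L2 L3.
have [t0|t0] := eqVneq (trip u1 u2 u3) 0; first by rewrite hd t0 mulr0.
have : (d * d')%:~R = 1%:~R :> rat.
  by apply: (mulIf t0); rewrite rmorphM /= mulrAC -hd mulrC -hd' mul1r.
move=> /intr_inj/(congr1 absz); rewrite abszM => /eqP; rewrite muln_eq1 => /andP[/eqP d1 _].
have d2 : d ^+ 2 = 1 by have [->|->] : d = 1 \/ d = -1 by lia.
by rewrite hd exprMn -rmorphXn d2 mul1r.
Qed.

End SameSpan.

Section GrossLattice.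
Variables (a b : rat).
Hypotheses (a0 : a < 0) (b0 : b < 0).
Local Notation B := (quat a b).
Implicit Types (x y z h i j k : B) (O : set B).

Section Basis.
Variables (O : set B) (i j k : B) (al be ga u v w : int).
Hypothesis G : good_basis O i j k al be ga u v w.
Local Notation L := (gross_lattice O).
Local Notation v1 := (purify i).
Local Notation v2 := (purify j).
Local Notation v3 := (purify k).
Local Notation N := (idisc al be ga u v w).

Let T : qtable i j k al%:~R be%:~R ga%:~R u%:~R v%:~R w%:~R. Proof. by case: G. Qed.

Lemma gross_in (z1 z2 z3 : int) : L (icomb3 v1 v2 v3 z1 z2 z3).
Proof.
split; first by rewrite qtr_re /icomb3 /purify /qtr /=; ring.
exists (comb4 i j k 0 z1%:~R z2%:~R z3%:~R); first by apply/(proj2 G); exists 0, z1, z2, z3.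
exists (- (z1 * u + z2 * v + z3 * w)).
have -> (m : int) : m%:~R = m%:~R%:A :> B by rewrite scaler_int.
rewrite !(rmorphD, rmorphN, rmorphM) /= -(qt_ti T) -(qt_tj T) -(qt_tk T) mulr2n.
by apply: quat_eq; rewrite /icomb3 /comb4 /purify /qtr /=; ring.
Qed.

Lemma gross_basisP : ibasis L v1 v2 v3.
Proof.
split.
- by rewrite [v1](_ : _ = icomb3 v1 v2 v3 1 0 0); [exact: gross_in|apply: quat_eq; rewrite /icomb3 /=; ring].
- by rewrite [v2](_ : _ = icomb3 v1 v2 v3 0 1 0); [exact: gross_in|apply: quat_eq; rewrite /icomb3 /=; ring].
- by rewrite [v3](_ : _ = icomb3 v1 v2 v3 0 0 1); [exact: gross_in|apply: quat_eq; rewrite /icomb3 /=; ring].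
move=> h [h0 [x /(proj2 G)[z0 [z1 [z2 [z3 ->]]]] [m hm]]]; exists z1, z2, z3.
have hm' : h = comb4 i j k z0%:~R z1%:~R z2%:~R z3%:~R *+ 2 + m%:~R%:A.
  by rewrite hm; congr (_ + _); rewrite scaler_int.
have e0 : qre h = 0 by move: h0; rewrite qtr_re; lra.
by apply: quat_eq; [rewrite e0|rewrite hm'..]; rewrite ?mulr2n /icomb3 /comb4 /purify /qtr /=; ring.
Qed.

Lemma idisc_half : N%:~R = half_disc al%:~R be%:~R ga%:~R u%:~R v%:~R w%:~R :> rat.
Proof. by rewrite /idisc /half_disc !(rmorphD, rmorphN, rmorphM, rmorphXn, rmorph_nat). Qed.

Lemma idisc_neq0 : N != 0.
Proof. by rewrite -(intr_eq0 rat) idisc_half; exact: half_disc_neq0 T. Qed.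

(** The second minors of an adjugate are the determinant times the entries of the original matrix.
    Hence the Gram minor is 4 [N] times the ternary form at the cross product of the coordinate
    vectors, which is the witness. *)
Lemma gross_gram2 h h' : L h -> L h' -> exists m : int, gram2 h h' = (4 * N * m)%:~R.
Proof.
have [_ _ _ H] := gross_basisP.
move=> /H[x1 [x2 [x3 ->]]] /H[y1 [y2 [y3 ->]]].
pose c1 := x2 * y3 - x3 * y2; pose c2 := x3 * y1 - x1 * y3; pose c3 := x1 * y2 - x2 * y1.
exists (al * c1 ^+ 2 + be * c2 ^+ 2 + ga * c3 ^+ 2 + u * c2 * c3 + v * c1 * c3 + w * c1 * c2).
have [[g11 g22 g33] [g12 g13 g23]] := qtable_gram T.
rewrite /gram2 /icomb3 !dot_comb3.
rewrite g11 g22 g33 g12 g13 g23 /idisc /c1 /c2 /c3.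
rewrite !(rmorphD, rmorphN, rmorphM, rmorphXn, rmorph_nat) /=.
ring.
Qed.

Lemma gross_nr x : is_order O -> L x -> exists n t : int, dot x x = (4 * n - t ^+ 2)%:~R.
Proof.
move=> HO [tx [x' Ox [m xE]]].
have /intrP[n hn] := order_qnr_int HO Ox; have /intrP[t ht] := order_qtr_int HO Ox.
exists n, t; have xE' : x = purify x'.
  have {}xE : x = 2 *: x' + m%:~R%:A by rewrite xE scaler_nat -scaler_int.
  apply: quat_eq.
  - by rewrite purify_re; move: tx; rewrite qtr_re; lra.
  - by rewrite xE /purify /=; ring.
  - by rewrite xE /purify /=; ring.
  - by rewrite xE /purify /=; ring.
rewrite xE' !(rmorphD, rmorphN, rmorphM, rmorphXn, rmorph_nat) /= -hn -ht.
by rewrite /dot /purify /qtr /qnr /=; ring.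
Qed.

Lemma gross_lattice_pure : is_order O -> pure_lattice L.
Proof.
move=> HO; split.
- move=> x y [tx [x' Ox [m ex]]] [ty [y' Oy [n ey]]]; split.
    by move: tx ty; rewrite !qtr_re /=; lra.
  exists (x' - y'); first exact: (orderB HO).
  by exists (m - n); rewrite ex ey rmorphB mulrnBl /= opprD addrACA.
- by move=> x []; rewrite qtr_re; lra.
- move=> x Lx; have [n [t nE]] := gross_nr HO Lx.
  have : 0 <= 4 * n - t ^+ 2 by rewrite -(ler0z rat) -nE dot_ge0.
  by rewrite nE; case: (4 * n - t ^+ 2) => // q _; exists q.
- have [L1 L2 L3 _] := gross_basisP; exists v1, v2, v3; split=> //.
  by rewrite trip_purify mulf_neq0 ?pnatr_eq0//; exact: qt_trip T.
Qed.

(** Norms on the Gross lattice have the form 4 n - t ^ 2, so they are 0 or 3 modulo 4. *)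
Lemma gross_ge3 h : is_order O -> L h -> h != 0 -> 3 <= dot h h.
Proof.
move=> HO Lh h0; have [n [t nE]] := gross_nr HO Lh.
have : 0 < 4 * n - t ^+ 2 by rewrite -(ltr0z rat) -nE dot_gt0.
rewrite nE => n0; rewrite (_ : 3 = 3%:~R)// ler_int.
have [q hq] : exists q, t ^+ 2 = 4 * q \/ t ^+ 2 = 4 * q + 1.
  have := divz_eq t 2; have := modz_ge0 t (isT : 2 != 0 :> int); have := ltz_pmod t (isT : 0 < 2 :> int).
  set q := (t %/ 2)%Z; set r := (t %% 2)%Z => r2 r0 tE.
  have [r00|r1] : r = 0 \/ r = 1 by lia.
    by exists (q ^+ 2); left; rewrite tE r00; ring.
  by exists (q ^+ 2 + q); right; rewrite tE r1; ring.
by lia.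
Qed.
End Basis.
End GrossLattice.

(** * The discriminant of a maximal order is p *)

Section Discriminant.
Variables (R : realType) (p : nat) (a b : rat).
Hypothesis hp : prime p.
Hypothesis hB : ramified_exactly_at_p_oo R p a b.
Local Notation B := (quat a b).

Let ab0 : a < 0 /\ b < 0.
Proof. by case: hB => a0 b0 hR _; exact: ramified_real_lt0 hR. Qed.

Lemma ram_a_lt0 : a < 0. Proof. by case: ab0. Qed.
Lemma ram_b_lt0 : b < 0. Proof. by case: ab0. Qed.

Variable O : set B.
Hypothesis mO : maximal_order O.
Local Notation L := (gross_lattice O).

Let HO : is_order O. Proof. by case: mO. Qed.

Lemma maximal_disc_prime (l : nat) al be ga u v w : prime l -> form_of O al be ga u v w ->
  (l%:Z %| idisc al be ga u v w)%Z -> l = p /\ ~~ ((l ^ 2)%N%:Z %| idisc al be ga u v w)%Z.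
Proof.
move=> lP h d.
have rot := @form_of_rot a b O; have shear := @form_of_shear a b O.
have plane al' be' ga' u' v' w' := @maximal_plane a b O l al' be' ga' u' v' w' mO lP.
have radical al' be' ga' u' v' w' := @maximal_radical a b O l al' be' ga' u' v' w' mO lP.
have [al' [be' [ga' [u' [v' [w' [lf <-]]]]]]] := local_form_exists lP rot shear plane h d.
split; last exact: (local_form_disc lP radical lf).
have [[[i [j [k [T _]]]] _ _ _] _] := lf.
have [_ _ _ hram] := hB; apply/hram => //.
by apply: (aniso_ramified lP T) => z0 z1 z2 z3; exact: (local_form_norm lP radical lf).
Qed.

Lemma minimal_ibasis (u1 u2 u3 : B) : minimal_triple L u1 u2 u3 -> ibasis L u1 u2 u3.
Proof.
move=> HU; split; [exact: mt_in1 HU|exact: mt_in2 HU|exact: mt_in3 HU|].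
have [i [j [k [al [be [ga [u [v [w G]]]]]]]]] := order_good_basis ram_a_lt0 ram_b_lt0 HO.
have PL := gross_lattice_pure ram_a_lt0 ram_b_lt0 G HO.
by move=> h Lh; exact: (mt_gen ram_a_lt0 ram_b_lt0 PL HU).
Qed.

Lemma gross_gram3 al be ga u v w (u1 u2 u3 : B) : form_of O al be ga u v w ->
  ibasis L u1 u2 u3 -> gram3 u1 u2 u3 = 4 * (idisc al be ga u v w)%:~R ^+ 2.
Proof.
move=> [i [j [k G]]] hu; have [T _] := G.
have a0 := ram_a_lt0; have b0 := ram_b_lt0.
have PL := gross_lattice_pure a0 b0 G HO.
have [L1 L2 L3 _] := hu.
rewrite idisc_half -(qtable_gram3 T) !gram3_trip ?purify_re ?(pl_pure PL)//.
by rewrite !exprMn (trip_ibasis (gross_basisP G) hu).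
Qed.

Lemma maximal_disc al be ga u v w : form_of O al be ga u v w -> `|idisc al be ga u v w|%N = p.
Proof.
move=> h; have dp := fun l lP => @maximal_disc_prime l _ _ _ _ _ _ lP h.
have gg := gross_gram3 h; set N := idisc _ _ _ _ _ _ in dp gg *.
have [i [j [k G]]] := h.
have a0 := ram_a_lt0; have b0 := ram_b_lt0.
have PL := gross_lattice_pure a0 b0 G HO.
have N0 : N != 0 := idisc_neq0 a0 b0 G.
have [u1 [u2 [u3 HU]]] := minimal_triple_exists a0 b0 PL.
(* With discriminant 1 the Gram determinant is 4, and Hermite's inequality would give 3 * 27 <= 8 *
   4. *)
have n1 : `|N|%N != 1%N.
  apply/eqP => n1.
  have H := mt_hermite a0 b0 PL HU.
  have g3 : gram3 u1 u2 u3 = 4.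
    rewrite (gg _ _ _ (minimal_ibasis HU)).
    by have [->|->] : N = 1 \/ N = -1 by lia.
  have L3 x : L x -> x != 0 -> 3 <= dot x x by move=> Lx; exact: (gross_ge3 a0 b0 HO Lx).
  have D1 := L3 _ (mt_in1 HU) (mt_neq0 HU).
  have D12 := mt_D12 HU; have D23 := mt_D23 a0 b0 PL HU.
  move: H; rewrite g3; move: D1 D12 D23.
  move: (dot u1 u1) (dot u2 u2) (dot u3 u3) => d1 d2 d3 D1 D12 D23.
  have d2' : 3 <= d2 by lra.
  have d3' : 3 <= d3 by lra.
  have e1 : 3 * 3 <= d1 * d2 by apply: ler_pM.
  have : 3 * 3 * 3 <= d1 * d2 * d3 by apply: ler_pM.
  lra.
have q1 := pdiv_prime (_ : (1 < `|N|)%N).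
have N1 : (1 < `|N|)%N by move: N0; rewrite -absz_gt0; case: `|N|%N n1 => [|[|]].
have pN : (p %| `|N|)%N.
  have := pdiv_dvd `|N|%N; set q := pdiv _ => qd.
  by have [<- _] := dp q (pdiv_prime N1) qd.
have [_ pp] := dp p hp pN.
have [m Nm] := dvdnP pN.
have [m1|m1] := eqVneq m 1%N; first by rewrite Nm m1 mul1n.
have m0 : (0 < m)%N by move: N1; rewrite Nm; case: (m).
have m2 : (1 < m)%N by case: (m) m0 m1 => [|[|]].
have rN : (pdiv m %| `|N|)%N by rewrite Nm dvdn_mulr// pdiv_dvd.
have [rp _] := dp (pdiv m) (pdiv_prime m2) rN.
by move: pp; rewrite dvdzE /= Nm -mulnn dvdn_pmul2r ?prime_gt0// -rp pdiv_dvd.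
Qed.

(** The interface to the arithmetic of the order: matching the two lattices up to isometry uses
    these properties only. *)
Record gross_facts (G : set B) : Prop := GrossFacts {
  gf_pure : pure_lattice G;
  gf_ge3 : forall h, G h -> h != 0 -> 3 <= dot h h;
  gf_gram2 : forall h h', G h -> G h' -> exists m : int, gram2 h h' = (4 * p%:Z * m)%:~R;
  gf_gram3 : forall u1 u2 u3, ibasis G u1 u2 u3 -> gram3 u1 u2 u3 = 4 * p%:R ^+ 2;
  gf_ibasis : forall u1 u2 u3, minimal_triple G u1 u2 u3 -> ibasis G u1 u2 u3;
  gf_free : exists u1 u2 u3, ibasis G u1 u2 u3 }.

Lemma maximal_gross_facts : gross_facts L.
Proof.
have a0 := ram_a_lt0; have b0 := ram_b_lt0.
have [i [j [k [al [be [ga [u [v [w G]]]]]]]]] := order_good_basis a0 b0 HO.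
have fo : form_of O al be ga u v w by exists i, j, k.
have Np := maximal_disc fo.
have [s [sE s1]] : exists s : int, idisc al be ga u v w = s * p%:Z /\ s ^+ 2 = 1.
  have [e|e] : idisc al be ga u v w = p%:Z \/ idisc al be ga u v w = - p%:Z by lia.
    by exists 1; rewrite mul1r e.
  by exists (- 1); rewrite mulN1r e.
split.
- exact: (gross_lattice_pure a0 b0 G HO).
- by move=> h Lh; exact: (gross_ge3 a0 b0 HO Lh).
- move=> h h' Lh Lh'; have [m ->] := gross_gram2 G Lh Lh'.
  by exists (s * m); rewrite sE; congr (_%:~R); ring.
- move=> u1 u2 u3 /(gross_gram3 fo) ->.
  by rewrite sE rmorphM /= exprMn -rmorphXn s1 mul1r -pmulrn.
- exact: minimal_ibasis.
- by exists (purify i), (purify j), (purify k); exact: (gross_basisP G).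
Qed.
End Discriminant.

(** * From domination to a norm-preserving bijection *)

Lemma fset_injection (T : choiceType) (x0 : T) (X Y : {fset T}) : (#|` X| <= #|` Y|)%N ->
  exists2 f : T -> T, {in X, forall x, f x \in Y} & {in X &, injective f}.
Proof.
move=> XY; exists (fun x => nth x0 (enum_fset Y) (index x (enum_fset X))).
  by move=> x xX; apply: mem_nth; apply: leq_trans XY; rewrite index_mem.
move=> x y xX yX /eqP; rewrite nth_uniq ?fset_uniq//.
- by move=> /eqP/(congr1 (nth x0 (enum_fset X))); rewrite !nth_index.
- by apply: leq_trans XY; rewrite index_mem.
- by apply: leq_trans XY; rewrite index_mem.
Qed.

(** Fischer's inequality, with the defect displayed as a sum of nonnegative terms. *)
Lemma gram3_le_gram2 (a b : rat) (a0 : a < 0) (b0 : b < 0) (x y h : quat a b) :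
  gram3 x y h <= gram2 x y * dot h h.
Proof.
have [->|x0] := eqVneq x 0.
  by rewrite /gram3 /gram2 !dot0l; lra.
have D0 := dot_gt0 a0 b0 x0.
have E : gram2 x y * dot h h - gram3 x y h =
  ((dot x x * dot y h - dot x y * dot x h) ^+ 2 + dot x h ^+ 2 * gram2 x y) / dot x x.
  by rewrite /gram2 /gram3; field; rewrite gt_eqF.
rewrite -subr_ge0 E divr_ge0 ?dot_ge0// addr_ge0 ?sqr_ge0// mulr_ge0 ?sqr_ge0//.
exact: gram2_ge0.
Qed.

Section Coercive.
Variables (a b : rat).
Hypotheses (a0 : a < 0) (b0 : b < 0).
Local Notation B := (quat a b).
Variables (u1 u2 u3 : B).
Hypotheses (q1 : qre u1 = 0) (q2 : qre u2 = 0) (q3 : qre u3 = 0).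
Hypothesis t0 : trip u1 u2 u3 != 0.

Definition comb3 (x1 x2 x3 : rat) : B := x1 *: u1 + x2 *: u2 + x3 *: u3.
Definition qform3 (x1 x2 x3 : rat) : rat := dot (comb3 x1 x2 x3) (comb3 x1 x2 x3).

(** By Cramer's rule a coordinate of h is a quotient of two [trip] values, and Fischer's inequality
    bounds its square by a multiple of the norm of h. *)
Lemma qform3_good : good_form qform3.
Proof.
split.
  exists (dot u1 u1), (dot u2 u2), (dot u3 u3), (dot u1 u2), (dot u1 u3), (dot u2 u3).
  by move=> x y z; rewrite /qform3 /comb3 dot_comb3; ring.
have C (x y z h : B) (c : rat) : qre x = 0 -> qre y = 0 -> qre z = 0 -> qre h = 0 ->
    trip x y h ^+ 2 = c ^+ 2 * trip x y z ^+ 2 -> trip x y z != 0 ->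
    c ^+ 2 <= gram2 x y / (a * b * trip x y z) ^+ 2 * dot h h.
  move=> hx hy hz hh th tz.
  have ab0 : 0 < (a * b * trip x y z) ^+ 2.
    rewrite lt_neqAle sqr_ge0 andbT eq_sym sqrf_eq0; apply: (mulf_neq0 _ tz).
    by apply: mulf_neq0; [rewrite (lt_eqF a0)|rewrite (lt_eqF b0)].
  rewrite mulrAC ler_pdivlMr//; apply: le_trans (gram3_le_gram2 a0 b0 x y h).
  by rewrite gram3_trip// !exprMn th; lra.
pose K1 := gram2 u2 u3 / (a * b * trip u2 u3 u1) ^+ 2.
pose K2 := gram2 u1 u3 / (a * b * trip u1 u3 u2) ^+ 2.
pose K3 := gram2 u1 u2 / (a * b * trip u1 u2 u3) ^+ 2.
have K10 : 0 <= K1 by rewrite divr_ge0 ?gram2_ge0 ?sqr_ge0.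
have K20 : 0 <= K2 by rewrite divr_ge0 ?gram2_ge0 ?sqr_ge0.
have K30 : 0 <= K3 by rewrite divr_ge0 ?gram2_ge0 ?sqr_ge0.
pose m := (Num.trunc (K1 + K2 + K3)).+1.
have hm : K1 + K2 + K3 <= m%:R ^+ 2.
  have h1 : K1 + K2 + K3 <= m%:R by apply: ltW; exact: truncnS_gt.
  by apply: le_trans h1 _; rewrite expr2 ler_peMl ?ler0n// ler1n.
exists m => x y z.
have qh : qre (comb3 x y z) = 0 by rewrite /comb3 /= q1 q2 q3; ring.
have d0 := dot_ge0 a0 b0 (comb3 x y z).
have t1 : trip u2 u3 u1 != 0 by rewrite (_ : trip u2 u3 u1 = trip u1 u2 u3)// /trip; ring.
have t2 : trip u1 u3 u2 != 0.
  by rewrite (_ : trip u1 u3 u2 = - trip u1 u2 u3) ?oppr_eq0// /trip; ring.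
split.
- apply: le_trans (C u2 u3 u1 (comb3 x y z) x q2 q3 q1 qh _ t1) _.
    by rewrite -exprMn; congr (_ ^+ 2); rewrite /comb3 /trip /=; ring.
  by rewrite ler_wpM2r//; rewrite -/K1; lra.
- apply: le_trans (C u1 u3 u2 (comb3 x y z) y q1 q3 q2 qh _ t2) _.
    by rewrite -exprMn; congr (_ ^+ 2); rewrite /comb3 /trip /=; ring.
  by rewrite ler_wpM2r//; rewrite -/K2; lra.
- apply: le_trans (C u1 u2 u3 (comb3 x y z) z q1 q2 q3 qh _ t0) _.
    by rewrite -exprMn; congr (_ ^+ 2); rewrite /comb3 /trip /=; ring.
  by rewrite ler_wpM2r//; rewrite -/K3; lra.
Qed.

(** At scale n + 1 the weight vanishes outside a finite box, while it is positive on vectors of norm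
    at most n < (n + 1) ^ 2. *)
Lemma norm_finite (L : set B) (n : nat) : ibasis L u1 u2 u3 ->
  finite_set [set h | L h /\ dot h h <= n%:R].
Proof.
move=> [_ _ _ H]; have [_ [m cm]] := qform3_good.
have m0 := coercive_gt0 cm.
apply: (@sub_finite_set _ _ ((fun p : int * int * int => icomb3 u1 u2 u3 p.1.1 p.1.2 p.2) @`
  [set` zbox3 (m * n.+1)])); last exact: finite_image.
move=> h [/H[z1 [z2 [z3 hE]]] hn]; exists ((z1, z2), z3) => //=.
apply: contraT => nin.
have w1 := weight_zbox3 cm (isT : (0 < n.+1)%N) nin.
have : 0 < weight qform3 n.+1 z1 z2 z3.
  rewrite /weight /pos4 exprn_gt0// lt_max; apply/orP; right.
  rewrite subr_gt0 ltr_pdivrMr ?exprn_gt0 ?ltr0n// mul1r.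
  rewrite /qform3 /comb3 -[_ + _ + _]/(icomb3 u1 u2 u3 z1 z2 z3) -hE.
  apply: le_lt_trans hn _; rewrite -natrX ltr_nat.
  by rewrite -mulnn mulSn ltnS leq_addr.
by rewrite w1 ltxx.
Qed.

End Coercive.

Lemma gcdz3_scale (g : nat) (z : 'I_3 -> int) :
  \big[gcdz/0]_(i < 3) (g%:Z * z i) = g%:Z * \big[gcdz/0]_(i < 3) z i.
Proof.
have H (m n : int) : gcdz (g%:Z * m) (g%:Z * n) = g%:Z * gcdz m n.
  by rewrite /gcdz !abszM /= -muln_gcdr PoszM.
have H0 (m : int) : gcdz (g%:Z * m) 0 = g%:Z * gcdz m 0 by rewrite -{1}(mulr0 g%:Z) H.
by rewrite !big_ord_recl !big_ord0 H0 !H.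
Qed.

(** * Contents and primitive vectors *)

Section Content.
Variables (a b : rat).
Local Notation B := (quat a b).

Definition prim (e : 3.-tuple B) (h : B) : Prop :=
  exists z : 'I_3 -> int, h = \sum_(i < 3) e`_i *~ z i /\ \big[gcdz/0]_(i < 3) z i = 1.

Lemma prim_reps (e : 3.-tuple B) d h : primitive_reps e d h <-> prim e h /\ qnr h = d%:R.
Proof.
split; first by move=> [z [? ? ?]]; split=> //; exists z.
by move=> [[z [? ?]] ?]; exists z.
Qed.

Lemma span_inj (e : 3.-tuple B) (z z' : 'I_3 -> int) : free e ->
  \sum_(i < 3) e`_i *~ z i = \sum_(i < 3) e`_i *~ z' i -> forall i, z i = z' i.
Proof.
move=> /freeP fe E i; apply/eqP; rewrite -subr_eq0 -(intr_eq0 rat); apply/eqP.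
apply: (fe (fun i => (z i - z' i)%:~R)).
under eq_bigr do rewrite scaler_int mulrzBr.
by rewrite sumrB E subrr.
Qed.

Lemma scale_span (e : 3.-tuple B) (g : nat) (z : 'I_3 -> int) :
  g%:R *: (\sum_(i < 3) e`_i *~ z i) = \sum_(i < 3) e`_i *~ (g%:Z * z i).
Proof.
rewrite scaler_sumr; apply: eq_bigr => i _.
by rewrite -!scaler_int scalerA rmorphM /= -pmulrn.
Qed.

Lemma content_uniq (e : 3.-tuple B) (g g' : nat) h h' : free e -> (0 < g)%N ->
  prim e h -> prim e h' -> g%:R *: h = g'%:R *: h' -> g = g' /\ h = h'.
Proof.
move=> fe g0 [z [-> gz]] [z' [-> gz']]; rewrite !scale_span => /(span_inj fe) E.
have gg : g = g'.
  have := gcdz3_scale g z; have := gcdz3_scale g' z'.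
  rewrite gz gz' !mulr1 (eq_bigr _ (fun i _ => E i)) => -> [].
  by [].
split=> //; apply: eq_bigr => i _; congr (_ *~ _).
have gn0 : g%:Z != 0 by lia.
by apply: (mulfI gn0); rewrite E gg.
Qed.

Lemma content_exists (e : 3.-tuple B) h : Zspan e h -> h != 0 ->
  exists (g : nat) h', [/\ (0 < g)%N, prim e h' & h = g%:R *: h'].
Proof.
move=> [z ->] h0.
pose G := \big[gcdz/0]_(i < 3) z i.
have [g gE] : exists g : nat, G = g%:Z.
  by rewrite /G !big_ord_recl; eexists.
have gd i : (G %| z i)%Z.
  rewrite /G !big_ord_recl big_ord0.
  case: i => [[|[|[|//]]] li].
  - rewrite (_ : Ordinal li = ord0); last exact: val_inj.
    exact: dvdz_gcdl.
  - rewrite (_ : Ordinal li = lift ord0 ord0); last exact: val_inj.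
    by apply: dvdz_trans (dvdz_gcdr _ _) (dvdz_gcdl _ _).
  - rewrite (_ : Ordinal li = lift ord0 (lift ord0 ord0)); last exact: val_inj.
    by apply: dvdz_trans (dvdz_gcdr _ _) (dvdz_trans (dvdz_gcdr _ _) (dvdz_gcdl _ _)).
have g0 : (0 < g)%N.
  rewrite lt0n; apply: contra h0 => /eqP g0; rewrite big1// => i _.
  by have := gd i; rewrite gE g0 dvd0z => /eqP ->; rewrite mulr0z.
have zE i : z i = g%:Z * (z i %/ G)%Z by rewrite -gE mulrC divzK.
exists g, (\sum_(i < 3) e`_i *~ (z i %/ G)%Z); split=> //.
  exists (fun i => (z i %/ G)%Z); split=> //.
  have gn0 : g%:Z != 0 by lia.
  apply: (mulfI gn0); rewrite -gcdz3_scale mulr1 -[RHS]gE.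
  by apply: eq_bigr => i _; exact: (esym (zE i)).
by rewrite scale_span; apply: eq_bigr => i _; congr (_ *~ _); exact: zE.
Qed.

End Content.

Section Domination.
Variables (R : realType) (p : nat) (a b : rat).
Hypothesis hp : prime p.
Hypothesis hB : ramified_exactly_at_p_oo R p a b.
Local Notation B := (quat a b).
Let a0 : a < 0 := ram_a_lt0 hB.
Let b0 : b < 0 := ram_b_lt0 hB.
Implicit Types (O : set B) (h k : B).

Lemma gram3_trip_neq0 (L : set B) (u1 u2 u3 : B) : gross_facts p L -> ibasis L u1 u2 u3 ->
  trip u1 u2 u3 != 0.
Proof.
move=> F hu; have [L1 L2 L3 _] := hu.
have := gf_gram3 F hu; rewrite gram3_trip; try by apply: (pl_pure (gf_pure F)).
apply: contra_eq_neq => ->; rewrite mulr0 expr0n eq_sym mulf_neq0// ?pnatr_eq0//.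
by rewrite expf_neq0// pnatr_eq0 -lt0n prime_gt0.
Qed.

Lemma Zspan3 (u1 u2 u3 : B) h : Zspan [tuple u1; u2; u3] h <->
  exists z1 z2 z3, h = icomb3 u1 u2 u3 z1 z2 z3.
Proof.
split=> [[z ->]|[z1 [z2 [z3 ->]]]].
  exists (z ord0), (z (lift ord0 ord0)), (z (lift ord0 (lift ord0 ord0))).
  by rewrite !big_ord_recl big_ord0 addr0 /= -!scaler_int !addrA.
exists (fun i : 'I_3 => [:: z1; z2; z3]`_i).
by rewrite !big_ord_recl big_ord0 addr0 /= -!scaler_int !addrA.
Qed.

Lemma ibasis_Zbasis (L : set B) (u1 u2 u3 : B) : gross_facts p L -> ibasis L u1 u2 u3 ->
  Zbasis [tuple u1; u2; u3] L.
Proof.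
move=> F hu; have t0 := gram3_trip_neq0 F hu; have [L1 L2 L3 H] := hu.
have PL := gf_pure F; split.
  apply/freeP => c; rewrite !big_ord_recl big_ord0 addr0 !addrA /= => h.
  have [_ h1 h2 h3] : [/\ (0 : rat) = 0, c ord0 = 0, c (lift ord0 ord0) = 0
      & c (lift ord0 (lift ord0 ord0)) = 0].
    apply: (comb4_inj t0); rewrite /comb4 scale0r add0r h.
    by rewrite !scale0r !addr0.
  case=> [[|[|[|//]]] lt]; [rewrite -h1|rewrite -h2|rewrite -h3]; congr c; exact: val_inj.
apply/seteqP; split=> h; first by move=> /H/Zspan3.
move=> /Zspan3[z1 [z2 [z3 ->]]]; rewrite /icomb3.
by do !apply: (plD PL); apply: (plZ PL).
Qed.

Lemma gross_basis_Zbasis O : maximal_order O -> Zbasis (gross_basis O) (gross_lattice O).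
Proof.
move=> mO; have F := maximal_gross_facts hp hB mO.
have [u1 [u2 [u3 hu]]] := gf_free F.
by apply: (@xgetPex _ _ [set u | Zbasis u (gross_lattice O)]); exists [tuple u1; u2; u3];
  exact: ibasis_Zbasis hu.
Qed.

Lemma prim_reps_finite O d : maximal_order O -> finite_set (primitive_reps (gross_basis O) d).
Proof.
move=> mO; have F := maximal_gross_facts hp hB mO.
have [u1 [u2 [u3 hu]]] := gf_free F; have [L1 L2 L3 _] := hu; have PL := gf_pure F.
have t0 := gram3_trip_neq0 F hu.
have := @norm_finite a b a0 b0 u1 u2 u3 (pl_pure PL L1) (pl_pure PL L2) (pl_pure PL L3) t0 _ d hu.
apply: sub_finite_set => h [z [-> _ hd]]; split; last by rewrite -qnr_dot hd.
by have [_ ->] := gross_basis_Zbasis mO; exists z.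
Qed.

(** Domination gives injections [f d] between the finite sets of primitive vectors of norm d; [Phi]
    extends them by sending g h' to g (f d h'). It is injective since the content and the norm of
    the primitive part can be read off the image. *)
Lemma dominates_injection O O' : maximal_order O -> maximal_order O' -> dominates O' O ->
  exists Phi : B -> B,
    (forall h, gross_lattice O h -> gross_lattice O' (Phi h) /\ dot (Phi h) (Phi h) = dot h h) /\
    (forall h k, gross_lattice O h -> gross_lattice O k -> Phi h = Phi k -> h = k).
Proof.
move=> mO mO' dom.
have F := maximal_gross_facts hp hB mO.
have [fe LE] := gross_basis_Zbasis mO; have [fe' LE'] := gross_basis_Zbasis mO'.
set e := gross_basis O in fe LE; set e' := gross_basis O' in fe' LE'.
pose P d := fset_set (primitive_reps e d); pose P' d := fset_set (primitive_reps e' d).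
have inP d h : h \in P d <-> prim e h /\ qnr h = d%:R.
  rewrite /P in_fset_set; last exact: prim_reps_finite.
  by rewrite -prim_reps; split=> [/set_mem|/mem_set].
have inP' d h : h \in P' d <-> prim e' h /\ qnr h = d%:R.
  rewrite /P' in_fset_set; last exact: prim_reps_finite.
  by rewrite -prim_reps; split=> [/set_mem|/mem_set].
have /choice[f hf] : forall d, exists f : B -> B,
    {in P d, forall x, f x \in P' d} /\ {in P d &, injective f}.
  by move=> d; have [f f1 f2] := fset_injection (0 : B) (dom d); exists f.
pose rel h k := gross_lattice O h -> (h = 0 /\ k = 0) \/ exists (g d : nat) h',
  [/\ (0 < g)%N, h' \in P d, h = g%:R *: h' & k = g%:R *: f d h'].
have /choice[Phi hPhi] : forall h, exists k, rel h k.
  move=> h; have [Lh|nLh] := pselect (gross_lattice O h); last by exists 0.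
  have [->|h0] := eqVneq h 0; first by exists 0; left.
  have Sh : Zspan e h by rewrite -LE.
  have [g [h' [g0 ph' hE]]] := content_exists Sh h0.
  have Lh' : gross_lattice O h'.
    by rewrite LE; have [z [-> _]] := ph'; exists z.
  have [d hd] := pl_nat (gf_pure F) Lh'.
  exists (g%:R *: f d h') => _; right; exists g, d, h'; split=> //.
  by apply/inP; split.
exists Phi; split.
  move=> h Lh; have [[-> ->]|[g [d [h' [g0 hP hE kE]]]]] := hPhi h Lh.
    by split=> //; rewrite LE'; exists (fun=> 0); rewrite big1// => i _; rewrite mulr0z.
  have /inP'[pf nf] := (hf d).1 _ hP; have /inP[ph' nh'] := hP.
  split; last by rewrite kE hE !dotE -!qnr_dot nf nh'.
  by rewrite LE' kE; have [z [-> _]] := pf; rewrite scale_span; eexists.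
have nz d h' g : (0 < g)%N -> h' \in P' d -> (g%:R : rat) *: h' != 0.
  move=> g0 /inP'[[z [-> gz]] _]; apply/eqP => E.
  have : forall i, (g%:Z * z i) = 0.
    apply: (span_inj (z := fun i => g%:Z * z i) (z' := fun=> 0) fe'); rewrite -scale_span E.
    by rewrite big1// => i _; rewrite mulr0z.
  move=> z0; have zz i : z i = 0.
    by apply/eqP; have /eqP := z0 i; rewrite mulf_eq0 => /orP[/eqP|//]; lia.
  by move: gz; rewrite !big_ord_recl big_ord0 !zz.
move=> h k Lh Lk.
have [[-> ->]|[g [d [h' [g0 hP hE ->]]]]] := hPhi h Lh;
  have [[-> ->]|[g' [d' [k' [g0' kP kE ->]]]]] := hPhi k Lk => //.
- by move=> /esym/eqP; rewrite (negPf (nz _ _ _ g0' ((hf d').1 _ kP))).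
- by move=> /eqP; rewrite (negPf (nz _ _ _ g0 ((hf d).1 _ hP))).
have /inP'[p1 n1] := (hf d).1 _ hP; have /inP'[p2 n2] := (hf d').1 _ kP.
move=> /(content_uniq fe' g0 p1 p2)[gg ff].
have dd : d = d' by apply/eqP; rewrite -(eqr_nat rat) -n1 -n2 ff.
move: hP ff; rewrite dd => hP ff.
by rewrite hE kE gg; congr (_ *: _); exact: ((hf d').2 _ _ hP kP ff).
Qed.

End Domination.

(** * Proportional bases and surjectivity *)

Section Surjectivity.
Variables (p : nat) (a b : rat).
Hypothesis hp : prime p.
Hypotheses (a0 : a < 0) (b0 : b < 0).
Local Notation B := (quat a b).
Implicit Types (L : set B) (u v w : 'I_3 -> B).

Definition fbasis L v : Prop := (forall i, L (v i)) /\
  forall h, L h -> exists z : 'I_3 -> int, h = \sum_i (z i)%:~R *: v i.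

Lemma pl_sum L v (z : 'I_3 -> int) : pure_lattice L -> (forall i, L (v i)) ->
  L (\sum_i (z i)%:~R *: v i).
Proof.
move=> PL Lv; elim/big_ind: _ => [|x y|i _]; [exact: pl0 PL|exact: plD PL _ _|exact: (plZ PL)].
Qed.

Lemma fbasis_unimodular L v (Q : 'M[int]_3) : pure_lattice L -> Q \in unitmx -> fbasis L v ->
  fbasis L (fun i => \sum_j (Q i j)%:~R *: v j).
Proof.
move=> PL Qu [Lv gen]; split; first by move=> i; exact: pl_sum.
move=> h /gen[z ->]; exists (fun i => \sum_k z k * invmx Q k i).
under [RHS]eq_bigr do rewrite scaler_sumr.
rewrite exchange_big /=; apply: eq_bigr => j _.
under eq_bigr do rewrite scalerA.
rewrite -scaler_suml; congr (_ *: _).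
have -> : z j = \sum_k z k * (1%:M : 'M[int]_3) k j.
  rewrite (bigD1 j)//= big1 ?mxE ?eqxx ?mulr1 ?addr0// => k kj.
  by rewrite mxE (negPf kj) mulr0.
rewrite -(mulVmx Qu) -[in RHS](eq_bigr _ (fun i _ => rmorphM _ _ _)) -rmorph_sum.
congr (_%:~R); under eq_bigr do rewrite mxE mulr_sumr.
rewrite exchange_big /=; apply: eq_bigr => i _.
by rewrite mulr_suml; apply: eq_bigr => k _; rewrite mulrA.
Qed.

Let o1 : 'I_3 := lift ord0 ord0.
Let o2 : 'I_3 := lift ord0 (lift ord0 ord0).

Lemma sum3 (V : nmodType) (F : 'I_3 -> V) : \sum_i F i = F ord0 + F o1 + F o2.
Proof. by rewrite !big_ord_recl big_ord0 addr0 addrA. Qed.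

Lemma all3 (P : 'I_3 -> Prop) : P ord0 -> P o1 -> P o2 -> forall i, P i.
Proof.
move=> h0 h1 h2; case=> [[|[|[|//]]] li].
- by rewrite (_ : Ordinal li = ord0)//; exact: val_inj.
- by rewrite (_ : Ordinal li = o1)//; exact: val_inj.
- by rewrite (_ : Ordinal li = o2)//; exact: val_inj.
Qed.

Lemma fbasisP L v : fbasis L v <-> ibasis L (v ord0) (v o1) (v o2).
Proof.
split=> [[Lv gen]|[L0 L1 L2 gen]]; split=> //.
- by move=> h /gen[z ->]; exists (z ord0), (z o1), (z o2); rewrite sum3.
- exact: all3.
- move=> h /gen[z0 [z1 [z2 ->]]]; exists (fun i => [:: z0; z1; z2]`_i).
  by rewrite sum3.
Qed.

Lemma fbasis_sign L v (s : 'I_3 -> int) : pure_lattice L -> (forall i, s i * s i = 1) ->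
  fbasis L v -> fbasis L (fun i => (s i)%:~R *: v i).
Proof.
move=> PL s2 [Lv gen]; split; first by move=> i; exact: plZ.
move=> h /gen[z ->]; exists (fun i => z i * s i); apply: eq_bigr => i _.
by rewrite scalerA -rmorphM -mulrA s2 mulr1.
Qed.

(** Clearing denominators by [m] makes the matrix of L' over L integral, and its Smith form
    diagonalises it by unimodular changes of both bases. Signs go into the basis of L', because
    dilation factors have to be natural numbers. *)
Lemma proportional_bases L L' : gross_facts p L -> gross_facts p L' ->
  exists v w (m : nat) (d : 'I_3 -> nat), [/\ (0 < m)%N, fbasis L v, fbasis L' w &
    forall i, m%:R *: w i = (d i)%:R *: v i].
Proof.
move=> F F'; have PL := gf_pure F; have PL' := gf_pure F'.
have [v0 [v1 [v2 hv]]] := gf_free F; have [w0 [w1 [w2 hw]]] := gf_free F'.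
have t0 := gram3_trip_neq0 hp F hv.
pose v (i : 'I_3) := [:: v0; v1; v2]`_i; pose w (i : 'I_3) := [:: w0; w1; w2]`_i.
have fv : fbasis L v by apply/fbasisP.
have fw : fbasis L' w by apply/fbasisP.
have comb h : L' h -> exists c : 'I_3 -> rat, h = \sum_j c j *: v j.
  move=> L'h; have [[V0 V1 V2 _] ph] := (hv, pl_pure PL' L'h).
  have := trip_expand (pl_pure PL V0) (pl_pure PL V1) (pl_pure PL V2) ph.
  set t := trip v0 v1 v2 => /(congr1 (fun x => t^-1 *: x)).
  rewrite scalerA mulVf// scale1r => ->.
  exists (fun i => t^-1 * [:: trip h v1 v2; trip v0 h v2; trip v0 v1 h]`_i).
  by rewrite sum3 !scalerDr !scalerA.
have /choice[A hA] : forall i, exists c : 'I_3 -> rat, w i = \sum_j c j *: v j.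
  by move=> i; apply: comb; exact: (proj1 fw).
pose m := (\prod_(ij : 'I_3 * 'I_3) `|denq (A ij.1 ij.2)|)%N.
have m0 : (0 < m)%N by rewrite prodn_gt0// => ij; rewrite absz_gt0 denq_eq0.
have /choice[M hM] : forall ij, exists n : int, m%:R * A ij.1 ij.2 = n%:~R.
  move=> ij; rewrite /m (bigD1 ij)//= natrM.
  set k := (\prod_(_ | _) _)%N.
  exists (numq (A ij.1 ij.2) * k%:Z); rewrite rmorphM /= -[in RHS]pmulrn numqE.
  have -> : (denq (A ij.1 ij.2))%:~R = `|denq (A ij.1 ij.2)|%N%:R :> rat.
    by rewrite [in RHS]pmulrn gez0_abs ?denq_ge0.
  ring.
have [P Pu [Q Qu [d _ MPQ]]] := int_Smith_normal_form (\matrix_(i, j) M (i, j)).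
pose v' i := \sum_j (Q i j)%:~R *: v j.
pose w' i := \sum_j (invmx P i j)%:~R *: w j.
have iPu : invmx P \in unitmx by rewrite unitmx_inv.
have fv' : fbasis L v' := fbasis_unimodular PL Qu fv.
have fw' : fbasis L' w' := fbasis_unimodular PL' iPu fw.
have PM : invmx P *m (\matrix_(i, j) M (i, j)) = \matrix_(i, j) (d`_i *+ (i == j)) *m Q.
  by rewrite MPQ -mulmxA mulKmx.
have E (i : 'I_3) : m%:R *: w' i = (d`_i)%:~R *: v' i.
  rewrite /w' /v' !scaler_sumr.
  transitivity (\sum_k ((invmx P *m (\matrix_(i, j) M (i, j))) i k)%:~R *: v k).
    transitivity (\sum_j \sum_k (invmx P i j * M (j, k))%:~R *: v k).
      apply: eq_bigr => j _; rewrite hA !scaler_sumr; apply: eq_bigr => k _.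
      by rewrite !scalerA rmorphM /= -(hM (j, k)) mulrA [m%:R * _]mulrC -!mulrA.
    rewrite exchange_big /=; apply: eq_bigr => k _; rewrite -scaler_suml mxE rmorph_sum.
    by congr (_ *: _); apply: eq_bigr => j _; rewrite mxE.
  rewrite PM; apply: eq_bigr => k _; rewrite scalerA -rmorphM; congr (_%:~R *: _).
  rewrite mxE (bigD1 i)//= big1 ?addr0 ?mxE ?eqxx ?mulr1n// => j ji.
  by rewrite mxE eq_sym (negPf ji) mulr0n mul0r.
pose s (i : 'I_3) : int := if 0 <= d`_i then 1 else -1.
exists v', (fun i => (s i)%:~R *: w' i), m, (fun i : 'I_3 => absz (d`_i)); split=> //.
  by apply: (fbasis_sign PL') => // i; rewrite /s; case: ifP.
move=> i; rewrite scalerA mulrC -scalerA E scalerA; congr (_ *: _).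
rewrite -rmorphM [RHS]pmulrn; congr (_%:~R); rewrite /s; case: ifP; lia.
Qed.

Lemma norm_injection_surj L L' (Phi : B -> B) : gross_facts p L -> gross_facts p L' ->
  (forall h, L h -> L' (Phi h) /\ dot (Phi h) (Phi h) = dot h h) ->
  (forall h k, L h -> L k -> Phi h = Phi k -> h = k) ->
  forall h', L' h' -> exists2 h, L h & Phi h = h'.
Proof.
move=> F F' hPhi iPhi.
have PL := gf_pure F; have PL' := gf_pure F'.
have [v [w [m [d [m0 fv fw E]]]]] := proportional_bases F F'.
have mn0 : m%:R != 0 :> rat by rewrite pnatr_eq0 -lt0n.
have hv := (fbasisP L v).1 fv; have hw := (fbasisP L' w).1 fw.
have tv := gram3_trip_neq0 hp F hv; have tw := gram3_trip_neq0 hp F' hw.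
have [Lv genv] := fv; have [Lw genw] := fw.
have qv i : qre (v i) = 0 := pl_pure PL (Lv i).
have qw i : qre (w i) = 0 := pl_pure PL' (Lw i).
have wE i : w i = ((d i)%:R / m%:R) *: v i.
  have := congr1 (fun x => m%:R^-1 *: x) (E i).
  by rewrite /= !scalerA mulVf// scale1r mulrC.
have d0 i : (0 < d i)%N.
  rewrite lt0n; apply: contra tw => /eqP di; have wi : w i = 0 by rewrite wE di mul0r scale0r.
  suff : forall k, w k = 0 -> trip (w ord0) (w o1) (w o2) = 0 by move=> /(_ i wi) ->.
  by apply: all3 => ->; rewrite /trip /=; ring.
pose c i : rat := (d i)%:R / m%:R.
have c0 i : 0 < c i by rewrite divr_gt0// ltr0n.
have tc : trip (w ord0) (w o1) (w o2) = (c ord0 * c o1 * c o2) * trip (v ord0) (v o1) (v o2).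
  by rewrite !wE /c /trip /=; ring.
(* Both Gram determinants are 4 p ^ 2, so the product of the ratios has square 1, and the ratios are
   positive. *)
have c1 : c ord0 * c o1 * c o2 = 1.
  have := gf_gram3 F' hw; rewrite -(gf_gram3 F hv) !gram3_trip// tc.
  set C := c ord0 * c o1 * c o2; set t := trip _ _ _ in tv *.
  have C0 : 0 < C by apply: mulr_gt0; [apply: mulr_gt0; exact: c0|exact: c0].
  have nz : (a * b * t) ^+ 2 != 0.
    by rewrite expf_neq0//; apply: (mulf_neq0 _ tv); apply: mulf_neq0; rewrite ?(lt_eqF a0) ?(lt_eqF b0).
  have -> : (a * b * (C * t)) ^+ 2 = C ^+ 2 * (a * b * t) ^+ 2 by ring.
  rewrite -[RHS]mul1r => /(mulIf nz)/eqP; rewrite sqrf_eq1 => /orP[/eqP//|/eqP C1].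
  by move: C0; rewrite C1 oppr_gt0 ltr10.
have gv := qform3_good a0 b0 (qv ord0) (qv o1) (qv o2) tv.
have gw := qform3_good a0 b0 (qw ord0) (qw o1) (qw o2) tw.
have := lattice_sum_scale3 (d0 ord0) m0 (d0 o1) m0 (d0 o2) m0 gv c1.
have -> : (fun x y z => qform3 (v ord0) (v o1) (v o2) ((d ord0)%:R / m%:R * x)
    ((d o1)%:R / m%:R * y) ((d o2)%:R / m%:R * z)) = qform3 (w ord0) (w o1) (w o2).
  apply/funext => x; apply/funext => y; apply/funext => z.
  by rewrite /qform3 /comb3 !wE !scalerA ![_ / _ * _]mulrC.
move=> cl.
pose V (q : int * int * int) := icomb3 (v ord0) (v o1) (v o2) q.1.1 q.1.2 q.2.
pose W (q : int * int * int) := icomb3 (w ord0) (w o1) (w o2) q.1.1 q.1.2 q.2.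
have LV q : L (V q) by rewrite /V /icomb3; do !apply: (plD PL); apply: (plZ PL).
have genW h : L' h -> exists q, h = W q.
  by move=> /genw[z ->]; exists ((z ord0, z o1), z o2); rewrite sum3.
have /choice[f hf] : forall q, exists q', Phi (V q) = W q'.
  by move=> q; apply: genW; exact: (hPhi _ (LV q)).1.
have Vinj : injective V.
  move=> [[x1 x2] x3] [[y1 y2] y3] VE.
  have [_ e1 e2 e3] : [/\ (0 : rat) = 0, x1%:~R = y1%:~R :> rat, x2%:~R = y2%:~R :> rat & x3%:~R = y3%:~R :> rat].
    apply: (comb4_inj tv); rewrite /comb4 !scale0r !add0r; exact: VE.
  by rewrite (intr_inj e1) (intr_inj e2) (intr_inj e3).
have fI : injective f.
  move=> q q' fq; apply: Vinj; apply: iPhi => //; by rewrite !hf fq.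
have fQ q : qform3 (w ord0) (w o1) (w o2) (f q).1.1%:~R (f q).1.2%:~R (f q).2%:~R =
    qform3 (v ord0) (v o1) (v o2) q.1.1%:~R q.1.2%:~R q.2%:~R.
  transitivity (dot (W (f q)) (W (f q))); first by [].
  by rewrite -hf (hPhi _ (LV q)).2.
have surj := lattice_rigidity gw cl fI fQ.
move=> h' /genW[q' ->]; have [q fq] := surj q'.
by exists (V q); rewrite ?hf ?fq.
Qed.
End Surjectivity.

(** * Recovering the Gram matrix *)

Lemma fset_inj_surj (T : choiceType) (S : {fset T}) (g : T -> T) :
  {in S, forall x, g x \in S} -> {in S &, injective g} ->
  forall y, y \in S -> exists2 x, x \in S & g x = y.
Proof.
move=> gS gI y yS.
have sub : ([fset g x | x in S] `<=` S)%fset.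
  by apply/fsubsetP => _ /imfsetP[x /= xS ->]; exact: gS.
have : ([fset g x | x in S] = S)%fset.
  by apply/eqP; rewrite eqEfcard sub /= card_in_imfset.
by move=> E; move: yS; rewrite -{1}E => /imfsetP[x /= xS ->]; exists x.
Qed.

(** t - t' and t + t' are even, and p divides the product of their halves. Both halves are below p
    in absolute value, so one of them is 0. *)
Lemma sqr_mod_unique (p : nat) (t t' m : int) : prime p -> `|t| < p%:Z -> `|t'| < p%:Z ->
  t ^+ 2 - t' ^+ 2 = 4 * p%:Z * m -> t' = t \/ t' = - t.
Proof.
move=> hp ht ht' E.
have [x [y [ex ey]]] : exists x y : int, t - t' = 2 * x /\ t + t' = 2 * y.
  have d : (2 %| t - t')%Z.
    have : (2%:Z %| (t - t') * (t + t'))%Z.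
      have -> : (t - t') * (t + t') = 2 * (2 * p%:Z * m) by rewrite -subr_sqr E; ring.
      exact: dvdz_mulr.
    rewrite dvdzE abszM Euclid_dvdM// => /orP[//|h].
    have -> : t - t' = (t + t') - 2 * t' by ring.
    by apply: rpredB; [exact: h|exact: dvdz_mulr].
  have [x ex] := dvdzP d.
  exists x, (x + t'); split; first by rewrite ex mulrC.
  by rewrite mulrDr [2 * x]mulrC -ex; ring.
have p0 : p%:Z != 0 by have := prime_gt0 hp; lia.
have xy : x * y = p%:Z * m.
  have : 4 * (x * y) = 4 * (p%:Z * m).
    by rewrite !mulrA -E subr_sqr ex ey; ring.
  by lia.
have : (p%:Z %| x * y)%Z by rewrite xy; exact: dvdz_mulr.
rewrite dvdzE abszM Euclid_dvdM// => /orP[d|d].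
  have : `|x|%N = 0%N.
    apply/eqP; rewrite -leqn0 leqNgt; apply/negP => x0.
    by have := dvdn_leq x0 d; lia.
  by left; lia.
have : `|y|%N = 0%N.
  apply/eqP; rewrite -leqn0 leqNgt; apply/negP => x0.
  by have := dvdn_leq x0 d; lia.
by right; lia.
Qed.

(* The variables are the off-diagonal entries of two Gram matrices with the same
   diagonal; equality of the products is equality of the determinants. *)
Lemma sign_match (x y z x' y' z' : rat) :
  x' = x \/ x' = - x -> y' = y \/ y' = - y -> z' = z \/ z' = - z ->
  x' * y' * z' = x * y * z ->
  exists e2 e3 : rat, [/\ e2 = 1 \/ e2 = - 1, e3 = 1 \/ e3 = - 1,
    x = e2 * x', y = e3 * y' & z = e2 * e3 * z'].
Proof.
have sg (u u' : rat) : u' = u \/ u' = - u -> exists s : rat, (s = 1 \/ s = - 1) /\ u = s * u'.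
  by move=> [->|->]; [exists 1|exists (-1)]; rewrite ?mul1r ?mulN1r ?opprK; split=> //; [left|right].
have sM (s t : rat) : s = 1 \/ s = - 1 -> t = 1 \/ t = - 1 -> s * t = 1 \/ s * t = - 1.
  by move=> [->|->] [->|->]; rewrite ?mul1r ?mulN1r ?opprK; auto.
have s2 (s : rat) : s = 1 \/ s = - 1 -> s * s = 1 by move=> [->|->]; rewrite ?mulN1r ?opprK ?mul1r.
move=> /sg[r [r1 xE]] /sg[s [s1 yE]] /sg[t [t1 zE]] det.
(* A zero entry leaves its sign free, and that sign is chosen so that the three signs multiply to 1;
   when no entry vanishes, the determinant forces this. *)
have [x0|x0] := eqVneq x' 0.
  exists (t * s), s; split; [exact: sM|done|by rewrite xE x0 !mulr0|done|].
  by rewrite zE -(mulrA t s s) (s2 s s1) mulr1.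
have [y0|y0] := eqVneq y' 0.
  exists r, (r * t); split; [done|exact: sM|done|by rewrite yE y0 !mulr0|].
  by rewrite mulrA (s2 r r1) mul1r.
have [z0|z0] := eqVneq z' 0.
  by exists r, s; split=> //; rewrite zE z0 !mulr0.
exists r, s; split=> //.
have rst : r * s * t = 1.
  apply: (mulIf (mulf_neq0 (mulf_neq0 x0 y0) z0)); rewrite mul1r [RHS]det xE yE zE; ring.
have rsE : r * s = t by rewrite -[LHS]mulr1 -(s2 t t1) mulrA rst mul1r.
by rewrite rsE.
Qed.

Section GramMatch.
Variables (p : nat) (a b : rat).
Hypothesis hp : prime p.
Hypotheses (a0 : a < 0) (b0 : b < 0).
Local Notation B := (quat a b).
Implicit Types (L : set B) (h : B).

Definition norm_injection L L' (Phi : B -> B) : Prop :=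
  (forall h, L h -> L' (Phi h) /\ dot (Phi h) (Phi h) = dot h h) /\
  (forall h k, L h -> L k -> Phi h = Phi k -> h = k).

(** [theta \o Phi] is an injective self-map of the finite set of vectors of L of norm at most n,
    hence onto. This refutes a larger minimum in L': its short vectors would span too little, and
    [theta] would have too small an image. *)
Lemma norm_injection_count L L' Phi (theta : B -> B) (n : nat) h0 :
  gross_facts p L -> norm_injection L L' Phi ->
  (forall h, L' h -> dot h h <= n%:R -> L (theta h) /\ dot (theta h) (theta h) = dot h h) ->
  (forall h k, L' h -> dot h h <= n%:R -> L' k -> dot k k <= n%:R -> theta h = theta k -> h = k) ->
  L h0 -> dot h0 h0 <= n%:R -> exists h, [/\ L' h, dot h h <= n%:R & theta h = h0].
Proof.
move=> F [hPhi iPhi] ht it Lh0 h0n.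
have [u1 [u2 [u3 hu]]] := gf_free F; have [L1 L2 L3 _] := hu; have PL := gf_pure F.
have t0 := gram3_trip_neq0 hp F hu.
have fin := norm_finite a0 b0 (pl_pure PL L1) (pl_pure PL L2) (pl_pure PL L3) t0 n hu.
set A := [set h | L h /\ dot h h <= n%:R] in fin.
have inS h : h \in fset_set A <-> L h /\ dot h h <= n%:R.
  by rewrite in_fset_set//; split=> [/set_mem|/mem_set].
have [|||h /inS[Lh hn] hE] := @fset_inj_surj _ (fset_set A) (theta \o Phi) _ _ h0.
- move=> h /inS[Lh hn]; apply/inS => /=; have [L'h dh] := hPhi h Lh.
  by rewrite -dh in hn *; have [? ->] := ht _ L'h hn; split; rewrite // -dh.
- move=> h k /inS[Lh hn] /inS[Lk kn] /= E; have [L'h dh] := hPhi h Lh; have [L'k dk] := hPhi k Lk.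
  by apply: iPhi => //; apply: it => //; rewrite ?dh ?dk.
- by apply/inS.
by have [L'h dh] := hPhi h Lh; exists (Phi h); split; rewrite ?dh.
Qed.

Section Minima.
Variables (L L' : set B) (Phi : B -> B) (u1 u2 u3 w1 w2 w3 : B).
Hypotheses (F : gross_facts p L) (F' : gross_facts p L').
Hypothesis inj : norm_injection L L' Phi.
Hypotheses (U : minimal_triple L u1 u2 u3) (W : minimal_triple L' w1 w2 w3).

Let PL := gf_pure F.
Let PL' := gf_pure F'.

Lemma min1_le : dot w1 w1 <= dot u1 u1.
Proof.
have [L'u <-] := inj.1 _ (mt_in1 U); apply: (mt_min1 W) => //.
apply: contraTneq (dot_gt0 a0 b0 (mt_neq0 U)) => E.
by have [_ <-] := inj.1 _ (mt_in1 U); rewrite E dot0l ltxx.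
Qed.

Let coords : exists c : B -> int * int * int,
  forall h, L' h -> h = icomb3 w1 w2 w3 (c h).1.1 (c h).1.2 (c h).2.
Proof.
have /choice[c hc] : forall h, exists q : int * int * int, L' h -> h = icomb3 w1 w2 w3 q.1.1 q.1.2 q.2.
  move=> h; have [Lh|nLh] := pselect (L' h); last by exists ((0, 0), 0).
  have [_ _ _ /(_ h Lh)[z1 [z2 [z3 hE]]]] := gf_ibasis F' W.
  by exists ((z1, z2), z3).
by exists c.
Qed.

Let twn0 : trip w1 w2 w3 != 0 := mt_trip W.

(** If the second minimum of L' were larger, its vectors of norm at most that of u2 would lie on the
    line of w1. They map isometrically to the line of u1, and by counting u2 would lie there. *)
Lemma min2_le : dot u1 u1 = dot w1 w1 -> dot w2 w2 <= dot u2 u2.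
Proof.
move=> d1; rewrite leNgt; apply/negP => lt2.
have [c hc] := coords; have [n un] := pl_nat PL (mt_in2 U).
have red h : L' h -> dot h h <= n%:R -> h = (c h).1.1%:~R *: w1.
  move=> L'h hn.
  have g0 : gram2 w1 h = 0.
    apply: contrapT => /eqP /(mt_min2 W L'h) h2.
    by have := lt_le_trans lt2 (le_trans h2 hn); rewrite un ltxx.
  have := gram2_eq0 a0 b0 (mt_neq0 W) g0; set x := _ / _ => hx.
  have := hc h L'h; rewrite {1}hx => E.
  have [_ -> _ _] : [/\ (0 : rat) = 0, (c h).1.1%:~R = x :> rat, (c h).1.2%:~R = 0 :> rat & (c h).2%:~R = 0 :> rat].
    apply: (comb4_inj twn0); rewrite /comb4 !scale0r !add0r !addr0; exact: esym E.
  exact: hx.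
have [||||h [L'h hn hE]] := @norm_injection_count L L' Phi (fun h => (c h).1.1%:~R *: u1) n u2 F inj.
- move=> h L'h hn; split; first exact: (plZ PL _ (mt_in1 U)).
  by rewrite [in RHS](red h L'h hn) !dotE d1.
- move=> h k L'h hn L'k kn /eqP; rewrite -subr_eq0 -scalerBl scaler_eq0 (negPf (mt_neq0 U)) orbF subr_eq0.
  by move=> /eqP E; rewrite (red h)// (red k)// E.
- exact: mt_in2 U.
- by rewrite un.
by have := mt_gram2 U; rewrite -hE gram2Z eqxx.
Qed.

(** The counting argument of [min2_le] one dimension up; the sign s makes the planes of the first
    two minimal vectors isometric. *)
Lemma min3_le (s : int) : s * s = 1 -> dot u1 u1 = dot w1 w1 -> dot u2 u2 = dot w2 w2 ->
  dot w1 w2 = s%:~R * dot u1 u2 -> dot w3 w3 <= dot u3 u3.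
Proof.
move=> s2 d1 d2 t12; rewrite leNgt; apply/negP => lt3.
have [c hc] := coords; have [n un] := pl_nat PL (mt_in3 U).
have red h : L' h -> dot h h <= n%:R -> h = (c h).1.1%:~R *: w1 + (c h).1.2%:~R *: w2.
  move=> L'h hn.
  have g0 : trip w1 w2 h = 0.
    apply: contrapT => /eqP /(mt_min3 W L'h) h2.
    by have := lt_le_trans lt3 (le_trans h2 hn); rewrite un ltxx.
  have E := hc h L'h.
  have c3 : (c h).2%:~R = 0 :> rat.
    have := congr1 (trip w1 w2) E; rewrite g0 /icomb3.
    have -> (x y z : rat) : trip w1 w2 (x *: w1 + y *: w2 + z *: w3) = z * trip w1 w2 w3.
      by rewrite /trip /=; ring.
    by move=> /esym/eqP; rewrite mulf_eq0 (negPf twn0) orbF => /eqP.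
  by rewrite {1}E /icomb3 c3 scale0r addr0.
have dE (z1 z2 : rat) : dot (z1 *: u1 + (s%:~R * z2) *: u2) (z1 *: u1 + (s%:~R * z2) *: u2) =
    dot (z1 *: w1 + z2 *: w2) (z1 *: w1 + z2 *: w2).
  have s2r : s%:~R * s%:~R = 1 :> rat by rewrite -rmorphM s2.
  rewrite !dotE (dotC u2 u1) (dotC w2 w1) t12 d1 d2.
  transitivity (z1 ^+ 2 * dot w1 w1 + 2 * z1 * (s%:~R * z2) * dot u1 u2 + (s%:~R * s%:~R) * z2 ^+ 2 * dot w2 w2).
    ring.
  by rewrite s2r; ring.
have [||||h [L'h hn hE]] := @norm_injection_count L L' Phi
    (fun h => (c h).1.1%:~R *: u1 + (s%:~R * (c h).1.2%:~R) *: u2) n u3 F inj.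
- move=> h L'h hn; split; last by rewrite dE -red.
  by apply: (plD PL); [exact: (plZ PL _ (mt_in1 U))|rewrite -rmorphM; exact: (plZ PL _ (mt_in2 U))].
- move=> h k L'h hn L'k kn E; rewrite (red h)// (red k)//.
  have [_ -> e2 _] : [/\ (0 : rat) = 0, (c h).1.1%:~R = (c k).1.1%:~R :> rat,
     s%:~R * (c h).1.2%:~R = s%:~R * (c k).1.2%:~R :> rat & (0 : rat) = 0].
    by apply: (comb4_inj (mt_trip U)); rewrite /comb4 !scale0r !add0r !addr0.
  have s0 : s%:~R != 0 :> rat by rewrite intr_eq0; apply: contra_eq_neq s2 => ->.
  by rewrite (mulfI s0 e2).
- exact: mt_in3 U.
- by rewrite un.
have := mt_trip U; rewrite -hE /trip /= => /eqP; apply; ring.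
Qed.

End Minima.

(** Integral norms make t = 2 [dot h k] an integer; its square is 4 (n1 n2 - [gram2 h k]), so t is
    even. *)
Lemma dot_int L h k : gross_facts p L -> L h -> L k -> exists t : int, dot h k = t%:~R.
Proof.
move=> F Lh Lk; have PL := gf_pure F.
have [n1 e1] := pl_nat PL Lh; have [n2 e2] := pl_nat PL Lk.
have [n3 e3] := pl_nat PL (plD PL Lh Lk); have [m em] := gf_gram2 F Lh Lk.
pose t : int := n3%:Z - n1%:Z - n2%:Z.
have tE : 2 * dot h k = t%:~R.
  by move: e3; rewrite !dotE (dotC k h) e1 e2 /t !rmorphB /= -!pmulrn => <-; ring.
have t2 : t ^+ 2 = 4 * (n1%:Z * n2%:Z - 4 * p%:Z * m).
  apply: (@intr_inj rat); rewrite rmorphXn /= -tE [in RHS]rmorphM [in RHS]rmorphB /= -em /gram2 e1 e2.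
  by rewrite rmorphM /= -!pmulrn; ring.
have : (2%:Z %| t)%Z.
  have : (2%:Z %| t * t)%Z.
    by rewrite -expr2 t2 [4](_ : _ = 2 * 2)// -mulrA; exact: dvdz_mulr.
  by rewrite !dvdzE abszM Euclid_dvdM// orbb.
move=> /dvdzP[x tx]; exists x; apply: (@mulfI _ (2 : rat)); first by [].
by rewrite tE tx rmorphM /= mulrC.
Qed.

Lemma dot_sign L L' h k h' k' : gross_facts p L -> gross_facts p L' -> L h -> L k -> L' h' -> L' k' ->
  dot h' h' = dot h h -> dot k' k' = dot k k -> `|dot h k| < p%:R -> `|dot h' k'| < p%:R ->
  exists s : int, s * s = 1 /\ dot h' k' = s%:~R * dot h k.
Proof.
move=> F F' Lh Lk L'h L'k eh ek.
have [t et] := dot_int F Lh Lk; have [t' et'] := dot_int F' L'h L'k.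
have [m em] := gf_gram2 F Lh Lk; have [m' em'] := gf_gram2 F' L'h L'k.
rewrite et et' !pmulrn -!intr_norm !ltr_int => lt lt'.
have E : t ^+ 2 - t' ^+ 2 = 4 * p%:Z * (m' - m).
  apply: (@intr_inj rat); rewrite mulrBr !rmorphB /= -em -em' !rmorphXn /= -et -et' /gram2 eh ek; ring.
have [->|->] := sqr_mod_unique hp lt lt' E; first by exists 1; rewrite !mul1r.
by exists (- 1); rewrite !mulN1r opprK rmorphN.
Qed.

(** D2 >= 2 p would give 3 D1 D2 D3 >= 36 p ^ 2, above the bound 32 p ^ 2 of Hermite's inequality.
    So D2 < 2 p, and each off-diagonal entry is at most D2 / 2. *)
Lemma mt_small L u1 u2 u3 : gross_facts p L -> minimal_triple L u1 u2 u3 ->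
  [/\ `|dot u1 u2| < p%:R, `|dot u1 u3| < p%:R & `|dot u2 u3| < p%:R].
Proof.
move=> F U; have PL := gf_pure F.
have D1 := gf_ge3 F (mt_in1 U) (mt_neq0 U).
have D12 := mt_D12 U; have D23 := mt_D23 a0 b0 PL U.
have T12 := mt_T12 a0 b0 PL U; have T13 := mt_T13 a0 b0 PL U; have T23 := mt_T23 a0 b0 PL U.
have := mt_hermite a0 b0 PL U; rewrite (gf_gram3 F (gf_ibasis F U)).
have p0 : 0 < p%:R :> rat by rewrite ltr0n prime_gt0.
move: T12 T13 T23 D1 D12 D23; rewrite !normrM (_ : `|2| = 2 :> rat)//.
move: (dot u1 u1) (dot u2 u2) (dot u3 u3) (`|dot u1 u2|) (`|dot u1 u3|) (`|dot u2 u3|) => d1 d2 d3 t12 t13 t23.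
move: (p%:R : rat) p0 => q q0 T12 T13 T23 D1 D12 D23 H.
have d2q : d2 < 2 * q.
  rewrite ltNge; apply/negP => h.
  have e0 : (2 * q) * (2 * q) <= d2 * d3.
    by apply: ler_pM; [lra|lra|exact: h|exact: le_trans h D23].
  have e1 : 3 * ((2 * q) * (2 * q)) <= d1 * (d2 * d3).
    apply: ler_pM => //; first by apply: mulr_ge0; lra.
  have : 0 < q * q by apply: mulr_gt0.
  move: H e1; rewrite expr2 !mulrA; lra.
by split; lra.
Qed.

Lemma norm_injection_inverse L L' Phi : gross_facts p L -> gross_facts p L' ->
  norm_injection L L' Phi -> exists Psi, norm_injection L' L Psi.
Proof.
move=> F F' [hPhi iPhi].
have surj := norm_injection_surj hp a0 b0 F F' hPhi iPhi.
have /choice[Psi hPsi] : forall h', exists h, L' h' -> L h /\ Phi h = h'.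
  move=> h'; have [L'h|nL'h] := pselect (L' h'); last by exists 0.
  by have [h Lh hE] := surj h' L'h; exists h.
exists Psi; split.
  move=> h' L'h; have [Lh hE] := hPsi h' L'h; split=> //.
  by rewrite -{3 4}hE (hPhi _ Lh).2.
by move=> h k L'h L'k E; rewrite -(hPsi h L'h).2 -(hPsi k L'k).2 E.
Qed.

Definition same_gram (u1 u2 u3 w1 w2 w3 : B) : Prop :=
  [/\ dot w1 w1 = dot u1 u1, dot w2 w2 = dot u2 u2 & dot w3 w3 = dot u3 u3] /\
  [/\ dot w1 w2 = dot u1 u2, dot w1 w3 = dot u1 u3 & dot w2 w3 = dot u2 u3].

Lemma ibasis_sign L u1 u2 u3 (s t : int) : pure_lattice L -> s * s = 1 -> t * t = 1 ->
  ibasis L u1 u2 u3 -> ibasis L u1 (s%:~R *: u2) (t%:~R *: u3).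
Proof.
move=> PL s2 t2 [L1 L2 L3 gen]; split; [exact: L1|exact: plZ|exact: plZ|].
move=> h /gen[z1 [z2 [z3 ->]]]; exists z1, (z2 * s), (z3 * t); rewrite /icomb3.
by rewrite !scalerA -!rmorphM -!mulrA s2 t2 !mulr1.
Qed.

Lemma gram_match L L' Phi : gross_facts p L -> gross_facts p L' -> norm_injection L L' Phi ->
  exists u1 u2 u3 w1 w2 w3,
    [/\ ibasis L u1 u2 u3, ibasis L' w1 w2 w3 & same_gram u1 u2 u3 w1 w2 w3].
Proof.
move=> F F' inj; have [Psi inj'] := norm_injection_inverse F F' inj.
have PL := gf_pure F; have PL' := gf_pure F'.
have [u1 [u2 [u3 U]]] := minimal_triple_exists a0 b0 PL.
have [w1 [w2 [w3 W]]] := minimal_triple_exists a0 b0 PL'.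
have [b12 b13 b23] := mt_small F U; have [c12 c13 c23] := mt_small F' W.
have d1 : dot w1 w1 = dot u1 u1.
  by apply: le_anti; rewrite (min1_le inj U W) (min1_le inj' W U).
have d2 : dot w2 w2 = dot u2 u2.
  by apply: le_anti; rewrite (min2_le F F' inj U W)// (min2_le F' F inj' W U).
have sgn := fun h k h' k' => @dot_sign L L' h k h' k' F F'.
have [s [s2 e12]] := sgn _ _ _ _ (mt_in1 U) (mt_in2 U) (mt_in1 W) (mt_in2 W) d1 d2 b12 c12.
(* The third minima can be compared only now: [min3_le] needs the first two minimal vectors to be
   matched up to sign. *)
have d3 : dot w3 w3 = dot u3 u3.
  apply: le_anti; rewrite (min3_le F F' inj U W s2)// (min3_le F' F inj' W U s2)//.
  by rewrite e12 mulrA -rmorphM s2 mul1r.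
have [t [t2 e13]] := sgn _ _ _ _ (mt_in1 U) (mt_in3 U) (mt_in1 W) (mt_in3 W) d1 d3 b13 c13.
have [r [r2 e23]] := sgn _ _ _ _ (mt_in2 U) (mt_in3 U) (mt_in2 W) (mt_in3 W) d2 d3 b23 c23.
have pm (z : int) (x y : rat) : z * z = 1 -> x = z%:~R * y -> x = y \/ x = - y.
  move=> z2 ->; have /pred2P[->|->] : (z == 1) || (z == -1) by rewrite -sqrf_eq1 expr2 z2.
    by left; rewrite mul1r.
  by right; rewrite mulN1r.
have det : dot w1 w2 * dot w1 w3 * dot w2 w3 = dot u1 u2 * dot u1 u3 * dot u2 u3.
  have := gf_gram3 F' (gf_ibasis F' W); rewrite -(gf_gram3 F (gf_ibasis F U)) /gram3 d1 d2 d3.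
  have sq (z : int) (x y : rat) : z * z = 1 -> x = z%:~R * y -> x ^+ 2 = y ^+ 2.
    by move=> z2 ->; rewrite exprMn expr2 -rmorphM z2 mul1r.
  rewrite (sq _ _ _ s2 e12) (sq _ _ _ t2 e13) (sq _ _ _ r2 e23); lra.
have [e2 [e3 [he2 he3 E12 E13 E23]]] := sign_match (pm _ _ _ s2 e12) (pm _ _ _ t2 e13) (pm _ _ _ r2 e23) det.
have toint (e : rat) : e = 1 \/ e = -1 -> exists z : int, z * z = 1 /\ e = z%:~R.
  by move=> [->|->]; [exists 1|exists (-1)]; rewrite ?rmorphN.
have [z2 [z22 z2E]] := toint _ he2; have [z3 [z33 z3E]] := toint _ he3.
exists u1, u2, u3, w1, (z2%:~R *: w2), (z3%:~R *: w3); split.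
- exact: (gf_ibasis F U).
- exact: (ibasis_sign PL' z22 z33 (gf_ibasis F' W)).
have sq (z : int) (x : rat) : z * z = 1 -> z%:~R * (z%:~R * x) = x.
  by move=> z2'; rewrite mulrA -rmorphM z2' mul1r.
rewrite /same_gram !dotE !sq//; split=> //; split.
- by rewrite E12 z2E.
- by rewrite E13 z3E.
- by rewrite E23 z2E z3E; ring.
Qed.
End GramMatch.

(** * From isometry to conjugation *)
Section Conjugation.
Variables (a b : rat).
Hypotheses (a0 : a < 0) (b0 : b < 0).
Local Notation B := (quat a b).
Implicit Types (x y h c I J K u w : B) (O : set B).

Let i_ : B := Quat a b 0 1 0 0.
Let j_ : B := Quat a b 0 0 1 0.
Let k_ : B := Quat a b 0 0 0 1.

Let an : a != 0. Proof. by rewrite lt_eqF. Qed.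
Let bn : b != 0. Proof. by rewrite lt_eqF. Qed.

Lemma quat_unit_neq0 x : x != 0 -> x \is a GRing.unit.
Proof. exact: dot_neq0. Qed.

Lemma pure_anticomm x y : qre x = 0 -> qre y = 0 -> x * y + y * x = (- 2 * dot x y)%:A.
Proof. by move=> hx hy; apply: quat_eq; rewrite /dot /= hx hy; ring. Qed.

Lemma pure_sqr x : qre x = 0 -> x * x = (- dot x x)%:A.
Proof. by move=> hx; apply: quat_eq; rewrite /dot /= hx; ring. Qed.

(* Averaging over the basis 1, i, j, k intertwines two embeddings of the algebra. *)
Definition average I J K x : B :=
  x + a^-1 *: (i_ * x * I) + b^-1 *: (j_ * x * J) - (a * b)^-1 *: (k_ * x * K).

(** It follows that the averages of 1, i, j, k are not all zero. *)
Lemma average_sum I J K : average I J K 1 + a^-1 *: (i_ * average I J K i_)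
  + b^-1 *: (j_ * average I J K j_) - (a * b)^-1 *: (k_ * average I J K k_) = 4%:A.
Proof. by apply: quat_eq; rewrite /average /=; field; rewrite an bn. Qed.

Lemma average_intertwines I J x : I * I = a%:A -> J * J = b%:A -> I * J = - (J * I) ->
  i_ * average I J (I * J) x = average I J (I * J) x * I /\
  j_ * average I J (I * J) x = average I J (I * J) x * J.
Proof.
move=> I2 J2 IJ.
have EI : i_ * average I J (I * J) x - average I J (I * J) x * I =
    - (a^-1 *: (i_ * x * (I * I - a%:A))) - b^-1 *: (j_ * x * (I * J + J * I))
    + (a * b)^-1 *: (k_ * x * ((I * J + J * I) * I - J * (I * I - a%:A))).
  by apply: quat_eq; rewrite /average /=; field; rewrite an bn.
have EJ : j_ * average I J (I * J) x - average I J (I * J) x * J =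
    - (b^-1 *: (j_ * x * (J * J - b%:A))) + (a * b)^-1 *: (k_ * x * (I * (J * J - b%:A))).
  by apply: quat_eq; rewrite /average /=; field; rewrite an bn.
split; apply/eqP; rewrite -subr_eq0; apply/eqP.
  by rewrite EI I2 IJ !subrr addNr !(mulr0, mul0r, subr0, scaler0, oppr0, addr0).
by rewrite EJ J2 !subrr !(mulr0, mul0r, subr0, scaler0, oppr0, addr0).
Qed.

Lemma intertwiner I J : I * I = a%:A -> J * J = b%:A -> I * J = - (J * I) ->
  exists c, [/\ c != 0, i_ * c = c * I & j_ * c = c * J].
Proof.
move=> I2 J2 IJ; have H x := average_intertwines x I2 J2 IJ.
suff [x xn] : exists x, average I J (I * J) x != 0.
  by have [hi hj] := H x; exists (average I J (I * J) x).
apply: contrapT => none; have Z x : average I J (I * J) x = 0.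
  by apply/eqP; apply: contrapT => /negP xn; apply: none; exists x.
have := average_sum I J (I * J); rewrite !Z !mulr0 !scaler0 subr0 !addr0.
by move=> /(congr1 (@qre _ a b)) /=; lra.
Qed.

(** [K] anticommutes with [I] and [J], so it commutes with [I * J]. Commuting pure quaternions are
    proportional, and equal norms leave only the sign, which is the orientation. *)
Lemma orthogonal_frame I J K : qre I = 0 -> qre J = 0 -> qre K = 0 ->
  dot I I = - a -> dot J J = - b -> dot K K = a * b ->
  dot I J = 0 -> dot I K = 0 -> dot J K = 0 ->
  I * J = - (J * I) /\ (K = I * J \/ K = - (I * J)).
Proof.
move=> hI hJ hK dI dJ dK dIJ dIK dJK.
have anti x y : qre x = 0 -> qre y = 0 -> dot x y = 0 -> x * y = - (y * x).
  move=> hx hy dxy; apply/eqP; rewrite -addr_eq0 (pure_anticomm hx hy) dxy mulr0.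
  by rewrite scale0r.
have IJ := anti _ _ hI hJ dIJ; split=> //.
have M0 : qre (I * J) = 0.
  by have := dIJ; rewrite /dot /= hI hJ; lra.
have comm : K * (I * J) = I * J * K.
  rewrite mulrA (anti _ _ hK hI) 1?dotC// mulNr.
  by rewrite -(mulrA I K J) (anti _ _ hK hJ) 1?dotC// mulrN opprK mulrA.
have dM : dot (I * J) (I * J) = a * b by rewrite -qnr_dot qnrM !qnr_dot dI dJ mulrNN.
have g0 : gram2 (I * J) K = 0.
  have := trip_comm M0 hK; rewrite comm subrr /trip /= => h.
  by apply: (@mulfI _ (2 : rat)) => //; rewrite -h; ring.
have ab0 : a * b != 0 by rewrite mulf_neq0.
have Mn : I * J != 0 by apply: contraNneq ab0 => M; rewrite -dM M dot0l.
have := gram2_eq0 a0 b0 Mn g0; set t := _ / _ => KE.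
have : t ^+ 2 = 1.
  apply: (mulIf ab0); rewrite mul1r -{2}dK KE dotZl dotZr dM; ring.
move=> /eqP; rewrite sqrf_eq1 => /orP[] /eqP tE; rewrite KE tE.
  by left; rewrite scale1r.
by right; rewrite scaleN1r.
Qed.

Lemma isometry_conj u1 u2 u3 w1 w2 w3 : trip u1 u2 u3 != 0 ->
  qre u1 = 0 -> qre u2 = 0 -> qre u3 = 0 -> qre w1 = 0 -> qre w2 = 0 -> qre w3 = 0 ->
  same_gram u1 u2 u3 w1 w2 w3 ->
  exists c (e : int), [/\ c != 0, e * e = 1, u1 * c = e%:~R *: (c * w1),
    u2 * c = e%:~R *: (c * w2) & u3 * c = e%:~R *: (c * w3)].
Proof.
move=> t0 p1 p2 p3 q1 q2 q3 [[d11 d22 d33] [d12 d13 d23]].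
set t := trip u1 u2 u3 in t0.
(* By Cramer's rule [f] is the linear map sending each u to the corresponding w; it preserves [dot]
   on pure quaternions. *)
pose f h := (t^-1 * trip h u2 u3) *: w1 + (t^-1 * trip u1 h u3) *: w2 + (t^-1 * trip u1 u2 h) *: w3.
have fre h : qre (f h) = 0 by rewrite /f /= q1 q2 q3; ring.
have fD h : qre h = 0 -> f h = qi h *: f i_ + qj h *: f j_ + qk h *: f k_.
  by move=> _; apply: quat_eq; rewrite /f /trip /=; ring.
have uE h : qre h = 0 -> h = (t^-1 * trip h u2 u3) *: u1 + (t^-1 * trip u1 h u3) *: u2 + (t^-1 * trip u1 u2 h) *: u3.
  move=> ph; have := trip_expand p1 p2 p3 ph; rewrite -/t => /(congr1 (fun x => t^-1 *: x)).
  by rewrite scalerA mulVf// scale1r !scalerDr !scalerA.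
have fdot h k : qre h = 0 -> qre k = 0 -> dot (f h) (f k) = dot h k.
  move=> ph pk; rewrite [in RHS](uE h ph) [in RHS](uE k pk) /f.
  by rewrite !dot_comb3 d11 d22 d33 d12 d13 d23.
have f1 : f u1 = w1.
  have -> : f u1 = 1 *: w1 + 0 *: w2 + 0 *: w3.
    rewrite /f -/t mulVf//; congr (_ + _ *: _ + _ *: _); rewrite /trip; ring.
  by rewrite scale1r !scale0r !addr0.
have f2 : f u2 = w2.
  have -> : f u2 = 0 *: w1 + 1 *: w2 + 0 *: w3.
    rewrite /f -/t mulVf//; congr (_ *: _ + _ + _ *: _); rewrite /trip; ring.
  by rewrite scale1r !scale0r add0r addr0.
have f3 : f u3 = w3.
  have -> : f u3 = 0 *: w1 + 0 *: w2 + 1 *: w3.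
    rewrite /f -/t mulVf//; congr (_ *: _ + _ *: _ + _); rewrite /trip; ring.
  by rewrite scale1r !scale0r !add0r.
clearbody f.
have dI : dot (f i_) (f i_) = - a by rewrite fdot// /dot /=; ring.
have dJ : dot (f j_) (f j_) = - b by rewrite fdot// /dot /=; ring.
have dK : dot (f k_) (f k_) = a * b by rewrite fdot// /dot /=; ring.
have dIJ : dot (f i_) (f j_) = 0 by rewrite fdot// /dot /=; ring.
have dIK : dot (f i_) (f k_) = 0 by rewrite fdot// /dot /=; ring.
have dJK : dot (f j_) (f k_) = 0 by rewrite fdot// /dot /=; ring.
have [IJ KE] := orthogonal_frame (fre _) (fre _) (fre _) dI dJ dK dIJ dIK dJK.
have I2 : f i_ * f i_ = a%:A by rewrite (pure_sqr (fre _)) dI opprK.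
have J2 : f j_ * f j_ = b%:A by rewrite (pure_sqr (fre _)) dJ opprK.
have [e [e2 {}KE]] : exists e : int, e * e = 1 /\ f k_ = e%:~R *: (f i_ * f j_).
  case: KE => ->; [exists 1|exists (- 1)]; split=> //; first by rewrite scale1r.
  by rewrite rmorphN scaleN1r.
have e2r : e%:~R * e%:~R = 1 :> rat by rewrite -rmorphM e2.
(* The map [e] [f] preserves orientation, so it respects the relation i j = k and extends to an
   algebra embedding. *)
have [||| c [cn ci cj]] := @intertwiner (e%:~R *: f i_) (e%:~R *: f j_).
- by rewrite -scalerAl -scalerAr scalerA e2r scale1r.
- by rewrite -scalerAl -scalerAr scalerA e2r scale1r.
- by rewrite -!scalerAl -!scalerAr IJ !scalerN.
have ck : k_ * c = c * (e%:~R *: f k_).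
  have {1}-> : k_ = i_ * j_ by apply: quat_eq; rewrite /=; ring.
  by rewrite KE -mulrA cj mulrA ci -!mulrA -!scalerAl -!scalerAr !scalerA.
have cf h : qre h = 0 -> h * c = e%:~R *: (c * f h).
  move=> ph; have {1}-> : h = qi h *: i_ + qj h *: j_ + qk h *: k_.
    by apply: quat_eq; rewrite /= ?ph; ring.
  rewrite !mulrDl -!scalerAl ci cj ck (fD h ph) !mulrDr !scalerDr -!scalerAr !scalerA.
  by congr (_ *: _ + _ *: _ + _ *: _); rewrite mulrC.
by exists c, e; split=> //; rewrite cf ?f1 ?f2 ?f3.
Qed.

(** The Gross lattice gives the conjugate y of x only up to a half-integer: y = x' + (m + t) / 2
    with x' in O'. The norms of y and x' are both integers, and this forces m + t to be even. *)
Lemma gross_conj_order O O' c : is_order O -> is_order O' -> c != 0 ->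
  (forall h, gross_lattice O h -> gross_lattice O' (c^-1 * h * c)) ->
  forall x, O x -> O' (c^-1 * x * c).
Proof.
move=> HO HO' cn HL x Ox; have cu := quat_unit_neq0 cn.
have /intrP[n nE] := order_qnr_int HO Ox; have /intrP[t tE] := order_qtr_int HO Ox.
set y := c^-1 * x * c.
have nc : qnr (c^-1) * qnr c = 1 by rewrite -qnrM mulVr// qnr1.
have ny : qnr y = n%:~R by rewrite /y !qnrM nE mulrAC nc mul1r.
have ty : qre y = qre x.
  have qreC u v : qre (u * v) = qre (v * u) by rewrite /=; ring.
  by rewrite /y -mulrA qreC -mulrA mulrV// mulr1.
have Lh : gross_lattice O (2 *: x - t%:~R%:A).
  split; first by rewrite qtr_re /=; move: tE; rewrite qtr_re => <-; ring.
  exists x => //; exists (- t); rewrite scaler_nat rmorphN /= -scaler_int.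
  by [].
have [_ [x' Ox' [m mE]]] := HL _ Lh.
have yE : 2 *: y = 2 *: x' + (m + t)%:~R%:A.
  move: mE; rewrite mulrBr mulrBl -!scalerAr -!scalerAl mulr1 mulVr// -/y.
  rewrite -scaler_nat -scaler_int => /(canRL (subrK _)) ->.
  by rewrite -addrA -scalerDl -rmorphD.
have /intrP[t' t'E] := order_qtr_int HO' Ox'; have /intrP[n' n'E] := order_qnr_int HO' Ox'.
pose s : rat := (m + t)%:~R / 2.
have {}yE : y = x' + s%:A.
  have := congr1 (fun z => (2^-1 : rat) *: z) yE.
  by rewrite scalerDr !scalerA mulVf// !scale1r /s [_ / 2]mulrC.
have t'm : t' = - m.
  apply: (@intr_inj rat); rewrite rmorphN /= -t'E qtr_re.
  have := congr1 (@qre _ a b) yE; rewrite ty /=; move: tE; rewrite qtr_re /s rmorphD /= => <-.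
  lra.
have par : (m + t) * (m + t + 2 * t') = 4 * (n - n').
  apply: (@intr_inj rat); rewrite !rmorphM !rmorphD /= rmorphM rmorphN /= -ny -n'E -t'E.
  have -> : qnr y = qnr x' + s * qtr x' + s ^+ 2.
    by rewrite yE /qnr /qtr /=; ring.
  by rewrite /s rmorphD /=; field.
have : (2%:Z %| m + t)%Z.
  have : (2%:Z %| (m + t) * (m + t))%Z.
    have -> : (m + t) * (m + t) = 2 * (2 * (n - n') - (m + t) * t').
      by rewrite mulrBr mulrA -[2 * 2]/(4%:Z) -par; ring.
    exact: dvdz_mulr.
  by rewrite !dvdzE abszM Euclid_dvdM// orbb.
move=> /dvdzP[r rE]; rewrite yE /s rE rmorphM /= mulfK//.
by apply: (orderD HO' Ox'); exact: order_scalar.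
Qed.

Lemma conj_same_type O O' c : c != 0 ->
  (forall x, O x -> O' (c^-1 * x * c)) -> (forall y, O' y -> O (c * y * c^-1)) ->
  same_type O O' /\ isomorphic_orders O O'.
Proof.
move=> cn f g; have cu := quat_unit_neq0 cn.
have E : O' = [set c^-1 * x * c | x in O].
  apply/seteqP; split=> [y O'y|_ [x Ox <-]]; last exact: f.
  exists (c * y * c^-1); first exact: g.
  by rewrite !mulrA mulVr// mul1r -mulrA mulVr// mulr1.
split; first by exists c.
exists (fun x => c^-1 * x * c); split.
- split=> [x Ox||y]; first exact: f.
  + move=> x y _ _ /= /(congr1 (fun z => c * z * c^-1)).
    by rewrite !mulrA mulrV// !mul1r -!mulrA mulrV// !mulr1.
  + by rewrite E.
- by rewrite mulr1 mulVr.
- by move=> x y _ _; rewrite mulrDr mulrDl.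
- by move=> x y _ _; rewrite !mulrA mulrK.
Qed.

End Conjugation.

Lemma dominates_same_type (R : realType) (p : nat) (a b : rat) (O O' : set (quat a b)) : prime p ->
  ramified_exactly_at_p_oo R p a b -> maximal_order O -> maximal_order O' -> dominates O' O ->
  same_type O O' /\ isomorphic_orders O O'.
Proof.
move=> hp hB mO mO' dom.
have a0 := ram_a_lt0 hB; have b0 := ram_b_lt0 hB.
have F := maximal_gross_facts hp hB mO; have F' := maximal_gross_facts hp hB mO'.
have [Phi inj] := dominates_injection hp hB mO mO' dom.
have [u1 [u2 [u3 [w1 [w2 [w3 [U W G]]]]]]] := gram_match hp a0 b0 F F' inj.
have PL := gf_pure F; have PL' := gf_pure F'.
have [U1 U2 U3 Ug] := U; have [W1 W2 W3 Wg] := W.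
have t0 := gram3_trip_neq0 hp F U.
have [c [e [cn e2 c1 c2 c3]]] := isometry_conj a0 b0 t0 (pl_pure PL U1) (pl_pure PL U2) (pl_pure PL U3)
  (pl_pure PL' W1) (pl_pure PL' W2) (pl_pure PL' W3) G.
have cu := quat_unit_neq0 a0 b0 cn.
have cz z1 z2 z3 : icomb3 u1 u2 u3 z1 z2 z3 * c = c * (e%:~R *: icomb3 w1 w2 w3 z1 z2 z3).
  rewrite /icomb3 !mulrDl -!scalerAl c1 c2 c3 -scalerAr !mulrDr !scalerDr -!scalerAr !scalerA.
  by congr (_ *: _ + _ *: _ + _ *: _); rewrite mulrC.
apply: (@conj_same_type _ _ a0 b0 _ _ c cn).
  apply: (gross_conj_order a0 b0 mO.1 mO'.1 cn) => h /Ug[z1 [z2 [z3 ->]]].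
  rewrite -mulrA cz mulrA mulVr// mul1r; apply: (plZ PL').
  by rewrite /icomb3; do !apply: (plD PL'); exact: (plZ PL').
have cVn : c^-1 != 0 by rewrite invr_eq0.
have := @gross_conj_order _ _ a0 b0 O' O c^-1 mO'.1 mO.1 cVn; rewrite invrK; apply.
move=> h /Wg[z1 [z2 [z3 ->]]].
have e2r : e%:~R * e%:~R = 1 :> rat by rewrite -rmorphM e2.
have -> : c * icomb3 w1 w2 w3 z1 z2 z3 = e%:~R *: (icomb3 u1 u2 u3 z1 z2 z3 * c).
  by rewrite cz -scalerAr scalerA e2r scale1r.
rewrite -scalerAl -mulrA mulrV// mulr1; apply: (plZ PL).
by rewrite /icomb3; do !apply: (plD PL); exact: (plZ PL).
Qed.

Theorem theorem1p2 (R : realType) (p : nat) (hp : prime p) (a b : rat)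
    (hB : ramified_exactly_at_p_oo R p a b) :
  (forall O O' : set (quat a b), maximal_order O -> maximal_order O' ->
     dominates O' O -> isomorphic_orders O O' /\ same_type O O') /\
  (forall (Out : Type) (A : procedure (max_order a b) Out),
     halting_criterion A -> forall O : max_order a b, halts_on A O).
Proof.
split=> [O O' mO mO' /(dominates_same_type hp hB mO mO')[]//|Out A crit [O mO]].
apply: crit => -[[O' mO'] /= [nsame dom]]; apply: nsame.
by have [] := dominates_same_type hp hB mO mO' dom.
Qed.
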